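(* Let $(M,L)$ be a Finsler manifold with $\dim M\geq3$. Suppose that the $h$-curvature tensor $R$ of the Cartan connection satisfies, for all $\pi$-vector fields $\overline{X},\overline{Y},\overline{Z}$, $$R(\overline{X},\overline{Y})\overline{Z}=k\big\{g(\overline{X},\overline{Z})\overline{Y}-g(\overline{Y},\overline{Z})\overline{X}+\omega(\overline{X},\overline{Y})\overline{Z}\big\},$$ where $\omega$ is an indicatory $\pi$-tensor field of type $(1,3)$, antisymmetric in $\overline{X},\overline{Y}$ and homogeneous of degree $0$ in $y$, and $k(x,y)$ is a smooth function on $\mathcal{T}M$ homogeneous of degree $0$ in $y$. Then: (a) $k$ is a constant. (b) If $k\neq0$, then for all $\pi$-vector fields $\overline{X},\overline{Y},\overline{Z}$: 1) $P(\overline{X},\overline{Y})\overline{Z}-P(\overline{Y},\overline{X})\overline{Z}=L^{-2}(\nabla_{\beta\overline{\eta}}\omega)(\overline{X},\overline{Y},\overline{Z})$; 2) $S(\overline{X},\overline{Y})\overline{Z}=\dfrac{1}{L^{2}}\Big\{\dfrac{1}{2kL^{2}}(\stackrel{1}{\nabla}\stackrel{1}{\nabla}\omega)(\overline{\eta},\overline{\eta},\overline{X},\overline{Y},\overline{Z})+\omega(\overline{X},\overline{Y})\overline{Z}\Big\}$.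
   Context: $M$ is a connected smooth manifold, $\mathcal{T}M=TM\setminus 0$ is the bundle of nonzero tangent vectors, $\pi:\mathcal{T}M\to M$ the projection, and $\pi^{-1}(TM)\to\mathcal{T}M$ the pullback bundle. Sections of $\pi^{-1}(TM)$ are called $\pi$-vector fields (written $\overline{X},\overline{Y},\dots$); tensor fields on $\pi^{-1}(TM)$ are called $\pi$-tensor fields. The fundamental $\pi$-vector field is $\overline{\eta}(u)=(u,u)$. There is an exact sequence $0\to\pi^{-1}(TM)\xrightarrow{\gamma}T(\mathcal{T}M)\xrightarrow{\rho}\pi^{-1}(TM)\to0$, where $\gamma(u,v)=\frac{d}{dt}|_{t=0}(u+tv)$ and $\rho(X)=(u,d\pi(X))$ for $X\in T_u(\mathcal{T}M)$. $L$ is the Finsler function and $g$ the Finsler metric on $\pi^{-1}(TM)$ defined by $L$ (in coordinates $g_{ij}=\frac12\partial^2L^2/\partial y^i\partial y^j$), so $g(\overline{\eta},\overline{\eta})=L^2$. A connection $\nabla$ on $\pi^{-1}(TM)$ has connection map $K(X)=\nabla_X\overline{\eta}$, $X\in T(\mathcal{T}M)$; it is regular if $T(\mathcal{T}M)=\ker d\pi\oplus\ker K$, and then its horizontal map is $\beta:=(\rho|_{\ker K})^{-1}$. Its torsion is $\mathbf{T}(X,Y)=\nabla_X\rho Y-\nabla_Y\rho X-\rho[X,Y]$ and its curvature is, with the sign convention $\mathbf{K}(X,Y)\overline{Z}=-\nabla_X\nabla_Y\overline{Z}+\nabla_Y\nabla_X\overline{Z}+\nabla_{[X,Y]}\overline{Z}$.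 Put $Q(\overline{X},\overline{Y})=\mathbf{T}(\beta\overline{X},\beta\overline{Y})$ and $T(\overline{X},\overline{Y})=\mathbf{T}(\gamma\overline{X},\beta\overline{Y})$. The Cartan connection of $(M,L)$ is the unique regular connection $\nabla$ on $\pi^{-1}(TM)$ with $\nabla g=0$, $Q=0$ and $g(T(\overline{X},\overline{Y}),\overline{Z})=g(T(\overline{X},\overline{Z}),\overline{Y})$. All objects refer to it. The $h$-, $hv$- and $v$-curvature tensors are $R(\overline{X},\overline{Y})\overline{Z}=\mathbf{K}(\beta\overline{X},\beta\overline{Y})\overline{Z}$, $P(\overline{X},\overline{Y})\overline{Z}=\mathbf{K}(\beta\overline{X},\gamma\overline{Y})\overline{Z}$, $S(\overline{X},\overline{Y})\overline{Z}=\mathbf{K}(\gamma\overline{X},\gamma\overline{Y})\overline{Z}$. A $\pi$-tensor field (or function) $A$ is homogeneous of degree $0$ in $y$ (written $h(0)$) if $\nabla_{\gamma\overline{\eta}}A=0$. A $\pi$-tensor field is indicatory if it vanishes whenever one of its arguments is $\overline{\eta}$. We write $\omega(\overline{X},\overline{Y},\overline{Z})=\omega(\overline{X},\overline{Y})\overline{Z}$. $\stackrel{1}{\nabla}$ is the $h$-covariant derivative, $(\stackrel{1}{\nabla}A)(\overline{W},\dots)=(\nabla_{\beta\overline{W}}A)(\dots)$; since $\nabla_{\beta\overline{\eta}}\overline{\eta}=0$, $(\stackrel{1}{\nabla}\stackrel{1}{\nabla}\omega)(\overline{\eta},\overline{\eta},\overline{X},\overline{Y},\overline{Z})=(\nabla_{\beta\overline{\eta}}\nabla_{\beta\overline{\eta}}\omega)(\overline{X},\overline{Y},\overline{Z})$.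 *)

(* Defs.v *)
From HB Require Import structures.
From mathcomp Require Import all_boot all_order all_algebra.
From mathcomp Require Import all_classical all_reals all_analysis.

Set Implicit Arguments.
Unset Strict Implicit.
Unset Printing Implicit Defensive.

Import Order.TTheory GRing.Theory Num.Theory.
Import numFieldNormedType.Exports.

Local Open Scope classical_set_scope.
Local Open Scope ring_scope.

(** * Smooth manifolds *)

(** C^oo on an open set of a finite-dimensional space: all iterated directional
    derivatives exist and are (Frechet) differentiable. *)
Definition smooth_on (R : realType) (V W : normedModType R) (U : set V)
    (f : V -> W) : Prop :=
  forall (vs : seq V) (x : V), U x ->
    differentiable (foldr (fun v (h : V -> W) => 'D_v h) f vs) x.

Record chart (R : realType) (n : nat) (T : topologicalType) := Chart {
  chart_dom : set T;
  chart_coord : T -> 'rV[R]_n;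
  chart_param : 'rV[R]_n -> T;
  dom_open : open chart_dom;
  img_open : open (chart_coord @` chart_dom);
  coordK : forall p, chart_dom p -> chart_param (chart_coord p) = p;
  coord_continuous : forall p, chart_dom p -> {for p, continuous chart_coord};
  param_continuous : forall x, (chart_coord @` chart_dom) x ->
    {for x, continuous chart_param} }.

Record manifold (R : realType) (n : nat) := Manifold {
  carrier :> topologicalType;
  atlas : set (chart R n carrier);
  manifold_hausdorff : hausdorff_space carrier;
  manifold_countable : @second_countable carrier;
  atlas_cover : forall p : carrier, exists2 c, atlas c & chart_dom c p;
  atlas_smooth : forall c d, atlas c -> atlas d ->
    smooth_on (chart_coord c @` (chart_dom c `&` chart_dom d))
      (chart_coord d \o chart_param c) }.

Arguments atlas {R n} _.

(** * Tangent vectors and vector fields as derivations *)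

(** In the next definitions [C] is the algebra of smooth functions on [T]. *)

Notation vec R T := ((T -> R) -> R).

(** A vector is only meaningful on smooth functions; the last clause makes
    Leibniz equality of vectors the equality of derivations. *)
Definition tangent (R : realType) (T : Type) (C : set (T -> R)) (p : T)
    (w : vec R T) : Prop :=
  [/\ forall (a : R) f h, C f -> C h ->
        w (fun q => a * f q + h q) = a * w f + w h,
      forall f h, C f -> C h -> w (fun q => f q * h q) = f p * w h + h p * w f
    & forall f, ~ C f -> w f = 0].

Definition cut_smooth (R : realType) (T : Type) (C : set (T -> R))
    (w : vec R T) : vec R T :=
  fun f => if `[< C f >] then w f else 0.

(** Smooth vector fields along [phi : T' -> T]. *)
Definition field_along (R : realType) (T' T : Type) (C' : set (T' -> R))
    (C : set (T -> R)) (phi : T' -> T) (s : T' -> vec R T) : Prop :=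
  (forall u, tangent C (phi u) (s u)) /\ (forall f, C f -> C' (fun u => s u f)).

Section SlitBundle.
Context (R : realType) (n : nat) (M : manifold R n).

Definition smoothM : set (M -> R) :=
  [set f : M -> R | forall c, atlas M c ->
     smooth_on (chart_coord c @` chart_dom c) (f \o chart_param c)].

(** [slit] is the bundle of nonzero tangent vectors. *)
Definition slit : Type :=
  {u : M * vec R M | `[< tangent smoothM u.1 u.2 /\ u.2 <> 0 >]}.

Definition slit_proj (u : slit) : M := (val u).1.

(** The fundamental pi-vector field. *)
Definition eta_field (u : slit) : vec R M := (val u).2.

(** The tangent vector with components [y] in the chart [c], at the point of
    coordinates [x]. *)
Definition coord_vec (c : chart R n M) (x y : 'rV[R]_n) : vec R M :=
  cut_smooth smoothM (fun f => 'D_y (f \o chart_param c) x).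

Definition slit_param (c : chart R n M) (z : 'rV[R]_n * 'rV[R]_n) :
    option slit :=
  insub (chart_param c z.1, coord_vec c z.1 z.2).

Definition smoothT : set (slit -> R) :=
  [set F : slit -> R | forall c, atlas M c ->
     smooth_on [set z : 'rV[R]_n * 'rV[R]_n |
                 (chart_coord c @` chart_dom c) z.1 /\ z.2 <> 0]
       (fun z => oapp F 0 (slit_param c z))].

Definition vfield : (slit -> vec R slit) -> Prop :=
  field_along smoothT smoothT id.

Definition pi_field : (slit -> vec R M) -> Prop :=
  field_along smoothT smoothM slit_proj.

Definition lie_bracket (X Y : slit -> vec R slit) : slit -> vec R slit :=
  fun u F => X u (fun w => Y w F) - Y u (fun w => X w F).

(** [translate u v t] is [u + t v] whenever this is nonzero, in particular for
    all [t] near [0]. *)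
Definition translate (u : slit) (v : vec R M) (t : R) : slit :=
  insubd u (slit_proj u, eta_field u + t *: v).

Definition fibre_deriv (v : vec R M) (F : slit -> R) (u : slit) : R :=
  derive1 (fun t : R => F (translate u v t)) 0.

Definition gamma_map (u : slit) (v : vec R M) : vec R slit :=
  cut_smooth smoothT (fun F => fibre_deriv v F u).

Definition rho_map (w : vec R slit) : vec R M :=
  cut_smooth smoothM (fun f => w (f \o slit_proj)).

(** * Finsler structures *)

(** The fibrewise Hessian of [L^2 / 2], i.e. [g_ij = d^2(L^2)/dy^i dy^j / 2]. *)
Definition finsler_metric (L : slit -> R) (u : slit) (v w : vec R M) : R :=
  2^-1 * fibre_deriv v (fibre_deriv w (fun u' => L u' ^+ 2)) u.

Definition finsler (L : slit -> R) : Prop :=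
  [/\ smoothT L,
      forall u, 0 < L u,
      forall u u' (a : R), 0 < a -> slit_proj u' = slit_proj u ->
        eta_field u' = a *: eta_field u -> L u' = a * L u
    & forall u v, tangent smoothM (slit_proj u) v -> v <> 0 ->
        0 < finsler_metric L u v v].

(** * Connections on the pullback bundle *)

(** [nabla u w s] is the covariant derivative at [u] of the pi-vector field [s]
    in the direction of the vector [w], tangent to the slit bundle at [u]. *)
Definition connection_map : Type :=
  forall u : slit, vec R slit -> (slit -> vec R M) -> vec R M.

Definition cov (nabla : connection_map) (X : slit -> vec R slit)
    (s : slit -> vec R M) : slit -> vec R M :=
  fun u => nabla u (X u) s.

Definition is_connection (nabla : connection_map) : Prop :=
  [/\ forall u (a : R) w w' s,
        tangent smoothT u w -> tangent smoothT u w' -> pi_field s ->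
        nabla u (a *: w + w') s = a *: nabla u w s + nabla u w' s,
      forall u w s s', tangent smoothT u w -> pi_field s -> pi_field s' ->
        nabla u w (s + s') = nabla u w s + nabla u w s',
      forall u w f s, tangent smoothT u w -> smoothT f -> pi_field s ->
        nabla u w (fun u' => f u' *: s u') = f u *: nabla u w s + w f *: s u
    & (forall u w s, tangent smoothT u w -> pi_field s ->
         tangent smoothM (slit_proj u) (nabla u w s)) /\
      (forall X s, vfield X -> pi_field s -> pi_field (cov nabla X s))].

Section WithConnection.
Variable nabla : connection_map.

Definition Kmap (u : slit) (w : vec R slit) : vec R M := nabla u w eta_field.

Definition vertical (u : slit) : set (vec R slit) :=
  [set w | tangent smoothT u w /\ rho_map w = 0].

Definition horizontal (u : slit) : set (vec R slit) :=
  [set w | tangent smoothT u w /\ Kmap u w = 0].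

Definition is_regular : Prop :=
  forall u,
    (forall w, tangent smoothT u w -> exists v h,
       [/\ vertical u v, horizontal u h & w = v + h]) /\
    (forall w, vertical u w -> horizontal u w -> w = 0).

(** The horizontal map, inverse of [rho_map] restricted to the
    kernel of [Kmap]. *)
Definition beta_map (u : slit) (v : vec R M) : vec R slit :=
  xget 0 [set w | horizontal u w /\ rho_map w = v].

Definition hor (X : slit -> vec R M) : slit -> vec R slit :=
  fun u => beta_map u (X u).

Definition ver (X : slit -> vec R M) : slit -> vec R slit :=
  fun u => gamma_map u (X u).

Definition rho_field (X : slit -> vec R slit) : slit -> vec R M :=
  fun u => rho_map (X u).

Definition torsion (X Y : slit -> vec R slit) : slit -> vec R M :=
  cov nabla X (rho_field Y) - cov nabla Y (rho_field X)
  - rho_field (lie_bracket X Y).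

Definition curvature (X Y : slit -> vec R slit) (Z : slit -> vec R M) :
    slit -> vec R M :=
  - cov nabla X (cov nabla Y Z) + cov nabla Y (cov nabla X Z)
  + cov nabla (lie_bracket X Y) Z.

Definition Qtorsion (X Y : slit -> vec R M) := torsion (hor X) (hor Y).
Definition Ttorsion (X Y : slit -> vec R M) := torsion (ver X) (hor Y).

Definition Rcurv (X Y Z : slit -> vec R M) := curvature (hor X) (hor Y) Z.
Definition Pcurv (X Y Z : slit -> vec R M) := curvature (hor X) (ver Y) Z.
Definition Scurv (X Y Z : slit -> vec R M) := curvature (ver X) (ver Y) Z.

Definition is_cartan (L : slit -> R) : Prop :=
  let g := finsler_metric L in
  [/\ is_connection nabla,
      is_regular,
      forall u w Y Z, tangent smoothT u w -> pi_field Y -> pi_field Z ->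
        w (fun u' => g u' (Y u') (Z u')) =
          g u (nabla u w Y) (Z u) + g u (Y u) (nabla u w Z),
      forall X Y, pi_field X -> pi_field Y -> Qtorsion X Y = 0
    & forall X Y Z u, pi_field X -> pi_field Y -> pi_field Z ->
        g u (Ttorsion X Y u) (Z u) = g u (Ttorsion X Z u) (Y u)].

(** Covariant derivatives of vector-valued pi-tensor fields with three and four
    arguments, seen as maps on pi-vector fields. *)
Definition cov3 (X : slit -> vec R slit)
    (A : (slit -> vec R M) -> (slit -> vec R M) -> (slit -> vec R M) ->
         slit -> vec R M)
    (Y Z W : slit -> vec R M) : slit -> vec R M :=
  cov nabla X (A Y Z W)
  - A (cov nabla X Y) Z W - A Y (cov nabla X Z) W - A Y Z (cov nabla X W).

Definition cov4 (X : slit -> vec R slit)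
    (A : (slit -> vec R M) -> (slit -> vec R M) -> (slit -> vec R M) ->
         (slit -> vec R M) -> slit -> vec R M)
    (V Y Z W : slit -> vec R M) : slit -> vec R M :=
  cov nabla X (A V Y Z W) - A (cov nabla X V) Y Z W
  - A V (cov nabla X Y) Z W - A V Y (cov nabla X Z) W - A V Y Z (cov nabla X W).

Definition hcov3
    (A : (slit -> vec R M) -> (slit -> vec R M) -> (slit -> vec R M) ->
         slit -> vec R M)
    (V X Y Z : slit -> vec R M) : slit -> vec R M :=
  cov3 (hor V) A X Y Z.

Definition hcov4
    (A : (slit -> vec R M) -> (slit -> vec R M) -> (slit -> vec R M) ->
         (slit -> vec R M) -> slit -> vec R M)
    (U V X Y Z : slit -> vec R M) : slit -> vec R M :=
  cov4 (hor U) A V X Y Z.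

End WithConnection.

(** * pi-tensor fields of type (1,3) *)

Definition tensor13 : Type :=
  slit -> vec R M -> vec R M -> vec R M -> vec R M.

Definition tensor_on_fields (omega : tensor13) (X Y Z : slit -> vec R M) :
    slit -> vec R M :=
  fun u => omega u (X u) (Y u) (Z u).

Definition pi_tensor13 (omega : tensor13) : Prop :=
  (forall u, let Tu := tangent smoothM (slit_proj u) in
     [/\ forall x y z, Tu x -> Tu y -> Tu z -> Tu (omega u x y z),
         forall (a : R) x x' y z, Tu x -> Tu x' -> Tu y -> Tu z ->
           omega u (a *: x + x') y z = a *: omega u x y z + omega u x' y z,
         forall (a : R) x y y' z, Tu x -> Tu y -> Tu y' -> Tu z ->
           omega u x (a *: y + y') z = a *: omega u x y z + omega u x y' z
       & forall (a : R) x y z z', Tu x -> Tu y -> Tu z -> Tu z' ->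
           omega u x y (a *: z + z') = a *: omega u x y z + omega u x y z']) /\
  (forall X Y Z, pi_field X -> pi_field Y -> pi_field Z ->
     pi_field (tensor_on_fields omega X Y Z)).

Definition indicatory (omega : tensor13) : Prop :=
  forall u x y, tangent smoothM (slit_proj u) x ->
    tangent smoothM (slit_proj u) y ->
    [/\ omega u (eta_field u) x y = 0, omega u x (eta_field u) y = 0
      & omega u x y (eta_field u) = 0].

Definition skew12 (omega : tensor13) : Prop :=
  forall u x y z, tangent smoothM (slit_proj u) x ->
    tangent smoothM (slit_proj u) y ->
    tangent smoothM (slit_proj u) z -> omega u x y z = - omega u y x z.

Definition homogeneous0_tensor (nabla : connection_map) (omega : tensor13) :
    Prop :=
  forall X Y Z, pi_field X -> pi_field Y -> pi_field Z ->
    cov3 nabla (ver eta_field) (tensor_on_fields omega) X Y Z = 0.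

Definition homogeneous0_fun (k : slit -> R) : Prop :=
  forall u, gamma_map u (eta_field u) k = 0.

End SlitBundle.

(* Main.v *)
Require Import Defs.
From HB Require Import structures.
From mathcomp Require Import all_boot all_order all_algebra.
From mathcomp Require Import all_classical all_reals all_analysis.
From mathcomp Require Import ring lra.

Set Implicit Arguments.
Unset Strict Implicit.
Unset Printing Implicit Defensive.

Import Order.TTheory GRing.Theory Num.Theory.
Import numFieldNormedType.Exports.

Local Open Scope classical_set_scope.
Local Open Scope ring_scope.

(** Write [P^(X,Y) = P(X,Y)eta], [D] for the covariant derivative along [beta eta],
    [L2 = g(eta,eta)].  The metric conditions make the torsion [T] totally symmetric
    with [T(eta,.) = 0], so the connection map inverts [gamma].  The first Bianchi
    identity paired with [eta] gives [P^(X,Y) = (D T)(Y,X)], which is symmetric, and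
    the skewness of curvature operators gives [P(eta,.) = P(.,eta) = 0],
    [S(eta,.) = 0] and [S(X,Y)eta = 0].  Inserting the hypothesis on [R] into the
    second Bianchi identity yields the two equations

      (beta eta k) Om(Y,Z)W + (beta Y k) Om(Z,eta)W + (beta Z k) Om(eta,Y)W
        + k (D omega)(Y,Z)W + k L2 (P(Z,Y)W - P(Y,Z)W) = 0,
      (gamma X k) Om(Y,eta)W + k omega(X,Y)W + k (g(T(X,Y),W) eta - g(eta,W) T(X,Y))
        - (D P)(Y,X)W + k L2 S(Y,X)W = 0,

    where [R = k Om].  At [W = eta] the second one, antisymmetrized in [X] and [Y],
    kills the vertical derivatives of [k], since a nonzero vector orthogonal to both
    [X] and [eta] exists in dimension at least 3.  So [k] is a function on [M], and
    the first one at [W = eta] reads [L2 (X k) = (u k) g(u,X)] for all [u]; choosing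
    [u] in the kernel of [dk] gives [dk = 0].  Once [k] is a nonzero constant, the
    first equation is b.1, and the second, antisymmetrized in [X] and [Y] and
    combined with b.1, is b.2. *)

(** * Smooth functions *)

(** Vectors are derivations of the algebra of globally defined smooth functions, and tensors act on
    global smooth fields. So nothing can be computed in a chart before local objects have been
    extended by bump functions, and derivations identified with partial derivatives by Hadamard's
    lemma. The horizontal map [beta_map] is picked pointwise by choice; that it carries smooth
    fields to smooth fields has to be proved, by Cramer's rule, before any bracket of horizontal
    lifts can be formed. The symmetry of [T] is seen on fields pulled back from [M]: there [T] is
    half the vertical derivative of [g], hence a third fibre derivative of [L ^+ 2]. The vanishing
    of [T] on [eta] is Euler's relation for the fibre Hessian, which has degree 0. The vanishing of
    P(eta,.), P(.,eta) and S(eta,.) has one source: the torsion formulas make an expression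
    symmetric, compatibility with the metric makes it skew, in the same pair of arguments or in
    overlapping pairs. The dimension is used once more to join two vectors of a punctured fibre by
    segments that miss zero. *)

Section Differentiability.
Context {R : realType} {V W : normedModType R}.

(** Unpacks the little-o definition of the differential once and for all. The explicit estimate
    serves where no rule of calculus applies: flat functions at the origin and integrals depending
    on a parameter. *)
Lemma differentiable_approx (f : V -> W) (df : {linear V -> W}) (x : V) :
  continuous df ->
  (forall e : R, 0 < e -> \forall h \near (0 : V),
     `|f (h + x) - f x - df h| <= e * `|h|) ->
  differentiable f x /\ 'd f x = df :> (V -> W).
Proof.
move=> dfc fx.
have E : f \o shift x = cst (f x) + df +o_ (0 : V) id.
  apply/eqaddoP => e e0.
  near=> h; rewrite /= /cst opprD addrA; near: h; exact: fx.
split; last exact: diff_unique.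
by apply/diff_locallyP; rewrite (diff_unique dfc E); split.
Unshelve. all: by end_near. Qed.

Lemma differentiable_near_eq (f g : V -> W) (x : V) :
  (\near x, f x = g x) -> differentiable f x -> differentiable g x.
Proof.
move=> fg /[dup] df /diff_locallyP [dc] /eqaddoP E.
have fgx : f x = g x by exact: nbhs_singleton fg.
suff [] : differentiable g x /\ 'd g x = 'd f x :> (V -> W) by [].
apply: differentiable_approx => // e e0.
have fg0 : \forall h \near (0 : V), f (h + x) = g (h + x).
  by move: fg; rewrite (near_shift 0) => H; apply: filterS H => h /=; rewrite subr0.
have He := E e e0.
near=> h.
have <- : f (h + x) = g (h + x) by near: h.
rewrite -fgx.
have : `|f (h + x) - (f x + 'd f x h)| <= e * `|h| by near: h; exact: He.
by rewrite opprD addrA.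
Unshelve. all: by end_near. Qed.

End Differentiability.

Section SmoothCalculus.
Context {R : realType} {V : normedModType R}.
Implicit Types (U : set V).

(** The sequences of directions in [smooth_on] do not go through the product and chain rules, whose
    terms distribute the directions; counting the order allows induction. Order 0 already asks for
    differentiability. *)
Fixpoint Ck (W : normedModType R) (m : nat) U (f : V -> W) : Prop :=
  (forall x, U x -> differentiable f x) /\
  match m with 0 => True | m'.+1 => forall v, Ck m' U ('D_v f) end.

Lemma Ck_diff (W : normedModType R) m U (f : V -> W) :
  Ck m U f -> forall x, U x -> differentiable f x.
Proof. by case: m => [|m] []. Qed.

Lemma smooth_onP (W : normedModType R) U (f : V -> W) :
  smooth_on U f <-> forall m, Ck m U f.
Proof.
split=> [sf m|Cf vs].
  elim: m f sf => [|m IH] f sf /=; first by split=> // x; exact: (sf [::]).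
  split=> [x|v]; first exact: (sf [::]).
  (* [foldr] differentiates along the last direction of the sequence first, hence [rcons]. *)
  by apply: IH => vs x Ux; have := sf (rcons vs v) x Ux; rewrite foldr_rcons.
elim/last_ind: vs f Cf => [|vs v IH] f Cf x Ux; first exact: (Ck_diff (Cf 0%N)).
by rewrite foldr_rcons; apply: IH => // m; case: (Cf m.+1) => _; apply.
Qed.

Lemma smooth_on_diff (W : normedModType R) U (f : V -> W) x :
  smooth_on U f -> U x -> differentiable f x.
Proof. by move=> sf; exact: (sf [::]). Qed.

Lemma smooth_on_derive (W : normedModType R) U (f : V -> W) v :
  smooth_on U f -> smooth_on U ('D_v f).
Proof. by move=> sf vs x Ux; have := sf (rcons vs v) x Ux; rewrite foldr_rcons. Qed.

Lemma smooth_onS (W : normedModType R) U U' (f : V -> W) :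
  U `<=` U' -> smooth_on U' f -> smooth_on U f.
Proof. by move=> UU' sf vs x /UU'; exact: sf. Qed.

Lemma near_derive_eq (W : normedModType R) U (f g : V -> W) v : open U ->
  (forall x, U x -> f x = g x) -> forall x, U x -> 'D_v f x = 'D_v g x.
Proof.
move=> oU fg x Ux; apply: near_eq_derive.
by apply: filterS (open_nbhs_nbhs (conj oU Ux)) => y; exact: fg.
Qed.

Lemma Ck_congr (W : normedModType R) m U (f g : V -> W) : open U ->
  (forall x, U x -> f x = g x) -> Ck m U f -> Ck m U g.
Proof.
move=> oU; elim: m f g => [|m IH] f g fg /=; move=> [df Df].
  split=> // x Ux; apply: differentiable_near_eq (df x Ux).
  by apply: filterS (open_nbhs_nbhs (conj oU Ux)) => y; exact: fg.
split=> [x Ux|v].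
  apply: differentiable_near_eq (df x Ux).
  by apply: filterS (open_nbhs_nbhs (conj oU Ux)) => y; exact: fg.
by apply: (IH ('D_v f)) => // x; exact: near_derive_eq.
Qed.

Lemma smooth_on_congr (W : normedModType R) U (f g : V -> W) : open U ->
  (forall x, U x -> f x = g x) -> smooth_on U f -> smooth_on U g.
Proof. by move=> oU fg /smooth_onP sf; apply/smooth_onP => m; exact: (Ck_congr oU fg). Qed.

Lemma smooth_on_local (W : normedModType R) U (f : V -> W) :
  (forall x, U x -> exists2 U', open_nbhs x U' & smooth_on U' f) -> smooth_on U f.
Proof. by move=> H vs x /H[U' [_ U'x] sf]; exact: sf. Qed.

Lemma CkD (W : normedModType R) m U (f g : V -> W) : open U ->
  Ck m U f -> Ck m U g -> Ck m U (fun x => f x + g x).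
Proof.
move=> oU; elim: m f g => [|m IH] f g [df Df] [dg Dg] /=.
  by split=> // x Ux; apply: differentiableD; [exact: df|exact: dg].
split=> [x Ux|v]; first by apply: differentiableD; [exact: df|exact: dg].
apply: Ck_congr (IH _ _ (Df v) (Dg v)) => // x Ux.
by rewrite (@deriveD _ _ _ f g) //; apply: diff_derivable; [exact: df|exact: dg].
Qed.

Lemma Ck_cst (W : normedModType R) m U (c : W) : open U -> Ck m U (fun=> c).
Proof.
move=> oU; elim: m c => [|m IH] c /=; first by split=> // x _; exact: differentiable_cst.
split=> [x _|v]; first exact: differentiable_cst.
by apply: Ck_congr (IH 0) => // x Ux; rewrite derive_cst.
Qed.

Lemma CkM m U (f g : V -> R) : open U ->
  Ck m U f -> Ck m U g -> Ck m U (fun x => f x * g x).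
Proof.
move=> oU; elim: m f g => [|m IH] f g [df Df] [dg Dg] /=.
  by split=> // x Ux; apply: differentiableM; [exact: df|exact: dg].
split=> [x Ux|v]; first by apply: differentiableM; [exact: df|exact: dg].
(* The product rule contains the undifferentiated factors, so both must be lowered by one order
   before the induction hypothesis applies. *)
have lowf : Ck m U f.
  elim: {IH Dg dg} m f df Df => [|m IH] f df Df; first by split.
  by split=> // w; apply: IH; case: (Df w).
have lowg : Ck m U g.
  elim: {IH Df df lowf} m g dg Dg => [|m IH] g dg Dg; first by split.
  by split=> // w; apply: IH; case: (Dg w).
apply: Ck_congr (CkD oU (IH _ _ lowf (Dg v)) (IH _ _ lowg (Df v))) => // x Ux.
rewrite (@deriveM _ _ f g) //; [exact/diff_derivable/df|exact/diff_derivable/dg].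
Qed.

Lemma CkW (W : normedModType R) m U (f : V -> W) : Ck m.+1 U f -> Ck m U f.
Proof.
elim: m f => [|m IH] f [df Df]; first by split.
by split=> // v; apply: IH; exact: Df.
Qed.

(** The derivative of [1 / f] is the product of minus the derivative of [f] with two copies of
    [1 / f], so the induction runs on the order with [f] fixed. *)
Lemma CkV m U (f : V -> R) : open U -> (forall x, U x -> f x != 0) ->
  Ck m U f -> Ck m U (fun x => (f x)^-1).
Proof.
move=> oU f0; elim: m => [|m IH] Cf; have [df Df] := Cf.
  by split=> // x Ux; apply: differentiableV; [exact: df|exact: f0].
split=> [x Ux|v]; first by apply: differentiableV; [exact: df|exact: f0].
have iC := IH (CkW Cf).
have C1 : Ck m U (fun=> -1 : R) by exact: Ck_cst.
have H := CkM oU (CkM oU C1 (Df v)) (CkM oU iC iC).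
apply: (Ck_congr oU _ H) => x Ux.
rewrite (@deriveV _ _ f) ?f0 //; last exact/diff_derivable/df.
rewrite /GRing.scale /= -exprVn expr2; ring.
Qed.

Lemma smooth_onD (W : normedModType R) U (f g : V -> W) : open U ->
  smooth_on U f -> smooth_on U g -> smooth_on U (fun x => f x + g x).
Proof.
by move=> oU /smooth_onP sf /smooth_onP sg; apply/smooth_onP => m; exact: CkD.
Qed.

Lemma smooth_on_cst (W : normedModType R) U (c : W) : open U -> smooth_on U (fun=> c).
Proof. by move=> oU; apply/smooth_onP => m; exact: Ck_cst. Qed.

Lemma smooth_onM U (f g : V -> R) : open U ->
  smooth_on U f -> smooth_on U g -> smooth_on U (fun x => f x * g x).
Proof.
by move=> oU /smooth_onP sf /smooth_onP sg; apply/smooth_onP => m; exact: CkM.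
Qed.

Lemma smooth_onV U (f : V -> R) : open U -> (forall x, U x -> f x != 0) ->
  smooth_on U f -> smooth_on U (fun x => (f x)^-1).
Proof. by move=> oU f0 /smooth_onP sf; apply/smooth_onP => m; exact: CkV. Qed.

Lemma smooth_onZ U (a : R) (f : V -> R) : open U ->
  smooth_on U f -> smooth_on U (fun x => a * f x).
Proof. by move=> oU sf; apply: smooth_onM => //; exact: smooth_on_cst. Qed.

Lemma smooth_onB U (f g : V -> R) : open U ->
  smooth_on U f -> smooth_on U g -> smooth_on U (fun x => f x - g x).
Proof.
move=> oU sf sg; apply: smooth_on_congr (smooth_onD oU sf (smooth_onZ (-1) oU sg)) => // x _.
by rewrite mulN1r.
Qed.

Lemma Ck_sum m (I : Type) (r : seq I) U (f : I -> V -> R) : open U ->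
  (forall i, Ck m U (f i)) -> Ck m U (fun x => \sum_(i <- r) f i x).
Proof.
move=> oU sf; elim: r => [|i r IH].
  have C0 : Ck m U (fun=> 0 : R) by exact: Ck_cst.
  by apply: (Ck_congr oU _ C0) => x _; rewrite big_nil.
by apply: (Ck_congr oU _ (CkD oU (sf i) IH)) => x _; rewrite big_cons.
Qed.

Lemma smooth_on_sum (I : Type) (r : seq I) (P : pred I) U (f : I -> V -> R) : open U ->
  (forall i, smooth_on U (f i)) -> smooth_on U (fun x => \sum_(i <- r | P i) f i x).
Proof.
move=> oU sf; elim: r => [|i r IH].
  apply: (smooth_on_congr (f := fun=> 0 : R)) => //; last exact: smooth_on_cst.
  by move=> x _; rewrite big_nil.
case Pi : (P i); last first.
  by apply: smooth_on_congr IH => // x _; rewrite big_cons Pi.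
by apply: smooth_on_congr (smooth_onD oU (sf i) IH) => // x _; rewrite big_cons Pi.
Qed.

Lemma Ck_linear_comp (W W' : normedModType R) m U (l : {linear W -> W'}) (f : V -> W) :
  open U -> continuous l -> Ck m U f -> Ck m U (l \o f).
Proof.
move=> oU cl.
have dl f' x : differentiable f' x -> differentiable (l \o f') x.
  by move=> df; apply: differentiable_comp => //; exact: linear_differentiable.
elim: m f => [|m IH] f [df Df]; first by split=> // x /df; exact: dl.
split=> [x /df|v]; first exact: dl.
apply: Ck_congr (IH _ (Df v)) => // x Ux /=.
rewrite !deriveE; [|exact/dl/df|exact: df].
rewrite (@diff_comp _ _ _ _ f l) ?diff_lin //; [exact: df|exact: linear_differentiable].
Qed.

Lemma smooth_on_linear_comp (W W' : normedModType R) U (l : {linear W -> W'}) (f : V -> W) :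
  open U -> continuous l -> smooth_on U f -> smooth_on U (l \o f).
Proof.
move=> oU cl /smooth_onP sf; apply/smooth_onP => m; exact: Ck_linear_comp.
Qed.

Lemma smooth_on_linear (W : normedModType R) U (l : {linear V -> W}) :
  open U -> continuous l -> smooth_on U l.
Proof.
move=> oU cl; apply/smooth_onP => -[|m].
  by split=> // x _; exact: linear_differentiable.
split=> [x _|v]; first exact: linear_differentiable.
apply: Ck_congr (Ck_cst m (l v) oU) => // x Ux.
by rewrite deriveE ?diff_lin //; exact: linear_differentiable.
Qed.

End SmoothCalculus.

Section DeriveRules.
Context {R : realType} {V : normedModType R}.
Implicit Types (f g : V -> R) (x v : V).

Lemma derive_addE f g x v : differentiable f x -> differentiable g x ->
  'D_v (fun x => f x + g x) x = 'D_v f x + 'D_v g x.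
Proof.
by move=> df dg; rewrite -[LHS]/('D_v (f + g) x) deriveD //; exact: diff_derivable.
Qed.

Lemma derive_mulE f g x v : differentiable f x -> differentiable g x ->
  'D_v (fun x => f x * g x) x = f x * 'D_v g x + g x * 'D_v f x.
Proof.
by move=> df dg; rewrite -[LHS]/('D_v (f * g) x) deriveM //; exact: diff_derivable.
Qed.

Lemma derive_scaleE (r : R) f x v : differentiable f x ->
  'D_v (fun x => r * f x) x = r * 'D_v f x.
Proof.
by move=> df; rewrite (derive_mulE _ (differentiable_cst r x) df) derive_cst mulr0 addr0.
Qed.

Lemma differentiable_sumE (W : normedModType R) (I : Type) (r : seq I) (f : I -> V -> W) x :
  (forall i, differentiable (f i) x) -> differentiable (fun x => \sum_(i <- r) f i x) x.
Proof.
move=> df; elim: r => [|i r IH].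
  have -> : (fun x => \sum_(i <- [::]) f i x) = cst 0 by apply/funext => y; rewrite big_nil.
  exact: differentiable_cst.
have -> : (fun x => \sum_(j <- i :: r) f j x) = f i + (fun x => \sum_(i <- r) f i x).
  by apply/funext => y; rewrite big_cons.
exact: differentiableD.
Qed.

Lemma derive_sumE (W : normedModType R) (I : Type) (r : seq I) (f : I -> V -> W) x v :
  (forall i, differentiable (f i) x) ->
  'D_v (fun x => \sum_(i <- r) f i x) x = \sum_(i <- r) 'D_v (f i) x.
Proof.
move=> df; elim: r => [|i r IH].
  rewrite big_nil (_ : (fun x => _) = cst 0) ?derive_cst //.
  by apply/funext => y; rewrite big_nil.
rewrite big_cons -IH (_ : (fun x => _) = f i + (fun x => \sum_(i <- r) f i x)); last first.
  by apply/funext => y; rewrite big_cons.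
by rewrite deriveD //; apply: diff_derivable => //; exact: differentiable_sumE.
Qed.

Lemma derive_sum_mulE (I : Type) (r : seq I) (f g : I -> V -> R) x v :
  (forall i, differentiable (f i) x) -> (forall i, differentiable (g i) x) ->
  'D_v (fun x => \sum_(i <- r) f i x * g i x) x =
  \sum_(i <- r) (f i x * 'D_v (g i) x + g i x * 'D_v (f i) x).
Proof.
move=> df dg; rewrite derive_sumE => [|i]; last exact: differentiableM.
by apply: eq_bigr => i _; exact: derive_mulE.
Qed.

End DeriveRules.

(** * Chain rule for maps given by scalar coefficients *)

Section Composition.
Context {R : realType} {V W : normedModType R}.

Lemma differentiable_sumZ (I : finType) (e : I -> W) (phi : I -> V -> R) (x : V) :
  (forall i, differentiable (phi i) x) ->
  differentiable (fun x => \sum_i phi i x *: e i) x.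
Proof.
move=> dphi; apply: (@differentiable_sumE _ _ _ _ _ (fun i x => phi i x *: e i)) => i.
exact: differentiableZl.
Qed.

(** Inner maps are combinations of fixed vectors [e i] with scalar coefficients. The chain rule is
    then a finite sum of products of scalar functions of the same kind, ready to be differentiated
    again. *)
Lemma derive_compE (I : finType) (e : I -> W) (phi : I -> V -> R) (h : W -> R) (x v : V) :
  (forall i, differentiable (phi i) x) ->
  differentiable h (\sum_i phi i x *: e i) ->
  differentiable (fun x => h (\sum_i phi i x *: e i)) x /\
  'D_v (fun x => h (\sum_i phi i x *: e i)) x =
  \sum_i 'D_v (phi i) x * 'D_(e i) h (\sum_i phi i x *: e i).
Proof.
move=> dphi dh.
pose F x := \sum_i phi i x *: e i.
have dF : differentiable F x by exact: differentiable_sumZ.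
have dhF : differentiable (h \o F) x by exact: differentiable_comp.
split=> //.
rewrite -[LHS]/('D_v (h \o F) x) deriveE // diff_comp //= .
have -> : 'd F x v = \sum_i 'D_v (phi i) x *: e i.
  rewrite -deriveE // (@derive_sumE _ _ _ _ _ (fun i x => phi i x *: e i)) => [|i]; last first.
    exact: differentiableZl.
  apply: eq_bigr => i _.
  by rewrite !deriveE // ?diffZl //; exact: differentiableZl.
rewrite linear_sum; apply: eq_bigr => i _.
by rewrite linearZ /= !deriveE.
Qed.

Lemma Ck_comp (I : finType) (k : nat) (e : I -> W) (phi : I -> V -> R) (h : W -> R)
    (U : set V) (O : set W) : open U ->
  (forall i, smooth_on U (phi i)) -> Ck k O h ->
  (forall x, U x -> O (\sum_i phi i x *: e i)) ->
  Ck k U (fun x => h (\sum_i phi i x *: e i)).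
Proof.
move=> oU sphi + UO; have dphi i x : U x -> differentiable (phi i) x.
  by move=> Ux; exact: smooth_on_diff.
elim: k h => [|k IH] h [dh Dh].
  by split=> // x Ux; have [] := @derive_compE _ e phi h x 0 (fun i => dphi i x Ux) (dh _ (UO _ Ux)).
split=> [x Ux|v].
  by have [] := @derive_compE _ e phi h x 0 (fun i => dphi i x Ux) (dh _ (UO _ Ux)).
have S : Ck k U (fun x => \sum_i 'D_v (phi i) x * 'D_(e i) h (\sum_i phi i x *: e i)).
  apply: Ck_sum => // i; apply: CkM => //; last exact: (IH _ (Dh (e i))).
  by have /smooth_onP := smooth_on_derive v (sphi i); apply.
apply: Ck_congr S => // x Ux.
by have [_ ->] := @derive_compE _ e phi h x v (fun i => dphi i x Ux) (dh _ (UO _ Ux)).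
Qed.

Lemma smooth_on_comp (I : finType) (e : I -> W) (phi : I -> V -> R) (h : W -> R)
    (U : set V) (O : set W) : open U ->
  (forall i, smooth_on U (phi i)) -> smooth_on O h ->
  (forall x, U x -> O (\sum_i phi i x *: e i)) ->
  smooth_on U (fun x => h (\sum_i phi i x *: e i)).
Proof.
move=> oU sphi /smooth_onP sh UO; apply/smooth_onP => k.
exact: (Ck_comp oU sphi (sh k) UO).
Qed.

End Composition.

Lemma smooth_on_comp1 {R : realType} {V : normedModType R} (phi : V -> R) (h : R -> R)
    (U : set V) (O : set R) : open U ->
  smooth_on U phi -> smooth_on O h -> (forall x, U x -> O (phi x)) ->
  smooth_on U (h \o phi).
Proof.
move=> oU sphi sh UO.
have E x : \sum_(i < 1) phi x *: (1 : R) = phi x by rewrite big_ord1 /GRing.scale /= mulr1.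
apply: (smooth_on_congr (f := fun x => h (\sum_(i < 1) phi x *: (1 : R)))) => //.
  by move=> x _; rewrite E.
have UO' x : U x -> O (\sum_(i < 1) phi x *: (1 : R)) by rewrite E; exact: UO.
exact: (@smooth_on_comp R V R 'I_1 (fun=> 1 : R) (fun=> phi) h U O oU (fun=> sphi) sh UO').
Qed.

(** * Bump functions *)

Section FlatFunction.
Context {R : realType}.
Implicit Types (k : nat) (t : R).

(** The classical flat function is the case [k = 0]. The powers of [1 / t] are built in so that the
    family is closed under differentiation: the derivative of member [k] combines members [k.+2] and
    [k.+1]. *)
Definition flat k t : R := if 0 < t then t^-1 ^+ k * expR (- t^-1) else 0.

Lemma flat_ge0 k t : 0 <= flat k t.
Proof.
rewrite /flat; case: ifP => // t0; apply: mulr_ge0; last exact: expR_ge0.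
by apply: exprn_ge0; rewrite invr_ge0 ltW.
Qed.

Lemma flatS k t : flat k t = t * flat k.+1 t.
Proof.
rewrite /flat; case: ifP => [t0|_]; last by rewrite mulr0.
by rewrite exprS !mulrA divff ?mul1r // gt_eqF.
Qed.

(** With s = 1/t, the inequality exp s >= s^(k+1) / (k+1)! gives s^k exp(-s) <= (k+1)! t. *)
Lemma flat_bound k : exists2 C : R, 0 < C & forall t, `|flat k t| <= C * `|t|.
Proof.
exists (k.+1)`!%:R; first by rewrite ltr0n fact_gt0.
move=> t; rewrite ger0_norm ?flat_ge0 // /flat; case: ifP => t0; last first.
  by rewrite mulr_ge0.
have s0 : 0 < t^-1 by rewrite invr_gt0.
rewrite (gtr0_norm t0) expRN.
have H := expR_ge1Dxn k (ltW s0).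
have F : (0 : R) < (k.+1)`!%:R by rewrite ltr0n fact_gt0.
have {}H : t^-1 ^+ k.+1 <= (k.+1)`!%:R * expR t^-1.
  rewrite mulrC -ler_pdivrMr //; apply: le_trans H.
  by rewrite lerDr.
rewrite ler_pdivrMr ?expR_gt0 //.
move: H; rewrite exprS -(ler_pM2l t0) mulrA divff ?gt_eqF // mul1r => H.
by apply: le_trans H _; rewrite mulrCA mulrA.
Qed.

Lemma flat_derivative k t v : differentiable (flat k) t /\
  'D_v (flat k) t = v * (flat k.+2 t - k%:R * flat k.+1 t).
Proof.
case: (ltgtP 0 t) => [t0|t0|<-].
- pose F (s : R) : R := s^-1 ^+ k * expR (- s^-1).
  have nF : \near t, F t = flat k t.
    near=> s; rewrite /flat ifT //; near: s; exact: lt_nbhsr.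
  have tn0 : t != 0 by rewrite gt_eqF.
  have dV : is_derive t (1 : R) (fun s : R => s^-1) (- t ^- 2 *: (1 : R)).
    exact: (@is_deriveV _ id t 1 1 tn0 (is_derive_id _ _)).
  have dX := is_deriveX k dV.
  have dE := @is_derive1_comp R expR (fun s => - s^-1) t _ _ (is_derive_expR _) (is_deriveN dV).
  have dF : is_derive t (1 : R) F (flat k.+2 t - k%:R * flat k.+1 t).
    have := is_deriveM dX dE; rewrite [X in is_derive _ _ X _](_ : _ = F); last first.
      by apply/funext => y; rewrite fctE /F; congr (_ * _); rewrite exprfctE.
    move=> /is_derive_eq; apply.
    rewrite /flat t0 !fctE /GRing.scale /= !mulr1 opprK -!exprVn.
    set u := t^-1; set E := expR _.
    case: (k) => [|k']; first by rewrite /= !exprS !expr0; ring.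
    by rewrite /= !exprS; ring.
  have dFt : differentiable F t by apply/derivable1_diffP; case: dF.
  split; first exact: differentiable_near_eq dFt.
  rewrite -(near_eq_derive _ nF) deriveE // -[v in LHS]mulr1.
  by rewrite -[_ * 1]/(v *: 1) linearZ /= -deriveE // (derive_val (is_derive := dF)).
- have nF : \near t, (fun=> 0 : R) t = flat k t.
    near=> s; rewrite /flat ifF //; apply/negbTE; rewrite -leNgt ltW //; near: s; exact: lt_nbhsl.
  split; first by apply: differentiable_near_eq nF _; exact: differentiable_cst.
  have e0 j : flat j t = 0 by rewrite /flat ifF //; apply/negbTE; rewrite -leNgt ltW.
  by rewrite -(near_eq_derive _ nF) derive_cst !e0 mulr0 subr0 mulr0.
(* At the origin, [flat k h] is [h] times [flat k.+1 h], and the second factor is itself O(h); so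
   the differential is zero. *)
- have [C C0 HC] := flat_bound k.+1.
  have e0 j : flat j 0 = 0 by rewrite /flat ltxx.
  have [] := @differentiable_approx R R R (flat k) (\0 : {linear R -> R}) 0.
  + by move=> x; exact: cvg_cst.
  + move=> e e_gt0.
    have Ce : 0 < C^-1 * e by rewrite mulr_gt0 ?invr_gt0.
    apply: filterS (@nbhs0_le _ R _ Ce) => h hC.
    rewrite addr0 e0 /= !subr0 flatS normrM mulrC; apply: ler_wpM2r => //.
    apply: le_trans (HC h) _; rewrite -ler_pdivlMl //.
  + move=> df d0; split=> //.
    by rewrite deriveE // d0 !e0 mulr0 subr0 mulr0.
Unshelve. all: by end_near. Qed.

Lemma flat_Ck m k : Ck m setT (flat k).
Proof.
elim: m k => [|m IH] k; split=> //; first by move=> t _; case: (flat_derivative k t 0).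
  by move=> t _; case: (flat_derivative k t 0).
move=> v; have C (a : R) : Ck m [set: R] (fun=> a : R) by apply: Ck_cst; exact: openT.
have H := CkM openT (C v) (CkD openT (IH k.+2) (CkM openT (C (- k%:R)) (IH k.+1))).
by apply: (Ck_congr openT _ H) => t _; case: (flat_derivative k t v) => _ ->; rewrite mulNr.
Qed.

(** A smooth step from 0 to 1. The two summands of the denominator never vanish together, because
    [t] and [1 - t] are not both nonpositive. *)
Definition plateau t : R := flat 0 t / (flat 0 t + flat 0 (1 - t)).

Lemma flat0_gt0 t : 0 < t -> 0 < flat 0 t.
Proof. by move=> t0; rewrite /flat t0 mul1r expR_gt0. Qed.

Lemma flat_le0 k t : t <= 0 -> flat k t = 0.
Proof. by move=> t0; rewrite /flat ifF //; apply/negbTE; rewrite -leNgt. Qed.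

Lemma plateau0 t : t <= 0 -> plateau t = 0.
Proof. by move=> t0; rewrite /plateau flat_le0 // mul0r. Qed.

Lemma plateau1 t : 1 <= t -> plateau t = 1.
Proof.
move=> t1; rewrite /plateau (@flat_le0 _ (1 - t)) ?subr_le0 // addr0 divff //.
by rewrite gt_eqF // flat0_gt0 // (lt_le_trans ltr01).
Qed.

Lemma smooth_on_affine (b : R) : smooth_on setT (fun t : R => b - t).
Proof.
apply: smooth_onB openT (smooth_on_cst b openT) _.
by apply: (@smooth_on_linear R R R setT idfun openT) => x; exact: cvg_id.
Qed.

Lemma smooth_plateau : smooth_on setT plateau.
Proof.
have f0 : smooth_on setT (flat 0) by apply/smooth_onP => m; exact: flat_Ck.
have f1 : smooth_on setT (flat 0 \o (fun t => 1 - t)).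
  by apply: (smooth_on_comp1 openT _ f0) => //; exact: smooth_on_affine.
apply: (smooth_onM openT f0); apply: smooth_onV openT _ (smooth_onD openT f0 f1).
move=> t _; rewrite gt_eqF //=; have [t0|t0] := ltP 0 t.
  by rewrite ltr_wpDr ?flat_ge0 // flat0_gt0.
by rewrite ltr_wpDl ?flat_ge0 // flat0_gt0 // subr_gt0 (le_lt_trans t0).
Qed.

End FlatFunction.

(** * Coordinate space and its cutoff functions *)

Section RowVectors.
Context {R : realType} {n : nat}.
Implicit Types (x a v : 'rV[R]_n).

Lemma coord_le_norm x i : `|x 0 i| <= `|x|.
Proof.
rewrite /Num.norm /= mx_normrE; exact: (le_bigmax _ (fun ij => `|x ij.1 ij.2|) (0, i)).
Qed.

Lemma norm_le_coord x (r : R) : 0 <= r -> (forall i, `|x 0 i| <= r) -> `|x| <= r.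
Proof.
move=> r0 H; rewrite /Num.norm /= mx_normrE; apply: bigmax_le => // -[j i] _ /=.
by rewrite ord1.
Qed.

Definition unit_row i : 'rV[R]_n := delta_mx 0 i.

Lemma row_sum_unit x : x = \sum_i x 0 i *: unit_row i.
Proof. exact: row_sum_delta. Qed.

Lemma smooth_on_coord (U : set 'rV[R]_n) i : open U -> smooth_on U (fun x => x 0 i).
Proof.
move=> oU; have lin : linear (fun x : 'rV[R]_n => x 0 i) by move=> a u v; rewrite !mxE.
pose l : {linear 'rV[R]_n -> R} := HB.pack (fun x : 'rV[R]_n => x 0 i) (GRing.isLinear.Build _ _ _ _ _ lin).
exact: (@smooth_on_linear _ _ _ _ l) oU (@coord_continuous _ _ _ _ _).
Qed.

Lemma derive_coord x v i : 'D_v (fun x : 'rV[R]_n => x 0 i) x = v 0 i.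
Proof.
have lin : linear (fun x : 'rV[R]_n => x 0 i) by move=> a u w; rewrite !mxE.
pose l : {linear 'rV[R]_n -> R} := HB.pack (fun x : 'rV[R]_n => x 0 i) (GRing.isLinear.Build _ _ _ _ _ lin).
have cl : continuous l by exact: coord_continuous.
by rewrite -[X in 'D_v X _]/(l : _ -> _) deriveE ?diff_lin //; exact: linear_differentiable.
Qed.

Lemma compact_closed_ball_row a (r : R) : compact [set x | `|x - a| <= r].
Proof.
apply: bounded_closed_compact.
  exists (`|a| + r); split=> [|M ltM x /= xa]; first exact: num_real.
  apply: ltW; apply: le_lt_trans ltM.
  by rewrite -[x](subrK a) addrC (le_trans (ler_normD _ _)) // lerD2l.
have -> : [set x | `|x - a| <= r] = (fun x : 'rV[R]_n => `|x - a|) @^-1` [set y | y <= r] by [].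
apply: closed_comp; last exact: closed_le.
move=> x _; apply: continuous_comp; last exact: norm_continuous.
by apply: continuousB => //; exact: cst_continuous.
Qed.

Lemma closed_ball_sub_nbhs a (U : set 'rV[R]_n) : nbhs a U ->
  exists2 r : R, 0 < r & [set x | `|x - a| <= r] `<=` U.
Proof.
move=> /nbhs_ballP[e /= e0 eU]; exists (e / 2); first by rewrite divr_gt0.
move=> x /= xa; apply: eU; rewrite -ball_normE /= distrC (le_lt_trans xa) //.
by rewrite ltr_pdivrMr // ltr_pMr // ltr1n.
Qed.

Lemma bump_exists a (U : set 'rV[R]_n) : open U -> U a ->
  exists (chi : 'rV[R]_n -> R) (K : set 'rV[R]_n),
    [/\ smooth_on setT chi, \near a, chi a = 1, compact K, K `<=` U
      & forall x, ~ K x -> chi x = 0].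
Proof.
move=> oU Ua.
have [r r0 rU] := closed_ball_sub_nbhs (open_nbhs_nbhs (conj oU Ua)).
(* The norm of row vectors is the maximum norm, which is not smooth; the sum of squares is smooth
   and dominates its square. *)
pose q x := \sum_i (x 0 i - a 0 i) * (x 0 i - a 0 i).
have sq : smooth_on setT q.
  have sc i : smooth_on setT (fun x : 'rV[R]_n => x 0 i - a 0 i).
    by apply: smooth_onB openT (smooth_on_coord _ openT) (smooth_on_cst _ openT).
  by apply: smooth_on_sum openT _ => i; exact: smooth_onM openT _ _.
(* With this [s], [plateau (2 - q / s)] is 1 where [q <= s], and 0 where [q >= 2 * s = r ^+ 2], in
   particular outside the ball of radius [r] in the maximum norm. *)
pose s := r ^+ 2 / 2.
have s0 : 0 < s by rewrite divr_gt0 // exprn_gt0.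
exists (plateau \o (fun x => 2 - s^-1 * q x)), [set x | `|x - a| <= r]; split => //.
- apply: (smooth_on_comp1 openT _ smooth_plateau) => //.
  by apply: smooth_onB openT (smooth_on_cst _ openT) _; exact: smooth_onZ openT _.
- have cq : {for a, continuous q}.
    by apply: differentiable_continuous; exact: (smooth_on_diff sq).
  have qa : q a = 0 by rewrite /q big1 // => i _; rewrite subrr mul0r.
  have : \forall x \near a, q x < s.
    by apply: (cvgr_lt (q a) cq); rewrite qa.
  apply: filterS => x qs /=; rewrite plateau1 //.
  have : s^-1 * q x < 1 by rewrite mulrC ltr_pdivrMr // mul1r.
  lra.
- exact: compact_closed_ball_row.
- move=> x /= nK; rewrite plateau0 // subr_le0 mulrC ler_pdivlMr // /s.
  rewrite mulrC divfK // leNgt; apply/negP => qr; apply: nK.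
  apply: norm_le_coord; first exact: ltW.
  move=> i; rewrite !mxE -(@ler_pXn2r _ 2) ?nnegrE ?normr_ge0 ?(ltW r0) //.
  rewrite real_normK ?num_real //; apply: le_trans (ltW qr).
  rewrite /q (bigD1 i) //= expr2 lerDl; apply: sumr_ge0 => j _.
  by rewrite -expr2 sqr_ge0.
Qed.

End RowVectors.

(** * Segments and Hadamard's lemma *)

Section Segments.
Context {R : realType} {V : normedModType R}.

Lemma differentiable_line (x v : V) (t : R) :
  differentiable (fun t : R => x + t *: v) t /\
  forall c : R, 'd (fun t : R => x + t *: v) t c = c *: v.
Proof.
have lin : linear (fun t : R => t *: v).
  by move=> a u w; rewrite scalerDl scalerA.
pose l : {linear R -> V} := HB.pack (fun t : R => t *: v) (GRing.isLinear.Build _ _ _ _ _ lin).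
have cl : continuous l by exact: scalel_continuous.
have dl : differentiable l t by exact: linear_differentiable.
have dc : differentiable (cst x : R -> V) t by exact: differentiable_cst.
have -> : (fun t : R => x + t *: v) = cst x + l by [].
split=> [|c]; first exact: differentiableD.
rewrite diffD // -[LHS]/('d (cst x) t c + 'd l t c) diff_lin // diff_cst.
by rewrite -[LHS]/(0 + l c) add0r.
Qed.

Lemma is_derive_line (F : V -> R) (x v : V) (t : R) : differentiable F (x + t *: v) ->
  is_derive t (1 : R) (fun t => F (x + t *: v)) ('D_v F (x + t *: v)).
Proof.
move=> dF; have [dl El] := differentiable_line x v t.
have dc : differentiable (F \o (fun t : R => x + t *: v)) t by exact: differentiable_comp.
have : derivable (F \o (fun t : R => x + t *: v)) t 1 by exact: diff_derivable.
move=> /derivableP; rewrite deriveE // diff_comp //= El scale1r -deriveE //.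
Qed.

Lemma mvt_line (F : V -> R) (x v : V) :
  (forall t : R, 0 <= t <= 1 -> differentiable F (x + t *: v)) ->
  exists2 c : R, 0 <= c <= 1 & F (x + v) - F x = 'D_v F (x + c *: v).
Proof.
move=> dF; have d (t : R) : 0 <= t <= 1 -> is_derive t (1 : R) (fun t => F (x + t *: v)) ('D_v F (x + t *: v)).
  by move=> /dF; exact: is_derive_line.
have [||c c01 E] := @MVT_segment R (fun t => F (x + t *: v)) (fun t => 'D_v F (x + t *: v)) 0 1 ler01.
- by move=> t /itvP t01; apply: d; rewrite !t01.
- apply: derivable_within_continuous => t /itvP t01.
  by case: (d t) => //; rewrite !t01.
exists c; first by move: c01; rewrite in_itv.
by move: E; rewrite scale1r scale0r addr0 subr0 mulr1.
Qed.

Lemma derive0_const (F : V -> R) (x v : V) :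
  (forall t : R, 0 <= t <= 1 -> differentiable F (x + t *: v)) ->
  (forall t : R, 0 <= t <= 1 -> 'D_v F (x + t *: v) = 0) -> F (x + v) = F x.
Proof.
move=> dF D0; have [c c01] := mvt_line dF.
by rewrite D0 // => /eqP; rewrite subr_eq0 => /eqP.
Qed.

End Segments.

(** * Integrals along rays, and symmetry of second derivatives *)

Section Hadamard.
Context {R : realType} {n : nat}.
Implicit Types (x a v h : 'rV[R]_n) (f F : 'rV[R]_n -> R).

Lemma derive_row F x v : differentiable F x ->
  'D_v F x = \sum_i v 0 i * 'D_(unit_row i) F x.
Proof.
move=> dF; rewrite deriveE // {1}[v]row_sum_unit linear_sum; apply: eq_bigr => i _.
by rewrite linearZ /= deriveE.
Qed.

Lemma convex_ball a (r : R) x y (t : R) : 0 <= t <= 1 ->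
  `|x - a| <= r -> `|x + y - a| <= r -> `|x + t *: y - a| <= r.
Proof.
move=> /andP[t0 t1] xa ya.
have -> : x + t *: y - a = (1 - t) *: (x - a) + t *: (x + y - a).
  rewrite scalerBl scale1r !scalerBr !scalerDr.
  apply/rowP => i; rewrite !mxE; ring.
apply: le_trans (ler_normD _ _) _; rewrite !normrZ (ger0_norm t0) ger0_norm ?subr_ge0 //.
nra.
Qed.

(** Mean value theorem on segments; [C] is the sum of the maxima of the partial derivatives on the
    compact ball. *)
Lemma lipschitz_on_ball (U : set 'rV[R]_n) a (r : R) F : open U -> 0 < r ->
  [set x | `|x - a| <= r] `<=` U -> smooth_on U F ->
  exists2 C : R, 0 <= C & forall x h, `|x - a| <= r -> `|x + h - a| <= r ->
    `|F (x + h) - F x| <= C * `|h|.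
Proof.
move=> oU r0 rU sF.
pose K := [set x | `|x - a| <= r].
have aK : K a by rewrite /K /= subrr normr0 ltW.
have bd i : exists2 C : R, 0 <= C & forall x, K x -> `|'D_(unit_row i) F x| <= C.
  have cD : {within K, continuous (fun x => `|'D_(unit_row i) F x|)}.
    apply: continuous_in_subspaceT => x /set_mem Kx.
    have dx := smooth_on_diff (smooth_on_derive (unit_row i) sF) (rU _ Kx).
    exact: cvg_norm (differentiable_continuous dx).
  have [c _ Hc] := compact_EVT_max (ex_intro _ a aK) (@compact_closed_ball_row _ _ a r) cD.
  exists `|'D_(unit_row i) F c| => // x Kx; exact/Hc/mem_set.
have /choice[C HC] : forall i, exists C : R, 0 <= C /\ forall x, K x -> `|'D_(unit_row i) F x| <= C.
  by move=> i; have [C ? ?] := bd i; exists C.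
exists (\sum_i C i); first by apply: sumr_ge0 => i _; case: (HC i).
move=> x h Kx Kxh.
have Kt t : 0 <= t <= 1 -> K (x + t *: h) by move=> t01; exact: convex_ball.
have dF t : 0 <= t <= 1 -> differentiable F (x + t *: h).
  by move=> /Kt/rU; exact: smooth_on_diff.
have [c c01 ->] := mvt_line dF.
rewrite derive_row; last exact: dF.
rewrite mulr_suml; apply: le_trans (ler_norm_sum _ _ _) _; apply: ler_sum => i _.
rewrite normrM mulrC; apply: ler_pM => //; last exact: coord_le_norm.
by case: (HC i) => _; apply; exact: Kt.
Qed.

(** The mean value theorem replaces the increment by a derivative at an intermediate point, and the
    Lipschitz bound for the partial derivatives compares it with the one at [x]. Uniformity of [C]
    is what permits integrating the estimate. *)
Lemma taylor_on_ball (U : set 'rV[R]_n) a (r : R) F : open U -> 0 < r ->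
  [set x | `|x - a| <= r] `<=` U -> smooth_on U F ->
  exists2 C : R, 0 <= C & forall x h, `|x - a| <= r -> `|x + h - a| <= r ->
    `|F (x + h) - F x - 'D_h F x| <= C * `|h| ^+ 2.
Proof.
move=> oU r0 rU sF.
have /choice[C HC] : forall i, exists C : R, 0 <= C /\
    forall x h, `|x - a| <= r -> `|x + h - a| <= r ->
    `|'D_(unit_row i) F (x + h) - 'D_(unit_row i) F x| <= C * `|h|.
  move=> i.
  by have [C ? ?] := lipschitz_on_ball oU r0 rU (smooth_on_derive (unit_row i) sF); exists C.
exists (\sum_i C i); first by apply: sumr_ge0 => i _; case: (HC i).
move=> x h Kx Kxh.
have Kt t : 0 <= t <= 1 -> `|x + t *: h - a| <= r by move=> t01; exact: convex_ball.
have dF t : 0 <= t <= 1 -> differentiable F (x + t *: h).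
  by move=> /Kt/rU; exact: smooth_on_diff.
have [c /[dup] c01 /andP[c0 c1] ->] := mvt_line dF.
rewrite (derive_row _ (dF _ c01)) derive_row; last by apply: (smooth_on_diff sF); exact: rU.
rewrite -sumrB mulr_suml; apply: le_trans (ler_norm_sum _ _ _) _; apply: ler_sum => i _.
rewrite -mulrBr normrM.
have [C0 /(_ x (c *: h) Kx (Kt _ c01))] := HC i.
rewrite normrZ (ger0_norm c0) => H.
have hi := coord_le_norm h i.
have ch : C i * (c * `|h|) <= C i * `|h| by apply: ler_wpM2l => //; rewrite ler_piMl.
rewrite expr2 mulrCA.
by apply: ler_pM => //; exact: le_trans H ch.
Qed.

(* [I k f x] is [int_0^1 t^k f (a + t (x - a)) dt]; the family is closed under
   differentiation, [D_v (I k f) = I k.+1 (D_v f)]. *)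
Definition ray_integral a (k : nat) f x : R :=
  \int[lebesgue_measure]_(t in `[0%R, 1%R]) (t ^+ k * f (a + t *: (x - a))).

Lemma segment_integrable (F : R -> R) : (forall t, 0 <= t <= 1 -> derivable F t 1) ->
  lebesgue_measure.-integrable `[0%R, 1%R] (EFin \o F).
Proof.
move=> dF; apply: continuous_compact_integrable; first exact: segment_compact.
by apply: derivable_within_continuous => t /itvP t01; apply: dF; rewrite !t01.
Qed.

Lemma Rintegral01_cst (b : R) : \int[lebesgue_measure]_(t in `[0%R, 1%R]) b = b.
Proof.
rewrite Rintegral_cst /=; last exact: measurable_itv.
by rewrite lebesgue_measure_itv /= lte01 oppr0 adde0 mulr1.
Qed.

Lemma ray_derivable (U : set 'rV[R]_n) a (r : R) k f x : 0 < r ->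
  [set x | `|x - a| <= r] `<=` U -> smooth_on U f -> `|x - a| <= r ->
  forall t : R, 0 <= t <= 1 -> derivable (fun t : R => t ^+ k * f (a + t *: (x - a))) t 1.
Proof.
move=> r0 rU sf xa t t01.
have tU : U (a + t *: (x - a)).
  apply: rU; apply: convex_ball; rewrite ?t01 //; first by rewrite subrr normr0 ltW.
  by rewrite addrCA subrr addr0.
apply: derivableM; first exact: exprn_derivable.
by case: (is_derive_line (smooth_on_diff sf tU)).
Qed.

Definition row_form (c : 'I_n -> R) v : R := \sum_i v 0 i * c i.

Lemma row_form_linear c : linear (row_form c).
Proof.
move=> a u v; rewrite /row_form scaler_sumr -big_split; apply: eq_bigr => i _ /=.
by rewrite !mxE mulrDl -mulrA.
Qed.
HB.instance Definition _ c := GRing.isLinear.Build R 'rV[R]_n R _ (row_form c) (row_form_linear c).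

Lemma row_form_continuous c : continuous (row_form c).
Proof.
have sc : smooth_on setT (row_form c).
  apply: smooth_on_sum openT _ => i.
  exact: smooth_onM openT (smooth_on_coord i openT) (smooth_on_cst (c i) openT).
by move=> x; exact/differentiable_continuous/(smooth_on_diff sc).
Qed.

(** The direction enters linearly under the integral. The candidate for the differential of a ray
    integral thus becomes a bundled continuous linear form, as [differentiable_approx] requires. *)
Lemma ray_integral_row (U : set 'rV[R]_n) a (r : R) k f x w : open U -> 0 < r ->
  [set x | `|x - a| <= r] `<=` U -> smooth_on U f -> `|x - a| <= r ->
  ray_integral a k ('D_w f) x =
  row_form (fun i => ray_integral a k ('D_(unit_row i) f) x) w.
Proof.
move=> oU r0 rU sf xr'.
have Uray t : 0 <= t <= 1 -> U (a + t *: (x - a)).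
  move=> t01; apply: rU; apply: convex_ball => //; first by rewrite subrr normr0 ltW.
  by rewrite addrCA subrr addr0.
have der_ k' F y : smooth_on U F -> `|y - a| <= r -> forall t : R, 0 <= t <= 1 ->
    derivable (fun t : R => t ^+ k' * F (a + t *: (y - a))) t 1.
  by move=> sF yr t t01; exact: (ray_derivable r0 rU sF yr t01).
have int_ k' F y : smooth_on U F -> `|y - a| <= r -> lebesgue_measure.-integrable `[0%R, 1%R]
    (EFin \o (fun t : R => t ^+ k' * F (a + t *: (y - a)))).
  by move=> sF yr; apply: segment_integrable; exact: der_.
have mI : measurable (`[0%R, 1%R]%classic : set R) by exact: measurable_itv.
have Dlin : linear (fun w => ray_integral a k ('D_w f) x).
  move=> b u {}w; rewrite /ray_integral.
  rewrite -[X in _ = X + _]/(b * _) -RintegralZl; [|exact: mI|exact: (int_ k _ x (smooth_on_derive u sf))].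
  have iu : lebesgue_measure.-integrable `[0%R, 1%R]
      (EFin \o (fun t : R => b * (t ^+ k * 'D_u f (a + t *: (x - a))))).
    apply: segment_integrable => t t01; apply: derivableM; first exact: derivable_cst.
    exact: der_ (smooth_on_derive u sf) xr' t t01.
  rewrite -RintegralD //; last exact: (int_ k _ x (smooth_on_derive w sf)).
  apply: eq_Rintegral => t /set_mem /=; rewrite in_itv /= => t01.
  have dt := smooth_on_diff sf (Uray t t01).
  by rewrite !deriveE // linearD linearZ /= -[X in _ * (X + _) = _]/(b * _) mulrDr mulrCA.
pose D : {linear 'rV[R]_n -> R} := HB.pack (fun w => ray_integral a k ('D_w f) x)
  (GRing.isLinear.Build _ _ _ _ _ Dlin).
rewrite -[LHS]/(D w) [in LHS](row_sum_unit w) linear_sum; apply: eq_bigr => i _.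
by rewrite linearZ.
Qed.

(** Differentiation under the integral sign: the uniform Taylor estimate is applied with increment
    [t *: h] and integrated over the unit interval. The factor [t] of this increment raises the
    exponent [k] by one. *)
Lemma ray_integral_derive (U : set 'rV[R]_n) a (r : R) k f x v : open U -> 0 < r ->
  [set x | `|x - a| <= r] `<=` U -> smooth_on U f -> `|x - a| < r ->
  differentiable (ray_integral a k f) x /\
  'D_v (ray_integral a k f) x = ray_integral a k.+1 ('D_v f) x.
Proof.
move=> oU r0 rU sf xr.
have [C C0 HC] := taylor_on_ball oU r0 rU sf.
pose c i := ray_integral a k.+1 ('D_(unit_row i) f) x.
have Uray t : 0 <= t <= 1 -> U (a + t *: (x - a)).
  move=> t01; apply: rU; apply: convex_ball => //; first by rewrite subrr normr0 ltW.
  by rewrite addrCA subrr addr0 ltW.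
have der_ k' F y : smooth_on U F -> `|y - a| <= r -> forall t : R, 0 <= t <= 1 ->
    derivable (fun t : R => t ^+ k' * F (a + t *: (y - a))) t 1.
  by move=> sF yr t t01; exact: (ray_derivable r0 rU sF yr t01).
have int_ k' F y : smooth_on U F -> `|y - a| <= r -> lebesgue_measure.-integrable `[0%R, 1%R]
    (EFin \o (fun t : R => t ^+ k' * F (a + t *: (y - a)))).
  by move=> sF yr; apply: segment_integrable; exact: der_.
have mI : measurable (`[0%R, 1%R]%classic : set R) by exact: measurable_itv.
have xr' := ltW xr.
have Dint w : ray_integral a k.+1 ('D_w f) x = row_form c w.
  exact: ray_integral_row rU sf xr'.
have [] := @differentiable_approx R _ _ (ray_integral a k f) (row_form c) x.
- exact: row_form_continuous.
- move=> e e0.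
  have n1 : \forall h \near (0 : 'rV[R]_n), `|h| <= r - `|x - a| by apply: nbhs0_le; rewrite subr_gt0.
  (* Dividing by [C + 1] rather than [C], since [C] may be 0. *)
  have n2 : \forall h \near (0 : 'rV[R]_n), `|h| <= e / (C + 1) by apply: nbhs0_le; rewrite divr_gt0 // ltr_wpDl.
  apply: filterS2 n1 n2 => h h1 h2.
  have xh : `|h + x - a| <= r.
    by rewrite -addrA (le_trans (ler_normD _ _)) // -lerBrDr.
  rewrite -[X in _ - X]/(row_form c h) -Dint /ray_integral.
  have i1 := int_ k _ _ sf xh; have i2 := int_ k _ _ sf xr'.
  have i3 := int_ k.+1 _ _ (smooth_on_derive h sf) xr'.
  have i12 : lebesgue_measure.-integrable `[0%R, 1%R] (EFin \o (fun t : R =>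
      t ^+ k * f (a + t *: (h + x - a)) - t ^+ k * f (a + t *: (x - a)))).
    by apply: segment_integrable => t t01; apply: derivableB; exact: der_.
  have i123 : lebesgue_measure.-integrable `[0%R, 1%R] (EFin \o (fun t : R =>
      t ^+ k * f (a + t *: (h + x - a)) - t ^+ k * f (a + t *: (x - a)) -
      t ^+ k.+1 * 'D_h f (a + t *: (x - a)))).
    apply: segment_integrable => t t01; apply: derivableB.
      by apply: derivableB; exact: der_.
    exact: der_ (smooth_on_derive h sf) xr' t t01.
  rewrite -RintegralB // -RintegralB //.
  have icst (b : R) : lebesgue_measure.-integrable `[0%R, 1%R] (EFin \o (fun _ : R => b)).
    by apply: segment_integrable => t _; exact: derivable_cst.
  have bd t : 0 <= t <= 1 -> `|t ^+ k * f (a + t *: (h + x - a)) - t ^+ k * f (a + t *: (x - a)) -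
      t ^+ k.+1 * 'D_h f (a + t *: (x - a))| <= C * `|h| ^+ 2.
    move=> /[dup] t01 /andP[t0 t1].
    have -> : a + t *: (h + x - a) = a + t *: (x - a) + t *: h.
      by rewrite -[in RHS]addrA -scalerDr [h + x]addrC addrAC.
    have K1 : `|a + t *: (x - a) - a| <= r.
      apply: convex_ball => //; first by rewrite subrr normr0 ltW.
      by rewrite addrCA subrr addr0 ltW.
    have K2 : `|a + t *: (x - a) + t *: h - a| <= r.
      have -> : a + t *: (x - a) + t *: h - a = t *: (h + x - a).
        by apply/rowP => i; rewrite !mxE; ring.
      by rewrite normrZ (ger0_norm t0); apply: le_trans xh; rewrite ler_piMl.
    have := HC _ _ K1 K2; rewrite normrZ (ger0_norm t0).
    have dt := smooth_on_diff sf (Uray t t01).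
    have -> : 'D_(t *: h) f (a + t *: (x - a)) = t * 'D_h f (a + t *: (x - a)).
      by rewrite !deriveE // linearZ.
    set f1 := f _; set f2 := f _; set f3 := 'D_h f _ => H.
    have -> : t ^+ k * f1 - t ^+ k * f2 - t ^+ k.+1 * f3 = t ^+ k * (f1 - f2 - t * f3).
      by rewrite exprSr; ring.
    rewrite normrM.
    have tk : `|t ^+ k| <= 1 by rewrite ger0_norm ?exprn_ge0 // exprn_ile1.
    apply: le_trans (_ : 1 * (C * (t * `|h|) ^+ 2) <= _); first exact: ler_pM.
    rewrite mul1r; apply: ler_wpM2l => //; rewrite exprMn; apply: ler_piMl => //.
    by rewrite exprn_ile1.
  have Ce : C * `|h| ^+ 2 <= e * `|h|.
    rewrite expr2 mulrA; apply: ler_wpM2r => //.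
    have C1 : 0 < C + 1 by rewrite ltr_wpDl.
    move: h2; rewrite ler_pdivlMr // => h2; apply: le_trans h2.
    by rewrite mulrDr mulr1 mulrC lerDl.
  apply: le_trans Ce; rewrite ler_norml; apply/andP; split.
    rewrite -[leLHS]Rintegral01_cst; apply: le_Rintegral => // t /=; rewrite in_itv /= => /bd.
    by rewrite ler_norml => /andP[].
  rewrite -[leRHS]Rintegral01_cst; apply: le_Rintegral => // t /=; rewrite in_itv /= => /bd.
  by rewrite ler_norml => /andP[].
- move=> dI EI; split=> //.
  by rewrite deriveE // EI Dint.
Qed.

Lemma open_ball_row a (r : R) : open [set x : 'rV[R]_n | `|x - a| < r].
Proof.
have -> : [set x : 'rV[R]_n | `|x - a| < r] = ball a r.
  by rewrite -ball_normE; apply/seteqP; split=> x /=; rewrite distrC.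
exact: ball_open_nbhs || exact: ball_open.
Qed.

Lemma ray_integral_smooth (U : set 'rV[R]_n) a (r : R) k f : open U -> 0 < r ->
  [set x | `|x - a| <= r] `<=` U -> smooth_on U f ->
  smooth_on [set x | `|x - a| < r] (ray_integral a k f).
Proof.
move=> oU r0 rU sf; apply/smooth_onP => m; elim: m k f sf => [|m IH] k f sf.
  by split=> // x xr; have [] := ray_integral_derive k 0 oU r0 rU sf xr.
split=> [x xr|v]; first by have [] := ray_integral_derive k 0 oU r0 rU sf xr.
apply: Ck_congr (IH k.+1 _ (smooth_on_derive v sf)); first exact: open_ball_row.
by move=> x xr; have [_ ->] := ray_integral_derive k v oU r0 rU sf xr.
Qed.

(** The difference [f x - f a] is the integral of the derivative of [f] along the ray from [a] to
    [x]; expanding the direction [x - a] in coordinates gives the factors. The values of the [g i]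
    at [a] are recorded because a derivation at [a] sees nothing else. *)
Lemma hadamard (U : set 'rV[R]_n) a f : open U -> U a -> smooth_on U f ->
  exists (U' : set 'rV[R]_n) (g : 'I_n -> 'rV[R]_n -> R),
    [/\ open U', U' a, U' `<=` U, forall i, smooth_on U' (g i)
      & (forall x, U' x -> f x = f a + \sum_i (x 0 i - a 0 i) * g i x) /\
        forall i, g i a = 'D_(unit_row i) f a].
Proof.
move=> oU Ua sf.
have [r r0 rU] := closed_ball_sub_nbhs (open_nbhs_nbhs (conj oU Ua)).
exists [set x | `|x - a| < r], (fun i => ray_integral a 0 ('D_(unit_row i) f)).
have aU' : `|a - a| < r by rewrite subrr normr0.
split=> //; first exact: open_ball_row.
- by move=> x /= xr; apply: rU => /=; exact: ltW.
- by move=> i; exact: ray_integral_smooth oU r0 rU (smooth_on_derive _ sf).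
split=> [x xr|i]; last first.
  rewrite /ray_integral (_ : (fun t => _) = (fun=> 'D_(unit_row i) f a)).
    exact: Rintegral01_cst.
  by apply/funext => t; rewrite subrr scaler0 addr0 expr0 mul1r.
have rI := ray_integral_row 0 (x - a) oU r0 rU sf (ltW xr).
have -> : \sum_i (x 0 i - a 0 i) * ray_integral a 0 ('D_(unit_row i) f) x =
    ray_integral a 0 ('D_(x - a) f) x.
  by rewrite rI; apply: eq_bigr => i _; rewrite !mxE.
have Ut t : 0 <= t <= 1 -> U (a + t *: (x - a)).
  move=> t01; apply: rU; apply: convex_ball => //; first by rewrite subrr normr0 ltW.
  by rewrite addrCA subrr addr0 ltW.
have dt (t : R) : 0 <= t <= 1 -> is_derive t (1 : R) (fun t => f (a + t *: (x - a))) ('D_(x - a) f (a + t *: (x - a))).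
  by move=> /Ut Ut'; exact/is_derive_line/(smooth_on_diff sf).
have ct (t : R) : 0 <= t <= 1 -> {for t, continuous (fun t : R => f (a + t *: (x - a)))}.
  by move=> /dt dt'; apply/differentiable_continuous/derivable1_diffP; case: dt'.
have [ct0 ct1] := (ct 0 (introT andP (conj (lexx 0) ler01)), ct 1 (introT andP (conj ler01 (lexx 1)))).
have := @continuous_FTC2 R (fun t => 'D_(x - a) f (a + t *: (x - a))) (fun t => f (a + t *: (x - a))) 0 1 ltr01.
have -> : ray_integral a 0 ('D_(x - a) f) x =
   \int[lebesgue_measure]_(t in `[0%R, 1%R]) ('D_(x - a) f (a + t *: (x - a))).
  by apply: eq_Rintegral => t _; rewrite expr0 mul1r.
rewrite /Rintegral => ->.
- have -> : a + 1 *: (x - a) = x by rewrite scale1r addrCA subrr addr0.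
  rewrite scale0r addr0 /=; set u := f x; set v := f a; ring.
- apply: derivable_within_continuous => t /itvP t01.
  have t01' : 0 <= t <= 1 by rewrite !t01.
  by case: (is_derive_line (smooth_on_diff (smooth_on_derive (x - a) sf) (Ut t t01'))).
- split.
  + move=> t /itvP t01; have t01' : 0 <= t <= 1 by rewrite !t01.
    by case: (dt t t01').
  + exact: cvg_at_right_filter.
  + exact: cvg_at_left_filter.
- move=> t /itvP t01; have t01' : 0 <= t <= 1 by rewrite !t01.
  by rewrite derive1E; case: (dt t t01').
Qed.

Lemma derive_centered_coord a x i v : 'D_v (fun x : 'rV[R]_n => x 0 i - a 0 i) x = v 0 i.
Proof.
have dc : derivable (fun x : 'rV[R]_n => x 0 i) x v.
  exact: (diff_derivable (smooth_on_diff (smooth_on_coord i openT) I)).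
rewrite -[LHS]/('D_v ((fun x : 'rV[R]_n => x 0 i) - cst (a 0 i)) x).
rewrite (deriveB dc (derivable_cst _ _ _)) derive_cst subr0; exact: derive_coord.
Qed.

(** Substitute Hadamard's expansion. As the factors [x_i - a_i] vanish at [a] and have constant
    derivatives, the second derivative is the sum of [w_i D_v g_i + v_i D_w g_i] at [a], visibly
    symmetric. *)
Lemma derive_comm (U : set 'rV[R]_n) a f v w : open U -> U a -> smooth_on U f ->
  'D_v ('D_w f) a = 'D_w ('D_v f) a.
Proof.
move=> oU Ua sf; have [U' [g [oU' U'a U'U sg [fE _]]]] := hadamard oU Ua sf.
pose G (i : 'I_n) := fun x : 'rV[R]_n => x 0 i - a 0 i.
have sG i : smooth_on U' (G i).
  exact: smooth_onB oU' (smooth_on_coord i oU') (smooth_on_cst (a 0 i) oU').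
have dG i x (U'x : U' x) := smooth_on_diff (sG i) U'x.
have dg i x (U'x : U' x) := smooth_on_diff (sg i) U'x.
have D1 u x : U' x -> 'D_u f x = \sum_i u 0 i * g i x + \sum_i G i x * 'D_u (g i) x.
  move=> U'x; rewrite (near_derive_eq u oU' fE U'x).
  rewrite (derive_addE u (differentiable_cst (f a) x) (differentiable_sumE _ _)); last first.
    by move=> i; exact: differentiableM (dG i x U'x) (dg i x U'x).
  rewrite (derive_cst (f a)) add0r.
  rewrite (@derive_sum_mulE _ _ _ _ G g x u (fun i => dG i x U'x) (fun i => dg i x U'x)).
  rewrite -big_split /=; apply: eq_bigr => i _.
  by rewrite addrC (derive_centered_coord a x i u) [g i x * _]mulrC.
have D2 u u' : 'D_u ('D_u' f) a = \sum_i u' 0 i * 'D_u (g i) a + \sum_i u 0 i * 'D_u' (g i) a.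
  have dDg i := smooth_on_diff (smooth_on_derive u' (sg i)) U'a.
  have dc i := differentiable_cst (u' 0 i) a.
  rewrite (near_derive_eq u oU' (D1 u') U'a) (derive_addE u (differentiable_sumE _ _) (differentiable_sumE _ _)).
  - rewrite (@derive_sum_mulE _ _ _ _ (fun i => cst (u' 0 i)) g a u dc (fun i => dg i a U'a)).
    rewrite (@derive_sum_mulE _ _ _ _ G (fun i => 'D_u' (g i)) a u (fun i => dG i a U'a) dDg).
    congr (_ + _); apply: eq_bigr => i _; first by rewrite derive_cst mulr0 addr0.
    by rewrite (derive_centered_coord a a i u) /G subrr mul0r add0r mulrC.
  - by move=> i; exact: differentiableM (dc i) (dg i a U'a).
  - by move=> i; exact: differentiableM (dG i a U'a) (dDg i).
by rewrite !D2 addrC.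
Qed.

End Hadamard.

(** * Tangent vectors and charts *)

Lemma open_setI_preimage (T T' : topologicalType) (A : set T) (f : T -> T') (B : set T') :
  open A -> (forall x, A x -> {for x, continuous f}) -> open B -> open (A `&` f @^-1` B).
Proof.
move=> oA cf oB; rewrite openE => x [Ax Bfx]; rewrite /interior; apply: filterI.
  exact: (open_nbhs_nbhs (conj oA Ax)).
exact: (cf x Ax B (open_nbhs_nbhs (conj oB Bfx))).
Qed.

Section Derivations.
Context {R : realType} {T : Type} (C : set (T -> R)).
Hypothesis Ccst : forall a : R, C (fun=> a).
Hypothesis CD : forall f h, C f -> C h -> C (fun q => f q + h q).
Hypothesis CM : forall f h, C f -> C h -> C (fun q => f q * h q).
Variables (p : T) (w : vec R T).
Hypothesis tw : tangent C p w.

Lemma tangentD f h : C f -> C h -> w (fun q => f q + h q) = w f + w h.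
Proof.
by move=> Cf Ch; case: tw => /(_ 1 _ _ Cf Ch); rewrite mul1r => <- _ _;
  congr w; apply/funext => q; rewrite mul1r.
Qed.

Lemma tangentM f h : C f -> C h -> w (fun q => f q * h q) = f p * w h + h p * w f.
Proof. by case: tw => _ + _; apply. Qed.

Lemma tangent_cst a : w (fun=> a) = 0.
Proof.
have w1 : w (fun=> 1) = 0.
  have := tangentM (Ccst 1) (Ccst 1).
  rewrite (_ : (fun q => _) = fun=> 1); last by apply/funext => q; rewrite mulr1.
  lra.
have w0 : w (fun=> 0) = 0.
  have := tangentM (Ccst 0) (Ccst 0).
  rewrite (_ : (fun q => _) = fun=> 0); last by apply/funext => q; rewrite mulr0.
  lra.
have [/(_ a _ _ (Ccst 1) (Ccst 0)) E _ _] := tw.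
transitivity (w (fun=> a * 1 + 0)); last by rewrite E w1 w0 mulr0 addr0.
by congr w; apply/funext => q; rewrite mulr1 addr0.
Qed.

Lemma tangentZ a f : C f -> w (fun q => a * f q) = a * w f.
Proof.
by move=> Cf; rewrite (tangentM (Ccst a) Cf) tangent_cst mulr0 addr0.
Qed.

Lemma tangentB f h : C f -> C h -> w (fun q => f q - h q) = w f - w h.
Proof.
move=> Cf Ch; rewrite -mulN1r -tangentZ // -tangentD //; last exact: CM.
by congr w; apply/funext => q; rewrite mulN1r.
Qed.

Lemma tangent_sum (I : Type) (r : seq I) (f : I -> T -> R) : (forall i, C (f i)) ->
  C (fun q => \sum_(i <- r) f i q) /\
  w (fun q => \sum_(i <- r) f i q) = \sum_(i <- r) w (f i).
Proof.
move=> Cf; elim: r => [|i r [IHC IH]].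
  rewrite big_nil (_ : (fun q => _) = fun=> 0); last by apply/funext => q; rewrite big_nil.
  by split; [exact: Ccst|exact: tangent_cst].
rewrite big_cons (_ : (fun q => _) = fun q => f i q + \sum_(i <- r) f i q); last first.
  by apply/funext => q; rewrite big_cons.
by split; [exact: CD|rewrite tangentD // IH].
Qed.

End Derivations.

Section TangentSpace.
Context {R : realType} {T : Type} (C : set (T -> R)) (p : T).
Hypothesis CM : forall f h, C f -> C h -> C (fun q => f q * h q).
Hypothesis CD : forall f h, C f -> C h -> C (fun q => f q + h q).

Lemma tangent0 : tangent C p 0.
Proof.
split => [a f h _ _|f h _ _|//].
  by rewrite -[LHS]/(0 : R) -[RHS]/(a * 0 + 0 : R) mulr0 addr0.
by rewrite -[LHS]/(0 : R) -[RHS]/(f p * 0 + h p * 0 : R) !mulr0 addr0.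
Qed.

Lemma tangent_lin (a : R) (v w : vec R T) : tangent C p v -> tangent C p w ->
  tangent C p (a *: v + w).
Proof.
move=> [v1 v2 v3] [w1 w2 w3]; split=> [b f h Cf Ch|f h Cf Ch|f nC].
- by rewrite !fctE /= v1 // w1 // /GRing.scale /=; ring.
- by rewrite !fctE /= v2 // w2 // /GRing.scale /=; ring.
- by rewrite !fctE /= v3 // w3 // scaler0 addr0.
Qed.

Lemma tangent_add (v w : vec R T) : tangent C p v -> tangent C p w -> tangent C p (v + w).
Proof. by move=> tv tw; rewrite -[v]scale1r; exact: tangent_lin. Qed.

Lemma tangent_scale (a : R) (v : vec R T) : tangent C p v -> tangent C p (a *: v).
Proof. by move=> tv; rewrite -[_ *: _]addr0; apply: tangent_lin => //; exact: tangent0. Qed.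

Lemma tangent_vsum (I : Type) (r : seq I) (v : I -> vec R T) :
  (forall i, tangent C p (v i)) -> tangent C p (\sum_(i <- r) v i).
Proof.
move=> tv; elim: r => [|i r IH]; first by rewrite big_nil; exact: tangent0.
by rewrite big_cons; exact: tangent_add.
Qed.

Lemma tangent_ext (v w : vec R T) : tangent C p v -> tangent C p w ->
  (forall f, C f -> v f = w f) -> v = w.
Proof.
move=> [_ _ v3] [_ _ w3] vw; apply/funext => f.
by have [/vw//|nC] := EM (C f); rewrite v3 // w3.
Qed.

End TangentSpace.

Lemma cut_smoothE (R : realType) (T : Type) (C : set (T -> R)) (w : vec R T) f :
  C f -> cut_smooth C w f = w f.
Proof. by move=> Cf; rewrite /cut_smooth; case: asboolP. Qed.

Lemma cut_smooth0 (R : realType) (T : Type) (C : set (T -> R)) (w : vec R T) f :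
  ~ C f -> cut_smooth C w f = 0.
Proof. by move=> Cf; rewrite /cut_smooth; case: asboolP. Qed.

(** * Extending local functions, and derivations in coordinates *)

Section Manifolds.
Context {R : realType} {n : nat} {M : manifold R n}.
Implicit Types (c d : chart R n M) (p q : M) (x y : 'rV[R]_n) (f h : M -> R).

Definition img c : set 'rV[R]_n := chart_coord c @` chart_dom c.

Lemma open_img c : open (img c).
Proof. exact: img_open. Qed.

Lemma img_coord c p : chart_dom c p -> img c (chart_coord c p).
Proof. by move=> cp; exists p. Qed.

Lemma dom_param c x : img c x -> chart_dom c (chart_param c x).
Proof. by move=> [p cp <-]; rewrite coordK. Qed.

Lemma paramK c x : img c x -> chart_coord c (chart_param c x) = x.
Proof. by move=> [p cp <-]; rewrite coordK. Qed.

Local Notation smM := (@smoothM R n M).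

Lemma smoothM_cst (a : R) : smM (fun=> a).
Proof. by move=> c _; exact: smooth_on_cst (@open_img c). Qed.

Lemma smoothM_add f h : smM f -> smM h -> smM (fun q => f q + h q).
Proof. by move=> sf sh c ac; exact: smooth_onD (@open_img c) (sf c ac) (sh c ac). Qed.

Lemma smoothM_mul f h : smM f -> smM h -> smM (fun q => f q * h q).
Proof. by move=> sf sh c ac; exact: smooth_onM (@open_img c) (sf c ac) (sh c ac). Qed.

(** A coordinate expression cut off by [chi] and extended by 0 outside the chart. It is smooth only
    when [chi] vanishes off a compact part of the image of the chart. *)
Definition chart_ext c (chi h : 'rV[R]_n -> R) : M -> R :=
  fun q => if `[< chart_dom c q >] then chi (chart_coord c q) * h (chart_coord c q) else 0.

Lemma chart_extE c (chi h : 'rV[R]_n -> R) q : chart_dom c q ->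
  chart_ext c chi h q = chi (chart_coord c q) * h (chart_coord c q).
Proof. by move=> cq; rewrite /chart_ext; case: asboolP. Qed.

(** This is where the Hausdorff axiom enters: the complement of the image is open, so that a cut-off
    function is locally zero there. *)
Lemma compact_param c (K : set 'rV[R]_n) : compact K -> K `<=` img c ->
  closed (chart_param c @` K).
Proof.
move=> cK Kc; apply: compact_closed; first exact: manifold_hausdorff.
apply: continuous_compact => //; apply: continuous_in_subspaceT => x /set_mem /Kc.
exact: param_continuous.
Qed.

(** Two open cases in any other chart [d]. Away from the closed image of [K] the function is zero;
    near a point of that image it is the smooth function [chi * h] composed with the transition map,
    whose coordinates supply the coefficients for the chain rule. *)
Lemma smoothM_ext c (chi h : 'rV[R]_n -> R) (K O : set 'rV[R]_n) : atlas M c -> smooth_on setT chi ->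
  compact K -> K `<=` O -> open O -> O `<=` img c -> (forall x, ~ K x -> chi x = 0) ->
  smooth_on O h -> smM (chart_ext c chi h).
Proof.
move=> ac schi cK KO oO Oc chi0 sh d ad; apply: smooth_on_local => x dx.
pose Kp := chart_param c @` K.
have clK : closed Kp by apply: compact_param => //; exact: subset_trans Oc.
have [Kx|nKx] := EM (Kp (chart_param d x)); last first.
  exists (img d `&` chart_param d @^-1` (~` Kp)).
    split; last by split.
    apply: open_setI_preimage; [exact: open_img|exact: param_continuous|exact: closed_openC].
  apply: smooth_on_congr (smooth_on_cst 0 _).
  - apply: open_setI_preimage; [exact: open_img|exact: param_continuous|exact: closed_openC].
  - move=> y [dy nKy] /=; rewrite /chart_ext; case: asboolP => // cy.
    rewrite chi0 ?mul0r // => Ky; apply: nKy; exists (chart_coord c (chart_param d y)) => //.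
    by rewrite coordK.
  - apply: open_setI_preimage; [exact: open_img|exact: param_continuous|exact: closed_openC].
pose B := chart_dom c `&` chart_coord c @^-1` O.
have oB : open B.
  by apply: open_setI_preimage => //; [exact: dom_open|exact: Defs.coord_continuous].
pose W := img d `&` chart_param d @^-1` B.
have oW : open W.
  by apply: open_setI_preimage => //; [exact: open_img|exact: param_continuous].
have Wx : W x.
  split=> //; have [y Ky yx] := Kx.
  have cy : chart_dom c (chart_param c y) by apply: dom_param; apply/Oc/KO.
  by rewrite /B /setI /= -yx; split=> //; rewrite /preimage /= paramK; [exact: KO|apply/Oc/KO].
exists W; first by split.
have str : smooth_on W (chart_coord c \o chart_param d).
  apply: smooth_onS (atlas_smooth ad ac) => y [[q dq <-]]; rewrite /preimage /= coordK // => -[cq _].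
  by exists q.
have sco i : smooth_on W (fun y => chart_coord c (chart_param d y) 0 i).
  have lin : linear (fun x : 'rV[R]_n => x 0 i) by move=> a u v; rewrite !mxE.
  pose l : {linear 'rV[R]_n -> R} := HB.pack (fun x : 'rV[R]_n => x 0 i) (GRing.isLinear.Build _ _ _ _ _ lin).
  exact: (@smooth_on_linear_comp _ _ _ _ _ l _ oW (@coord_continuous _ _ _ _ _) str).
have sp : smooth_on O (fun y => chi y * h y).
  by apply: smooth_onM => //; exact: smooth_onS schi.
have WO y : W y -> O (\sum_i chart_coord c (chart_param d y) 0 i *: unit_row i).
  by move=> [_ [_ Oy]]; rewrite -row_sum_unit.
apply: (smooth_on_congr oW _ (smooth_on_comp oW sco sp WO)).
by move=> y [dy [cy Oy]]; rewrite /= chart_extE // -row_sum_unit.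
Qed.

(** Derivations accept only globally defined functions, so each local function is replaced by a
    global one with the same germ. *)
Lemma chart_extend c x (O : set 'rV[R]_n) (h : 'rV[R]_n -> R) : atlas M c -> open O -> O `<=` img c -> O x ->
  smooth_on O h -> exists (f : M -> R) (W : set 'rV[R]_n),
  [/\ smM f, open W, W x, W `<=` O & forall y, W y -> f (chart_param c y) = h y].
Proof.
move=> ac oO Oc Ox sh; have [chi [K [schi chi1 cK KO chi0]]] := bump_exists oO Ox.
have [W [oW Wx] Wchi] : exists2 W, open_nbhs x W & W `<=` [set y | chi y = 1].
  by move: chi1; rewrite -nbhs_nearE nbhsE.
exists (chart_ext c chi h), (W `&` O); split.
- exact: smoothM_ext KO oO Oc chi0 sh.
- exact: openI.
- by [].
- exact: subIsetr.
move=> y [Wy Oy]; rewrite chart_extE; last by apply/dom_param/Oc.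
by rewrite paramK ?Wchi ?mul1r //; exact: Oc.
Qed.

Lemma open_dom_preimage c (O : set 'rV[R]_n) : open O ->
  open (chart_dom c `&` chart_coord c @^-1` O).
Proof.
by move=> oO; apply: open_setI_preimage => //; [exact: dom_open|exact: Defs.coord_continuous].
Qed.

Lemma open_img_preimage c (B : set M) : open B -> open (img c `&` chart_param c @^-1` B).
Proof.
by move=> oB; apply: open_setI_preimage => //; [exact: open_img|exact: param_continuous].
Qed.

Lemma bumpM c p (N : set M) : atlas M c -> chart_dom c p -> open N -> N p ->
  exists (b : M -> R) (K : set M), [/\ smM b, \near p, b p = 1, closed K,
    K `<=` chart_dom c `&` N & forall q, ~ K q -> b q = 0].
Proof.
move=> ac cp oN Np.
pose O := img c `&` chart_param c @^-1` N.
have oO : open O by exact: open_img_preimage.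
have Op : O (chart_coord c p) by split; [exact: img_coord|rewrite /preimage /= coordK].
have [chi [K [schi chi1 cK KO chi0]]] := bump_exists oO Op.
have Oc : O `<=` img c by move=> x [].
exists (chart_ext c chi (fun=> 1)), (chart_param c @` K); split.
- have s1 : smooth_on O (fun=> 1 : R) by exact: smooth_on_cst.
  exact: (smoothM_ext ac schi cK KO oO Oc chi0 s1).
- have [W [oW Wx] Wchi] : exists2 W, open_nbhs (chart_coord c p) W & W `<=` [set y | chi y = 1].
    by move: chi1; rewrite -nbhs_nearE nbhsE.
  have : nbhs p (chart_dom c `&` chart_coord c @^-1` W).
    by apply: open_nbhs_nbhs; split; [exact: open_dom_preimage|].
  by apply: filterS => q [cq Wq]; rewrite chart_extE // (Wchi _ Wq) mulr1.
- by apply: compact_param => //; exact: subset_trans Oc.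
- by move=> _ [x /KO [cx Nx] <-]; split=> //; exact: dom_param.
- move=> q nq; rewrite /chart_ext; case: asboolP => // cq; rewrite chi0 ?mul0r //.
  by move=> Kq; apply: nq; exists (chart_coord c q) => //; rewrite coordK.
Qed.

(** Choose [b] equal to 1 near [p] and vanishing wherever [f] and [h] may differ. Then [b * (f - h)]
    is identically zero, and the Leibniz rule at [p] leaves [w f - w h]. *)
Lemma tangentM_local p (w : vec R M) f h : tangent smM p w -> smM f -> smM h ->
  (\near p, f p = h p) -> w f = w h.
Proof.
move=> tw sf sh fh; have [c ac cp] := atlas_cover p.
have [N [oN Np] Nfh] : exists2 N, open_nbhs p N & N `<=` [set q | f q = h q].
  by move: fh; rewrite -nbhs_nearE nbhsE.
have [b [K [sb b1 _ KN b0]]] := bumpM ac cp oN Np.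
have smB : smM (fun q => f q - h q).
  rewrite (_ : (fun q => _) = fun q => f q + (-1) * h q); last first.
    by apply/funext => q; rewrite mulN1r.
  by apply: smoothM_add => //; apply: smoothM_mul => //; exact: smoothM_cst.
have := tangentM tw sb smB; rewrite (nbhs_singleton b1) (nbhs_singleton fh) subrr mul0r addr0 mul1r.
rewrite (tangentB smoothM_cst smoothM_mul tw sf sh).
rewrite (_ : (fun q => b q * _) = fun=> 0); last first.
  apply/funext => q; have [/KN[_ Nq]|/b0 ->] := EM (K q); last by rewrite mul0r.
  by rewrite (Nfh _ Nq) subrr mulr0.
by rewrite (tangent_cst smoothM_cst tw) => /esym /eqP; rewrite subr_eq0 => /eqP.
Qed.

Lemma coord_vecE c x y f : smM f -> coord_vec c x y f = 'D_y (f \o chart_param c) x.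
Proof. exact: cut_smoothE. Qed.

Lemma smoothM_diff c x f : atlas M c -> img c x -> smM f ->
  differentiable (f \o chart_param c) x.
Proof. by move=> ac cx sf; exact: (smooth_on_diff (sf c ac)). Qed.

Lemma coord_vec_tangent c x y : atlas M c -> img c x ->
  tangent smM (chart_param c x) (coord_vec c x y).
Proof.
move=> ac cx; split=> [a f h sf sh|f h sf sh|f nf].
- rewrite !coord_vecE //; last by apply: smoothM_add => //; apply: smoothM_mul => //; exact: smoothM_cst.
  have df := smoothM_diff ac cx sf; have dh := smoothM_diff ac cx sh.
  have da := differentiable_cst a x.
  rewrite (@derive_addE _ _ (fun x => a * (f \o chart_param c) x) (h \o chart_param c) x y _ dh); last exact: differentiableM.
  by rewrite (derive_mulE y da df) derive_cst mulr0 addr0.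
- rewrite !coord_vecE //; last exact: smoothM_mul.
  have df := smoothM_diff ac cx sf; have dh := smoothM_diff ac cx sh.
  exact: (derive_mulE y df dh).
- exact: cut_smooth0.
Qed.

Lemma coord_vec_lin c x (a : R) y y' : atlas M c -> img c x ->
  coord_vec c x (a *: y + y') = a *: coord_vec c x y + coord_vec c x y'.
Proof.
move=> ac cx; apply/funext => f; have [sf|nf] := EM (smM f); last first.
  by rewrite !fctE !/coord_vec !cut_smooth0 // scaler0 addr0.
rewrite !fctE !coord_vecE //; have df := smoothM_diff ac cx sf.
by rewrite !deriveE // linearP.
Qed.

Lemma coord_vec0 c x : atlas M c -> img c x -> coord_vec c x 0 = 0.
Proof.
move=> ac cx; apply/funext => f; have [sf|nf] := EM (smM f); last exact: cut_smooth0.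
by rewrite coord_vecE // derive0.
Qed.

Lemma coord_vecD c x y y' : atlas M c -> img c x ->
  coord_vec c x (y + y') = coord_vec c x y + coord_vec c x y'.
Proof. by move=> ac cx; rewrite -[y]scale1r coord_vec_lin // !scale1r. Qed.

Lemma coord_vecZ c x (a : R) y : atlas M c -> img c x ->
  coord_vec c x (a *: y) = a *: coord_vec c x y.
Proof. by move=> ac cx; rewrite -[_ *: _]addr0 coord_vec_lin // coord_vec0 // addr0. Qed.

Lemma coord_vec_row c x y : atlas M c -> img c x ->
  coord_vec c x y = \sum_i y 0 i *: coord_vec c x (unit_row i).
Proof.
move=> ac cx; rewrite {1}(row_sum_unit y).
elim/big_rec2: _ => [|i v z _ IH]; first exact: coord_vec0.
by rewrite coord_vec_lin // IH.
Qed.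

(** The coordinates of the chart times a bump function. On [W] they are true coordinates, so
    evaluating a vector on them reads off its components. *)
Lemma chart_functions c x : atlas M c -> img c x ->
  exists (X : 'I_n -> M -> R) (W : set 'rV[R]_n),
  [/\ forall i, smM (X i), open W, W x, W `<=` img c
    & forall y, W y -> (forall i, X i (chart_param c y) = y 0 i) /\
                      forall v i, coord_vec c y v (X i) = v 0 i].
Proof.
move=> ac cx.
have [chi [K [schi chi1 cK KO chi0]]] := bump_exists (@open_img c) cx.
have [W [oW Wx] Wchi] : exists2 W, open_nbhs x W & W `<=` [set y | chi y = 1].
  by move: chi1; rewrite -nbhs_nearE nbhsE.
pose X i := chart_ext c chi (fun y => y 0 i).
have sX i : smM (X i).
  exact: (smoothM_ext ac schi cK KO (@open_img c) _ chi0 (smooth_on_coord i (@open_img c))).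
have XE y : (W `&` img c) y -> forall i, X i (chart_param c y) = y 0 i.
  by move=> [Wy cy] i; rewrite /X chart_extE ?paramK ?Wchi ?mul1r //; exact: dom_param.
have oWc : open (W `&` img c) by apply: openI => //; exact: open_img.
exists X, (W `&` img c); split=> // y Wy; split; first exact: XE.
move=> v i; rewrite coord_vecE // (@near_derive_eq _ _ _ _ _ (fun y => y 0 i) v oWc _ y Wy).
  exact: derive_coord.
by move=> z Wz; exact: XE.
Qed.

Lemma coord_vec_inj c x y y' : atlas M c -> img c x ->
  coord_vec c x y = coord_vec c x y' -> y = y'.
Proof.
move=> ac cx E; have [X [W [_ _ Wx _ /(_ x Wx)[_ H]]]] := chart_functions ac cx.
by apply/rowP => i; rewrite -(H y i) E H.
Qed.

(* Hadamard's lemma makes a derivation at [p] a combination of the partial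
   derivatives of a chart. *)
Lemma tangentM_coord c p (w : vec R M) : atlas M c -> chart_dom c p -> tangent smM p w ->
  exists y, w = coord_vec c (chart_coord c p) y.
Proof.
move=> ac cp tw; set x := chart_coord c p; have cx : img c x by exact: img_coord.
have [X [W [sX oW Wx Wc XE]]] := chart_functions ac cx.
exists (\row_i w (X i)).
have pE : chart_param c x = p by rewrite coordK.
have tc := coord_vec_tangent (\row_i w (X i)) ac cx; rewrite pE in tc.
apply: (tangent_ext tw tc) => f sf; rewrite coord_vecE //.
have [U' [g [oU' U'x U'W sg [fE g0]]]] := hadamard oW Wx (smooth_onS Wc (sf c ac)).
have /choice[G HG] : forall i, exists G : M -> R, smM G /\ exists W' : set 'rV[R]_n,
    [/\ open W', W' x, W' `<=` U' & forall y, W' y -> G (chart_param c y) = g i y].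
  move=> i; have [G [W' [? ? ? ? ?]]] := chart_extend ac oU' (subset_trans U'W Wc) U'x (sg i).
  by exists G; split=> //; exists W'.
have sG i : smM (G i) by case: (HG i).
have Gp i : G i p = g i x.
  by case: (HG i) => _ [W' [_ W'x _ H]]; rewrite -H // pE.
have nG : \forall q \near p, forall i, G i q = g i (chart_coord c q).
  apply: filter_forall => i; case: (HG i) => _ [W' [oW' W'x _ H]].
  have : nbhs p (chart_dom c `&` chart_coord c @^-1` W').
    by apply: open_nbhs_nbhs; split; [exact: open_dom_preimage|].
  by apply: filterS => q [cq W'q]; rewrite -H // coordK.
(* A global function equal to [f] near [p]. The factors [X i - x_i] vanish at [p], so a derivation
   sees only the values [G i p], which are the partial derivatives of [f]. *)
pose h q := f p + \sum_i (X i q + - x 0 i) * G i q.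
have sXc i : smM (fun q => X i q + - x 0 i) by apply: smoothM_add => //; exact: smoothM_cst.
have sP i : smM (fun q => (X i q + - x 0 i) * G i q) by exact: smoothM_mul.
have [sS wS] := tangent_sum smoothM_cst smoothM_add tw (index_enum 'I_n) sP.
have sh : smM h by apply: smoothM_add => //; exact: smoothM_cst.
have Xp i : X i p = x 0 i by case: (XE x Wx) => H _; rewrite -H pE.
have nfh : \near p, f p = h p.
  have nU : nbhs p (chart_dom c `&` chart_coord c @^-1` U').
    by apply: open_nbhs_nbhs; split; [exact: open_dom_preimage|].
  apply: filterS2 nG nU => q Gq [cq U'q].
  have := fE _ U'q; rewrite /= coordK // => ->; rewrite pE /h; congr (_ + _).
  apply: eq_bigr => i _; rewrite Gq; congr ((_ - _) * _).
  by have [XEq _] := XE _ (U'W _ U'q); rewrite -XEq coordK.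
rewrite (tangentM_local tw sf sh nfh) /h (tangentD tw (smoothM_cst _) sS).
rewrite (tangent_cst smoothM_cst tw) add0r wS.
rewrite derive_row; last exact: smoothM_diff.
apply: eq_bigr => i _; rewrite (tangentM tw (sXc i) (sG i)) Xp subrr mul0r add0r.
rewrite (tangentD tw (sX i) (smoothM_cst _)) (tangent_cst smoothM_cst tw) addr0.
by rewrite Gp g0 mxE mulrC.
Qed.

End Manifolds.

(** * The slit bundle *)

Section ProductCalculus.
Context {R : realType} {V W : normedModType R}.

Lemma slice_derive (F : V * W -> R) x y b :
  'D_b (fun y => F (x, y)) y = 'D_((0, b) : V * W) F (x, y).
Proof.
have E : (fun h : R => h^-1 *: (((fun y => F (x, y)) \o shift y) (h *: b) - F (x, y))) =
    (fun h => h^-1 *: ((F \o shift (x, y)) (h *: ((0, b) : V * W)) - F (x, y))).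
  apply/funext => h /=; congr (_ *: (F _ - _)).
  by rewrite [RHS]surjective_pairing /= scaler0 add0r.
by rewrite /derive E.
Qed.

Lemma smooth_on_slice (U : set (V * W)) (F : V * W -> R) x :
  smooth_on U F -> smooth_on [set y | U (x, y)] (fun y => F (x, y)).
Proof.
move=> sF vs y Uxy.
have -> : foldr (fun v h => 'D_v h) (fun y => F (x, y)) vs =
    fun y => foldr (fun v h => 'D_v h) F [seq ((0, v) : V * W) | v <- vs] (x, y).
  elim: vs => [//|v vs IH] /=; rewrite IH; apply/funext => z; exact: slice_derive.
apply: (@differentiable_comp _ _ _ _ (fun y : W => (x, y))); last exact: sF.
by apply: differentiable_pair => //; exact: differentiable_cst.
Qed.

Lemma smooth_on_fst_comp (U : set (V * W)) (O : set V) (f : V -> R) : open U ->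
  (forall z, U z -> O z.1) -> smooth_on O f -> smooth_on U (fun z => f z.1).
Proof.
move=> oU UO sf vs z Uz.
have Df v z' : 'D_v (fun z : V * W => f z.1) z' = 'D_(v.1) f z'.1.
  by rewrite /derive; congr (lim (_ @ _)); apply/funext => h.
have -> : foldr (fun v h => 'D_v h) (fun z : V * W => f z.1) vs =
    fun z => foldr (fun v h => 'D_v h) f [seq v.1 | v <- vs] z.1.
  elim: vs => [//|v vs IH] /=; rewrite IH; apply/funext => z'.
  by rewrite /derive; congr (lim (_ @ _)); apply/funext => h.
apply: (@differentiable_comp _ _ _ _ fst); last by apply: sf; exact: UO.
by apply: linear_differentiable => w; exact: cvg_fst.
Qed.

Lemma smooth_on_snd_comp (U : set (V * W)) (O : set W) (f : W -> R) : open U ->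
  (forall z, U z -> O z.2) -> smooth_on O f -> smooth_on U (fun z => f z.2).
Proof.
move=> oU UO sf vs z Uz.
have -> : foldr (fun v h => 'D_v h) (fun z : V * W => f z.2) vs =
    fun z => foldr (fun v h => 'D_v h) f [seq v.2 | v <- vs] z.2.
  elim: vs => [//|v vs IH] /=; rewrite IH; apply/funext => z'.
  by rewrite /derive; congr (lim (_ @ _)); apply/funext => h.
apply: (@differentiable_comp _ _ _ _ snd); last by apply: sf; exact: UO.
by apply: linear_differentiable => w; exact: cvg_snd.
Qed.

Lemma derive_fst_comp (f : V -> R) (v z : V * W) :
  'D_v (fun z : V * W => f z.1) z = 'D_(v.1) f z.1.
Proof. by rewrite /derive; congr (lim (_ @ _)); apply/funext => h. Qed.

End ProductCalculus.

Section SlitBundles.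
Context {R : realType} {n : nat} {M : manifold R n}.
Implicit Types (c d : chart R n M) (p q : M) (x y a : 'rV[R]_n) (f h : M -> R)
  (u : slit M) (z : 'rV[R]_n * 'rV[R]_n) (F G : slit M -> R).
Local Notation smM := (@smoothM R n M).
Local Notation smT := (@smoothT R n M).
Local Notation V := ('rV[R]_n * 'rV[R]_n)%type.

Definition slit_dom c : set V := [set z | img c z.1 /\ z.2 <> 0].

(** The function that [smoothT] tests. For a chart of the atlas the default value 0 is never read on
    [slit_dom c], where [slit_param] succeeds. *)
Definition loc c F : V -> R := fun z => oapp F 0 (slit_param c z).

Lemma open_slit_dom c (B : set M) : open B ->
  open (slit_dom c `&` [set z | B (chart_param c z.1)]).
Proof.
move=> oB.
have -> : slit_dom c `&` [set z | B (chart_param c z.1)] =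
    (fst @^-1` (img c `&` chart_param c @^-1` B)) `&` (snd @^-1` (~` [set 0])).
  by apply/seteqP; split=> z [] [] //= ? ? ?.
apply: openI; apply: open_comp.
- by move=> z _; exact: cvg_fst.
- exact: open_img_preimage.
- by move=> z _; exact: cvg_snd.
- by apply: closed_openC; apply: accessible_closed_set1; apply: hausdorff_accessible; exact: norm_hausdorff.
Qed.

Lemma open_slit_domT c : open (slit_dom c).
Proof. by have := @open_slit_dom c setT openT; rewrite setIT. Qed.

Lemma slit_eq u u' : slit_proj u = slit_proj u' -> eta_field u = eta_field u' -> u = u'.
Proof.
by case: u u' => [[p v] H] [[p' v'] H']; rewrite /slit_proj /eta_field /= => E1 E2; apply: val_inj; rewrite /= E1 E2.
Qed.

Lemma slit_tangent u : tangent smM (slit_proj u) (eta_field u).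
Proof. by have /asboolP[] := valP u. Qed.

Lemma eta_neq0 u : eta_field u <> 0.
Proof. by have /asboolP[] := valP u. Qed.

Lemma slit_paramP c z u : slit_param c z = Some u ->
  slit_proj u = chart_param c z.1 /\ eta_field u = coord_vec c z.1 z.2.
Proof.
by rewrite /slit_param /slit_proj /eta_field; case: insubP => //= u' _ E [<-]; rewrite E.
Qed.

Lemma slit_param_Some c z : atlas M c -> slit_dom c z -> exists u, slit_param c z = Some u.
Proof.
move=> ac [cz z2]; rewrite /slit_param.
have H : `[< tangent smM (chart_param c z.1, coord_vec c z.1 z.2).1 (chart_param c z.1, coord_vec c z.1 z.2).2
   /\ (chart_param c z.1, coord_vec c z.1 z.2).2 <> 0 >].
  apply/asboolP; split=> /=; first exact: coord_vec_tangent.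
  by rewrite -(coord_vec0 ac cz) => /(coord_vec_inj ac cz).
by case: insubP => [u' _ _|/negP//]; exists u'.
Qed.

Lemma slit_paramE c z u : atlas M c -> slit_dom c z -> slit_proj u = chart_param c z.1 ->
  eta_field u = coord_vec c z.1 z.2 -> slit_param c z = Some u.
Proof.
move=> ac cz E1 E2; have [u' E] := slit_param_Some ac cz; rewrite E; congr Some.
by have [E1' E2'] := slit_paramP E; apply: slit_eq; [rewrite E1|rewrite E2].
Qed.

Lemma slit_coords c u : atlas M c -> chart_dom c (slit_proj u) ->
  exists z, slit_dom c z /\ slit_param c z = Some u.
Proof.
move=> ac cu; have [y ey] := tangentM_coord ac cu (slit_tangent u).
have cz : slit_dom c (chart_coord c (slit_proj u), y).
  split; first exact: img_coord.
  by move=> /= y0; apply: (@eta_neq0 u); rewrite ey y0 coord_vec0 //; exact: img_coord.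
by exists (chart_coord c (slit_proj u), y); split=> //; apply: slit_paramE => //=; rewrite coordK.
Qed.

Lemma slit_coords_exists u : exists c z, [/\ atlas M c, slit_dom c z & slit_param c z = Some u].
Proof.
have [c ac cu] := atlas_cover (slit_proj u).
by have [z [cz E]] := slit_coords ac cu; exists c, z.
Qed.

Lemma slit_param_dom c z u : slit_dom c z -> slit_param c z = Some u -> chart_dom c (slit_proj u).
Proof. by move=> [cz _] /slit_paramP[-> _]; exact: dom_param. Qed.

Lemma slit_param_inj c z z' u : atlas M c -> slit_dom c z -> slit_dom c z' ->
  slit_param c z = Some u -> slit_param c z' = Some u -> z = z'.
Proof.
move=> ac [cz _] [cz' _] /slit_paramP[p1 e1] /slit_paramP[p2 e2].
have E : z.1 = z'.1 by rewrite -(paramK cz) -(paramK cz') -p1 -p2.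
have := e2; rewrite e1 -E => /(coord_vec_inj ac cz) E2.
by case: z z' E E2 {cz cz' p1 e1 p2 e2} => [? ?] [? ?] /= -> ->.
Qed.

Lemma locE c z u F : slit_param c z = Some u -> loc c F z = F u.
Proof. by rewrite /loc => ->. Qed.

Lemma smoothT_loc c F : smT F -> atlas M c -> smooth_on (slit_dom c) (loc c F).
Proof. by move=> sF ac; exact: sF. Qed.

Lemma smoothT_local F :
  (forall c z0, atlas M c -> slit_dom c z0 -> exists (W : set V) (h : V -> R),
     [/\ open W, W z0, W `<=` slit_dom c, smooth_on W h
       & forall z u, W z -> slit_param c z = Some u -> F u = h z]) -> smT F.
Proof.
move=> H c ac; apply: smooth_on_local => z0 cz0.
have [W [h [oW Wz0 Wc sh E]]] := H c z0 ac cz0.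
exists W; first by split.
apply: (smooth_on_congr oW _ sh) => z Wz.
have [u Eu] := slit_param_Some ac (Wc _ Wz).
by rewrite -(E z u Wz Eu) -/(loc c F z) (locE _ Eu).
Qed.

Lemma smoothT_chart F :
  (forall c, atlas M c -> exists h : V -> R, smooth_on (slit_dom c) h /\
     forall z u, slit_dom c z -> slit_param c z = Some u -> F u = h z) -> smT F.
Proof.
move=> H; apply: smoothT_local => c z0 ac cz0; have [h [sh E]] := H c ac.
by exists (slit_dom c), h; split=> //; exact: open_slit_domT.
Qed.

Lemma smoothT_cst (b : R) : smT (fun=> b).
Proof.
apply: smoothT_chart => c ac; exists (fun=> b); split=> //.
exact: smooth_on_cst (@open_slit_domT c).
Qed.

Lemma smoothT_add F G : smT F -> smT G -> smT (fun u => F u + G u).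
Proof.
move=> sF sG; apply: smoothT_chart => c ac; exists (fun z => loc c F z + loc c G z); split.
  exact: smooth_onD (@open_slit_domT c) (sF c ac) (sG c ac).
by move=> z u cz E; rewrite !(locE _ E).
Qed.

Lemma smoothT_mul F G : smT F -> smT G -> smT (fun u => F u * G u).
Proof.
move=> sF sG; apply: smoothT_chart => c ac; exists (fun z => loc c F z * loc c G z); split.
  exact: smooth_onM (@open_slit_domT c) (sF c ac) (sG c ac).
by move=> z u cz E; rewrite !(locE _ E).
Qed.

Lemma smoothT_scale (b : R) F : smT F -> smT (fun u => b * F u).
Proof. by move=> sF; apply: smoothT_mul => //; exact: smoothT_cst. Qed.

Lemma smoothT_opp F : smT F -> smT (fun u => - F u).
Proof.
by move=> sF; rewrite (_ : (fun u => _) = fun u => (-1) * F u); [exact: smoothT_scale|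
  apply/funext => u; rewrite mulN1r].
Qed.

Lemma smoothT_sub F G : smT F -> smT G -> smT (fun u => F u - G u).
Proof. by move=> sF sG; apply: smoothT_add => //; exact: smoothT_opp. Qed.

Lemma smoothT_sum (I : Type) (r : seq I) (F : I -> slit M -> R) : (forall i, smT (F i)) ->
  smT (fun u => \sum_(i <- r) F i u).
Proof.
move=> sF; elim: r => [|i r IH].
  by rewrite (_ : (fun u => _) = fun=> 0); [exact: smoothT_cst|apply/funext => u; rewrite big_nil].
by rewrite (_ : (fun u => _) = fun u => F i u + \sum_(i <- r) F i u); [exact: smoothT_add|
  apply/funext => u; rewrite big_cons].
Qed.

Lemma smoothT_pull f : smM f -> smT (f \o @slit_proj R n M).
Proof.
move=> sf; apply: smoothT_chart => c ac; exists (fun z => f (chart_param c z.1)); split.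
  apply: (@smooth_on_fst_comp _ _ _ _ (img c) (f \o chart_param c)) => //.
  - exact: open_slit_domT.
  - by move=> z [].
  - exact: sf.
by move=> z u cz /slit_paramP[pu _]; rewrite /= pu.
Qed.

Lemma smoothT_eta f : smM f -> smT (fun u => eta_field u f).
Proof.
move=> sf; apply: smoothT_chart => c ac.
exists (fun z => \sum_i z.2 0 i * 'D_(unit_row i) (f \o chart_param c) z.1); split.
  apply: smooth_on_sum (@open_slit_domT c) _ => i; apply: smooth_onM (@open_slit_domT c) _ _.
    exact: (smooth_on_snd_comp (@open_slit_domT c) (O := setT) _ (smooth_on_coord i openT)).
  apply: (@smooth_on_fst_comp _ _ _ _ (img c) ('D_(unit_row i) (f \o chart_param c)) (@open_slit_domT c)) => [z []//|].
  exact: smooth_on_derive (sf c ac).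
move=> z u [cz _] /slit_paramP[_ ->]; rewrite coord_vecE // derive_row //.
exact: smoothM_diff.
Qed.

End SlitBundles.

(** * Vertical lift and projection in coordinates *)

Section SlitVectors.
Context {R : realType} {n : nat} {M : manifold R n}.
Implicit Types (c d : chart R n M) (p q : M) (x y a b : 'rV[R]_n) (f h : M -> R)
  (u : slit M) (z e : 'rV[R]_n * 'rV[R]_n) (F G : slit M -> R).
Local Notation smM := (@smoothM R n M).
Local Notation smT := (@smoothT R n M).
Local Notation V := ('rV[R]_n * 'rV[R]_n)%type.

Lemma pair_line z e (t : R) : z + t *: e = (z.1 + t *: e.1, z.2 + t *: e.2).
Proof. by rewrite [LHS]surjective_pairing. Qed.

Lemma loc_diff c z F : atlas M c -> slit_dom c z -> smT F -> differentiable (loc c F) z.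
Proof. by move=> ac cz sF; exact: (smooth_on_diff (smoothT_loc sF ac)). Qed.

Lemma locD c F G z : loc c (fun u => F u + G u) z = loc c F z + loc c G z.
Proof. by rewrite /loc; case: (slit_param c z) => //=; rewrite addr0. Qed.

Lemma locM c F G z : loc c (fun u => F u * G u) z = loc c F z * loc c G z.
Proof. by rewrite /loc; case: (slit_param c z) => //=; rewrite mul0r. Qed.

Lemma loc_cst c (r : R) z : atlas M c -> slit_dom c z -> loc c (fun=> r) z = r.
Proof. by move=> ac cz; have [u /locE ->] := slit_param_Some ac cz. Qed.

Lemma derive_loc_cst c (r : R) z e : atlas M c -> slit_dom c z -> 'D_e (loc c (fun=> r)) z = 0.
Proof.
move=> ac cz; rewrite (near_derive_eq e (@open_slit_domT _ _ _ c) (g := cst r) _ cz) ?derive_cst //.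
by move=> z' cz'; rewrite loc_cst.
Qed.

(** The analogue of [coord_vec] on the slit bundle: [e.1] holds the base components and [e.2] the
    fibre components. *)
Definition slit_vec c z e : vec R (slit M) := cut_smooth smT (fun F => 'D_e (loc c F) z).

Lemma slit_vecE c z e F : smT F -> slit_vec c z e F = 'D_e (loc c F) z.
Proof. exact: cut_smoothE. Qed.

Lemma slit_vec_tangent c z e u : atlas M c -> slit_dom c z -> slit_param c z = Some u ->
  tangent smT u (slit_vec c z e).
Proof.
move=> ac cz E; split=> [r F G sF sG|F G sF sG|F nF]; last exact: cut_smooth0.
- rewrite !slit_vecE //; last by apply: smoothT_add => //; exact: smoothT_scale.
  have dF := loc_diff ac cz sF; have dG := loc_diff ac cz sG.
  have dr := loc_diff ac cz (smoothT_cst r).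
  have -> : loc c (fun v => r * F v + G v) = fun z => loc c (fun=> r) z * loc c F z + loc c G z.
    by apply/funext => z'; rewrite (locD _ (fun v => r * F v)) locM.
  rewrite (@derive_addE _ _ (fun z => loc c (fun=> r) z * loc c F z) (loc c G) z e _ dG); last exact: differentiableM.
  by rewrite (derive_mulE e dr dF) (derive_loc_cst _ _ ac cz) mulr0 addr0 loc_cst.
- rewrite !slit_vecE //; last exact: smoothT_mul.
  have dF := loc_diff ac cz sF; have dG := loc_diff ac cz sG.
  have -> : loc c (fun v => F v * G v) = fun z => loc c F z * loc c G z.
    by apply/funext => z'; rewrite locM.
  by rewrite (derive_mulE e dF dG) !(locE _ E).
Qed.

Lemma slit_vec_lin c z (r : R) e e' : atlas M c -> slit_dom c z ->
  slit_vec c z (r *: e + e') = r *: slit_vec c z e + slit_vec c z e'.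
Proof.
move=> ac cz; apply/funext => F; have [sF|nF] := EM (smT F); last first.
  have E0 e1 : slit_vec c z e1 F = 0 by exact: cut_smooth0.
  by rewrite -[RHS]/(r * slit_vec c z e F + slit_vec c z e' F) !E0 mulr0 addr0.
rewrite -[RHS]/(r * slit_vec c z e F + slit_vec c z e' F) !slit_vecE //; have dF := loc_diff ac cz sF.
by rewrite !deriveE // linearP.
Qed.

Lemma slit_vec_rho c z e u : atlas M c -> slit_dom c z -> slit_param c z = Some u ->
  rho_map (slit_vec c z e) = coord_vec c z.1 e.1.
Proof.
move=> ac cz E; apply/funext => f; have [sf|nf] := EM (smM f); last first.
  by transitivity (0 : R); [exact: cut_smooth0|apply/esym; exact: cut_smooth0].
rewrite /rho_map cut_smoothE // slit_vecE; last exact: smoothT_pull.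
rewrite coord_vecE // -(derive_fst_comp (f \o chart_param c) e z).
apply: (near_derive_eq e (@open_slit_domT _ _ _ c)) => // z' cz'.
have [u' E'] := slit_param_Some ac cz'; rewrite (locE _ E') /=.
by have [-> _] := slit_paramP E'.
Qed.

(** The nonvanishing hypothesis keeps [insubd] in [translate] away from its default value [u]. *)
Lemma translate_param c z u a (t : R) : atlas M c -> slit_dom c z -> slit_param c z = Some u ->
  z.2 + t *: a <> 0 ->
  slit_param c (z.1, z.2 + t *: a) = Some (translate u (coord_vec c z.1 a) t).
Proof.
move=> ac cz E nz; have cz' : slit_dom c (z.1, z.2 + t *: a) by case: cz.
have [pu eu] := slit_paramP E.
have [u' E'] := slit_param_Some ac cz'; rewrite E'; congr Some.
have [pu' eu'] := slit_paramP E'; rewrite /= in pu' eu'.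
have : (slit_proj u, eta_field u + t *: coord_vec c z.1 a) = val u'.
  rewrite [RHS]surjective_pairing -[(val u').1]/(slit_proj u') -[(val u').2]/(eta_field u') pu' eu' pu eu.
  by case: cz => cz1 _; rewrite coord_vecD // coord_vecZ.
by rewrite /translate => ->; rewrite valKd.
Qed.

Lemma near_nonzero_line (y a : 'rV[R]_n) : y <> 0 -> \forall t \near (0 : R), y + t *: a <> 0.
Proof.
move=> y0; have [dl _] := differentiable_line y a 0.
have H := differentiable_continuous dl.
have : nbhs (y + (0 : R) *: a) (~` [set 0]); last exact: H.
apply: open_nbhs_nbhs; split; last by rewrite scale0r addr0.
by apply: closed_openC; apply: accessible_closed_set1; apply: hausdorff_accessible; exact: norm_hausdorff.
Qed.

(** Agreement of [G] and [g] along a single fibre is enough. The rule therefore also applies when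
    [G] is itself a fibre derivative, whose smoothness on the slit bundle is not known. *)
Lemma fibre_derivE c z u a G (g : V -> R) : atlas M c -> slit_dom c z -> slit_param c z = Some u ->
  (forall y u', y <> 0 -> slit_param c (z.1, y) = Some u' -> G u' = g (z.1, y)) ->
  differentiable g z ->
  fibre_deriv (coord_vec c z.1 a) G u = 'D_((0, a) : V) g z.
Proof.
move=> ac cz E Gg dg; rewrite /fibre_deriv derive1E.
have z0 : z + (0 : R) *: ((0, a) : V) = z by rewrite scale0r addr0.
have dg' : differentiable g (z + (0 : R) *: ((0, a) : V)) by rewrite z0.
have [_ dv] := is_derive_line dg'; rewrite z0 in dv; rewrite -dv.
apply: near_eq_derive; rewrite -nbhs_nearE.
apply: filterS (near_nonzero_line a (proj2 cz)) => t nz.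
rewrite (Gg _ _ nz (translate_param ac cz E nz)) pair_line /= scaler0 addr0 //.
Qed.

Lemma gamma_coord c z u a : atlas M c -> slit_dom c z -> slit_param c z = Some u ->
  gamma_map u (coord_vec c z.1 a) = slit_vec c z (0, a).
Proof.
move=> ac cz E; apply/funext => F; have [sF|nF] := EM (smT F); last first.
  by transitivity (0 : R); [exact: cut_smooth0|apply/esym; exact: cut_smooth0].
rewrite /gamma_map cut_smoothE // slit_vecE // (@fibre_derivE c z u a F (loc c F) ac cz E) //; last exact: loc_diff.
by move=> y u' _ E'; rewrite (locE _ E').
Qed.

Lemma gamma_tangent u (v : vec R M) : tangent smM (slit_proj u) v -> tangent smT u (gamma_map u v).
Proof.
move=> tv; have [c [z [ac cz E]]] := slit_coords_exists u.
have [a ->] := tangentM_coord ac (slit_param_dom cz E) tv.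
have [pu _] := slit_paramP E; have [cz1 _] := cz.
by rewrite pu paramK // (gamma_coord a ac cz E); exact: slit_vec_tangent.
Qed.

Lemma gamma_lin u (r : R) (v w : vec R M) : tangent smM (slit_proj u) v -> tangent smM (slit_proj u) w ->
  gamma_map u (r *: v + w) = r *: gamma_map u v + gamma_map u w.
Proof.
move=> tv tw; have [c [z [ac cz E]]] := slit_coords_exists u.
have cu := slit_param_dom cz E; have [pu _] := slit_paramP E; have [cz1 _] := cz.
have [a ->] := tangentM_coord ac cu tv; have [b ->] := tangentM_coord ac cu tw.
rewrite pu paramK // -(coord_vec_lin r a b ac cz1) !(gamma_coord _ ac cz E).
rewrite -(slit_vec_lin r (0, a) (0, b) ac cz).
by congr (slit_vec c z _); rewrite [RHS]surjective_pairing /= scaler0 addr0.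
Qed.

Lemma gamma_rho u (v : vec R M) : tangent smM (slit_proj u) v -> rho_map (gamma_map u v) = 0.
Proof.
move=> tv; have [c [z [ac cz E]]] := slit_coords_exists u.
have cu := slit_param_dom cz E; have [pu _] := slit_paramP E; have [cz1 _] := cz.
have [a ->] := tangentM_coord ac cu tv.
by rewrite pu paramK // (gamma_coord a ac cz E) (slit_vec_rho _ ac cz E) coord_vec0.
Qed.

Lemma rho_tangent u (w : vec R (slit M)) : tangent smT u w -> tangent smM (slit_proj u) (rho_map w).
Proof.
move=> [w1 w2 w3]; split=> [a f h sf sh|f h sf sh|f nf]; last exact: cut_smooth0.
- have sa : smM (fun q => a * f q + h q).
    by apply: smoothM_add => //; apply: smoothM_mul => //; exact: smoothM_cst.
  rewrite /rho_map !cut_smoothE //; exact: w1 (smoothT_pull sf) (smoothT_pull sh).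
- have sp : smM (fun q => f q * h q) by exact: smoothM_mul.
  rewrite /rho_map !cut_smoothE //; exact: w2 (smoothT_pull sf) (smoothT_pull sh).
Qed.

Lemma rhoE (w : vec R (slit M)) f : smM f -> rho_map w f = w (f \o @slit_proj R n M).
Proof. exact: cut_smoothE. Qed.

Lemma rho_lin (r : R) (v w : vec R (slit M)) : rho_map (r *: v + w) = r *: rho_map v + rho_map w.
Proof.
apply/funext => f; have [sf|nf] := EM (smM f); last first.
  have E0 w1 : rho_map w1 f = 0 by exact: cut_smooth0.
  by rewrite -[RHS]/(r * rho_map v f + rho_map w f) !E0 mulr0 addr0.
by rewrite -[RHS]/(r * rho_map v f + rho_map w f) !rhoE.
Qed.

End SlitVectors.

(** * Smooth fields on the slit bundle and their brackets *)

Section SlitFields.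
Context {R : realType} {n : nat} {M : manifold R n}.
Implicit Types (c d : chart R n M) (p q : M) (x y a b : 'rV[R]_n) (f h : M -> R)
  (u : slit M) (z e : 'rV[R]_n * 'rV[R]_n) (F G : slit M -> R)
  (X Y Z : slit M -> vec R M) (A B : slit M -> vec R (slit M)).
Local Notation smM := (@smoothM R n M).
Local Notation smT := (@smoothT R n M).
Local Notation pf := (@pi_field R n M).
Local Notation vf := (@vfield R n M).

Lemma pi_field_tangent X u : pf X -> tangent smM (slit_proj u) (X u).
Proof. by case. Qed.

Lemma pi_field_smooth X f : pf X -> smM f -> smT (fun u => X u f).
Proof. by case=> _; apply. Qed.

Lemma vfield_tangent A u : vf A -> tangent smT u (A u).
Proof. by case=> + _; exact. Qed.

Lemma vfield_smooth A F : vf A -> smT F -> smT (fun u => A u F).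
Proof. by case=> _; apply. Qed.

Lemma pi_field_eta : pf (@eta_field R n M).
Proof. by split; [exact: slit_tangent|exact: smoothT_eta]. Qed.

Lemma pi_field_lin F X Y : smT F -> pf X -> pf Y -> pf (fun u => F u *: X u + Y u).
Proof.
move=> sF pX pY; split=> [u|f sf]; first by apply: tangent_lin; exact: pi_field_tangent.
apply: (smoothT_add (F := fun u => F u * X u f) (G := fun u => Y u f)).
  exact: smoothT_mul sF (pi_field_smooth pX sf).
exact: pi_field_smooth.
Qed.

Lemma pi_field0 : pf 0.
Proof.
by split=> [u|f sf]; [exact: tangent0|exact: (smoothT_cst 0)].
Qed.

Lemma pi_fieldD X Y : pf X -> pf Y -> pf (X + Y).
Proof.
move=> pX pY; have := pi_field_lin (smoothT_cst 1) pX pY.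
by congr pf; apply/funext => u; rewrite scale1r.
Qed.

Lemma pi_fieldZ F X : smT F -> pf X -> pf (fun u => F u *: X u).
Proof.
move=> sF pX; have := pi_field_lin sF pX pi_field0.
by congr pf; apply/funext => u; rewrite addr0.
Qed.

Lemma pi_fieldN X : pf X -> pf (- X).
Proof.
move=> pX; have := pi_fieldZ (smoothT_cst (-1)) pX.
by congr pf; apply/funext => u; rewrite scaleN1r.
Qed.

Lemma pi_fieldB X Y : pf X -> pf Y -> pf (X - Y).
Proof. by move=> pX pY; apply: pi_fieldD => //; exact: pi_fieldN. Qed.

Lemma vfield_lin F A B : smT F -> vf A -> vf B -> vf (fun u => F u *: A u + B u).
Proof.
move=> sF vA vB; split=> [u|G sG]; first by apply: tangent_lin; exact: vfield_tangent.
apply: (smoothT_add (F := fun u => F u * A u G) (G := fun u => B u G)).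
  exact: smoothT_mul sF (vfield_smooth vA sG).
exact: vfield_smooth.
Qed.

Lemma vfield0 : vf 0.
Proof.
by split=> [u|f sf]; [exact: tangent0|exact: (smoothT_cst 0)].
Qed.

Lemma vfieldD A B : vf A -> vf B -> vf (A + B).
Proof.
move=> vA vB; have := vfield_lin (smoothT_cst 1) vA vB.
by congr vf; apply/funext => u; rewrite scale1r.
Qed.

Lemma vfieldZ F A : smT F -> vf A -> vf (fun u => F u *: A u).
Proof.
move=> sF vA; have := vfield_lin sF vA vfield0.
by congr vf; apply/funext => u; rewrite addr0.
Qed.

Lemma vfieldN A : vf A -> vf (- A).
Proof.
move=> vA; have := vfieldZ (smoothT_cst (-1)) vA.
by congr vf; apply/funext => u; rewrite scaleN1r.
Qed.

Lemma vfieldB A B : vf A -> vf B -> vf (A - B).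
Proof. by move=> vA vB; apply: vfieldD => //; exact: vfieldN. Qed.

Lemma vfield_bracket A B : vf A -> vf B -> vf (lie_bracket A B).
Proof.
move=> vA vB; split=> [u|F sF]; last first.
  by apply: smoothT_sub; apply: vfield_smooth => //; exact: vfield_smooth.
have [a1 a2 a3] := vfield_tangent u vA; have [b1 b2 b3] := vfield_tangent u vB.
have sA F : smT F -> smT (fun w => A w F) by exact: vfield_smooth.
have sB F : smT F -> smT (fun w => B w F) by exact: vfield_smooth.
have lin (r : R) D F G : vf D -> smT F -> smT G ->
    (fun w => D w (fun v => r * F v + G v)) = (fun w => r * D w F + D w G).
  by move=> vD sF sG; apply/funext => w; case: (vfield_tangent w vD) => H _ _; exact: H.
have lei D F G : vf D -> smT F -> smT G ->
    (fun w => D w (fun v => F v * G v)) = (fun w => F w * D w G + G w * D w F).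
  by move=> vD sF sG; apply/funext => w; case: (vfield_tangent w vD) => _ H _; exact: H.
have aD F G : smT F -> smT G -> A u (fun w => F w + G w) = A u F + A u G.
  by move=> sF sG; exact (tangentD (vfield_tangent u vA) sF sG).
have bD F G : smT F -> smT G -> B u (fun w => F w + G w) = B u F + B u G.
  by move=> sF sG; exact (tangentD (vfield_tangent u vB) sF sG).
split=> [r F G sF sG|F G sF sG|F nF]; rewrite /lie_bracket.
- rewrite !lin // a1 ?b1 //; try exact: sA; try exact: sB. ring.
- rewrite !lei // aD ?bD; try by apply: smoothT_mul => //; by [exact: sA|exact: sB].
  rewrite !a2 ?b2 //; try exact: sA; try exact: sB. ring.
- have -> : (fun w => A w F) = fun=> 0.
    by apply/funext => w; case: (vfield_tangent w vA) => _ _ H; exact: H.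
  have -> : (fun w => B w F) = fun=> 0.
    by apply/funext => w; case: (vfield_tangent w vB) => _ _ H; exact: H.
  rewrite (tangent_cst (@smoothT_cst R n M) (vfield_tangent u vA)).
  by rewrite (tangent_cst (@smoothT_cst R n M) (vfield_tangent u vB)) subrr.
Qed.

End SlitFields.

(** * Local frames *)

Section Frames.
Context {R : realType} {n : nat} {M : manifold R n}.
Implicit Types (c d : chart R n M) (p q : M) (x y a : 'rV[R]_n) (f h : M -> R)
  (u : slit M) (z e : 'rV[R]_n * 'rV[R]_n) (F G : slit M -> R)
  (X Y Z : slit M -> vec R M) (A B : slit M -> vec R (slit M)).
Local Notation smM := (@smoothM R n M).
Local Notation smT := (@smoothT R n M).
Local Notation V := ('rV[R]_n * 'rV[R]_n)%type.
Local Notation pf := (@pi_field R n M).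
Local Notation vf := (@vfield R n M).

Lemma slit_param_proj c z u : slit_dom c z -> slit_param c z = Some u ->
  chart_coord c (slit_proj u) = z.1.
Proof. by move=> [cz _] /slit_paramP[-> _]; rewrite paramK. Qed.

Lemma tangent_slit_coord c z u (v : vec R M) : atlas M c -> slit_dom c z ->
  slit_param c z = Some u -> tangent smM (slit_proj u) v -> exists a, v = coord_vec c z.1 a.
Proof.
move=> ac cz E tv; have [a ->] := tangentM_coord ac (slit_param_dom cz E) tv.
by rewrite (slit_param_proj cz E); exists a.
Qed.

Lemma open_slit_dom_fst c (W : set 'rV[R]_n) : open W -> open (slit_dom c `&` [set z | W z.1]).
Proof.
move=> oW; apply: openI; first exact: open_slit_domT.
by apply: (@open_comp _ _ fst) => // z _; exact: cvg_fst.
Qed.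

Lemma coordinate_functions c x : atlas M c -> img c x ->
  exists (X : 'I_n -> M -> R) (W : set 'rV[R]_n),
  [/\ forall i, smM (X i), open W, W x, W `<=` img c
    & forall z u, slit_dom c z -> W z.1 -> slit_param c z = Some u ->
      [/\ forall i, X i (slit_proj u) = z.1 0 i, forall i, eta_field u (X i) = z.2 0 i
        & forall v, tangent smM (slit_proj u) v -> v = coord_vec c z.1 (\row_i v (X i))]].
Proof.
move=> ac cx; have [X [W [sX oW Wx Wc H]]] := chart_functions ac cx.
exists X, W; split=> // z u cz Wz E; have [pu eu] := slit_paramP E.
have [H1 H2] := H _ Wz; split=> [i|i|v tv].
- by rewrite pu H1.
- by rewrite eu H2.
- have [a va] := tangent_slit_coord ac cz E tv.
  by rewrite {1}va; congr coord_vec; apply/rowP => i; rewrite mxE va H2.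
Qed.

Lemma sum_pair_fst (I : finType) (r : I -> R) (v : I -> 'rV[R]_n) :
  \sum_i r i *: ((v i, 0) : V) = (\sum_i r i *: v i, 0).
Proof.
rewrite [LHS]surjective_pairing (linear_sum fst) (linear_sum snd) /=; congr (_, _).
by rewrite big1 // => i _; rewrite scaler0.
Qed.

Lemma sum_pair_snd (I : finType) (r : I -> R) (v : I -> 'rV[R]_n) :
  \sum_i r i *: ((0, v i) : V) = (0, \sum_i r i *: v i).
Proof.
rewrite [LHS]surjective_pairing (linear_sum fst) (linear_sum snd) /=; congr (_, _).
by rewrite big1 // => i _; rewrite scaler0.
Qed.

Lemma derive_vert (Phi : V -> R) z a : differentiable Phi z ->
  'D_((0, a) : V) Phi z = \sum_i a 0 i * 'D_((0, unit_row i) : V) Phi z.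
Proof.
move=> dF; rewrite {1}(row_sum_unit a) -sum_pair_snd.
by rewrite deriveE // linear_sum; apply: eq_bigr => i _; rewrite linearZ /= deriveE.
Qed.

Lemma gamma_coordE c z u a F : atlas M c -> slit_dom c z -> slit_param c z = Some u -> smT F ->
  gamma_map u (coord_vec c z.1 a) F = \sum_i a 0 i * 'D_((0, unit_row i) : V) (loc c F) z.
Proof.
move=> ac cz E sF; rewrite (gamma_coord a ac cz E) slit_vecE // derive_vert //.
exact: loc_diff.
Qed.

Lemma vfield_ver Y : pf Y -> vf (ver Y).
Proof.
move=> pY; split=> [u|F sF]; first exact: gamma_tangent (pi_field_tangent u pY).
apply: smoothT_local => c z0 ac cz0; have [cz1 _] := cz0.
have [X [W [sX oW Wz0 Wc H]]] := coordinate_functions ac cz1.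
have oW' := @open_slit_dom_fst c W oW.
exists (slit_dom c `&` [set z | W z.1]).
exists (fun z => \sum_i loc c (fun u => Y u (X i)) z * 'D_((0, unit_row i) : V) (loc c F) z).
split=> //.
- have sub : slit_dom c `&` [set z | W z.1] `<=` slit_dom c by move=> z [].
  apply: smooth_on_sum => // i; apply: (smooth_onM oW').
    exact: smooth_onS sub (smoothT_loc (pi_field_smooth pY (sX i)) ac).
  exact: smooth_onS sub (smooth_on_derive _ (smoothT_loc sF ac)).
move=> z u [cz Wz] E; have [_ _ HY] := H z u cz Wz E.
rewrite /ver (HY _ (pi_field_tangent u pY)) (gamma_coordE _ ac cz E sF).
by apply: eq_bigr => i _; rewrite mxE (locE _ E).
Qed.

(** Pullbacks of vector fields on [M]. They are constant along the fibres, so that vertical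
    derivatives see only the metric coefficients, and every tangent vector is a value of one of
    them. *)
Definition basic (Y : slit M -> vec R M) : Prop := exists s : M -> vec R M,
  [/\ forall q, tangent smM q (s q), forall f, smM f -> smM (fun q => s q f)
    & Y = s \o @slit_proj R n M].

Lemma basic_pi_field Y : basic Y -> pf Y.
Proof.
move=> [s [ts ss ->]]; split=> [u|f sf]; first exact: ts.
exact: (smoothT_pull (ss f sf)).
Qed.

Lemma basic_lin (r : R) X Y : basic X -> basic Y -> basic (r *: X + Y).
Proof.
move=> [s [ts ss ->]] [t [tt st ->]]; exists (fun q => r *: s q + t q); split=> //.
  by move=> q; exact: tangent_lin.
move=> f sf; apply: (smoothM_add (f := fun q => r * s q f) (h := fun q => t q f)).
  exact: smoothM_mul (smoothM_cst r) (ss f sf).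
exact: st.
Qed.

Lemma basic0 : basic 0.
Proof.
exists 0; split=> // [q|f sf]; first exact: tangent0.
exact: (smoothM_cst 0).
Qed.

(** The coordinate frame multiplied by a cutoff, which is also [b]. The expansion of [b v] holds
    over all of [M]: off the compact set [K] both sides vanish, and on it the [X i] are true
    coordinates. *)
Lemma frame p : exists (b : M -> R) (B : 'I_n -> slit M -> vec R M) (X : 'I_n -> M -> R),
  [/\ smM b, b p = 1, forall i, basic (B i), forall i, smM (X i)
    & forall u v, tangent smM (slit_proj u) v ->
        b (slit_proj u) *: v = \sum_i v (X i) *: B i u].
Proof.
have [c ac cp] := atlas_cover p.
have [X [W [sX oW Wx Wc XE]]] := chart_functions ac (img_coord cp).
have [chi [K [schi chi1 cK KW chi0]]] := bump_exists oW Wx.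
have ext (h : 'rV[R]_n -> R) : smooth_on (img c) h -> smM (chart_ext c chi h).
  by move=> sh; exact: (smoothM_ext ac schi cK KW oW Wc chi0 (smooth_onS Wc sh)).
pose s i q : vec R M := if `[< chart_dom c q >] then
  chi (chart_coord c q) *: coord_vec c (chart_coord c q) (unit_row i) else 0.
exists (chart_ext c chi (fun=> 1)), (fun i => s i \o @slit_proj R n M), X; split=> //.
- by apply: ext; exact: smooth_on_cst (@open_img _ _ _ c).
- by rewrite chart_extE // mulr1 (nbhs_singleton chi1).
- move=> i; exists (s i); split=> // [q|f sf]; rewrite /s.
    case: asboolP => cq; last exact: tangent0.
    apply: tangent_scale; have := coord_vec_tangent (unit_row i) ac (img_coord cq).
    by rewrite coordK.
  rewrite (_ : (fun q => _) = chart_ext c chi ('D_(unit_row i) (f \o chart_param c))).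
    by apply: ext; exact: smooth_on_derive (sf c ac).
  apply/funext => q; rewrite /chart_ext; case: asboolP => // cq.
  by rewrite -[LHS]/(chi _ * coord_vec c _ _ f) coord_vecE.
move=> u v tv; rewrite /chart_ext /s /=; case: asboolP => cu; last first.
  by rewrite scale0r big1 // => i _; rewrite scaler0.
rewrite mulr1; have [Kx|/chi0 ->] := EM (K (chart_coord c (slit_proj u))); last first.
  by rewrite scale0r big1 // => i _; rewrite scale0r scaler0.
have [a va] := tangentM_coord ac cu tv; have [_ Xa] := XE _ (KW _ Kx).
rewrite {1}va (coord_vec_row _ ac (img_coord cu)) scaler_sumr; apply: eq_bigr => i _.
by rewrite va Xa !scalerA mulrC.
Qed.

Lemma basic_sum (r : 'I_n -> R) (B : 'I_n -> slit M -> vec R M) : (forall i, basic (B i)) ->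
  basic (\sum_i r i *: B i).
Proof.
move=> bB; elim: (index_enum _) => [|i s IH]; first by rewrite big_nil; exact: basic0.
by rewrite big_cons; exact: basic_lin.
Qed.

Lemma basic_value u v : tangent smM (slit_proj u) v -> exists Y, basic Y /\ Y u = v.
Proof.
move=> tv; have [b [B [X [sb bp bB sX /(_ u v tv)]]]] := frame (slit_proj u).
rewrite bp scale1r => E; exists (\sum_i v (X i) *: B i); split; first exact: basic_sum.
by rewrite fct_sumE -E.
Qed.

(** Apply [tau] to the global expansion of [b Y] in the basic fields [B i]: linearity over functions
    makes every term zero, and [b] is 1 at the point in question. *)
Lemma tensorial_basic u (tau : (slit M -> vec R M) -> R) :
  (forall F X Y, smT F -> pf X -> pf Y ->
     tau (fun u => F u *: X u + Y u) = F u * tau X + tau Y) ->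
  (forall Y, basic Y -> tau Y = 0) -> forall Y, pf Y -> tau Y = 0.
Proof.
move=> tlin t0 Y pY; have [b [B [X [sb bp bB sX H]]]] := frame (slit_proj u).
have sbT := smoothT_pull sb.
have tau0 : tau 0 = 0 by apply: t0; exact: basic0.
have E : (fun u => (b \o @slit_proj R n M) u *: Y u + (0 : slit M -> vec R M) u) =
         \sum_i (fun u => Y u (X i) *: B i u).
  by apply/funext => w; rewrite addr0 fct_sumE -H //; exact: pi_field_tangent.
have := tlin _ _ _ sbT pY pi_field0; rewrite E tau0 addr0 /= bp mul1r => <-.
have pS (s : seq 'I_n) : pf (\sum_(i <- s) (fun u => Y u (X i) *: B i u)) /\
    tau (\sum_(i <- s) (fun u => Y u (X i) *: B i u)) = 0.
  elim: s => [|i s [IH1 IH2]]; first by rewrite big_nil; split=> //; exact: pi_field0.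
  have sY := pi_field_smooth pY (sX i).
  rewrite big_cons; split; first exact: (pi_field_lin sY (basic_pi_field (bB i)) IH1).
  by have := tlin _ _ _ sY (basic_pi_field (bB i)) IH1; rewrite IH2 (t0 _ (bB i)) mulr0 addr0.
by have [] := pS (index_enum _).
Qed.

(** Cutting off in the base alone suffices, because a chart of [M] parametrizes whole punctured
    fibres. The cutoff [b] is chosen before [H] and serves all of them. *)
Lemma slit_extend c p : atlas M c -> chart_dom c p -> exists b : M -> R,
  [/\ smM b, \near p, b p = 1 & forall H : V -> R, smooth_on (slit_dom c) H ->
     exists G, [/\ smT G, forall z u, slit_dom c z -> slit_param c z = Some u ->
                             G u = b (slit_proj u) * H z
               & forall u, ~ chart_dom c (slit_proj u) -> G u = 0]].
Proof.
move=> ac cp.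
have [X [W [sX oW Wx Wc XE]]] := coordinate_functions ac (img_coord cp).
pose N := chart_dom c `&` chart_coord c @^-1` W.
have oN : open N by exact: open_dom_preimage.
have Np : N p by [].
have [b [K [sb b1 clK KN b0]]] := bumpM ac cp oN Np.
exists b; split=> // H sH.
(* Globally smooth functions [P i] whose combination with the fixed vectors [E i] recovers the
   coordinates of [u]; this is the form that [smooth_on_comp] accepts in another chart. *)
pose E (i : 'I_n + 'I_n) : V := match i with inl i => (unit_row i, 0) | inr i => (0, unit_row i) end.
pose P (i : 'I_n + 'I_n) : slit M -> R := match i with
  inl i => X i \o @slit_proj R n M | inr i => fun u => eta_field u (X i) end.
have sP i : smT (P i) by case: i => i; [exact: smoothT_pull|exact: smoothT_eta].
have PE z u : slit_dom c z -> W z.1 -> slit_param c z = Some u -> \sum_i P i u *: E i = z.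
  move=> cz Wz Ez; have [H1 H2 _] := XE z u cz Wz Ez.
  rewrite big_sumType /=.
  rewrite [RHS]surjective_pairing [in RHS](row_sum_unit z.1) [in RHS](row_sum_unit z.2).
  rewrite sum_pair_fst sum_pair_snd [LHS]surjective_pairing /= addr0 add0r.
  by congr (_, _); apply: eq_bigr => i _; rewrite ?H1 ?H2.
exists (fun u => if `[< chart_dom c (slit_proj u) >] then b (slit_proj u) * H (\sum_i P i u *: E i) else 0).
split; last by move=> u nu; case: asboolP.
- apply: smoothT_local => d z0 ad dz0; have [u0 E0] := slit_param_Some ad dz0.
  have [pu0 _] := slit_paramP E0.
  have [Ku|nKu] := EM (K (slit_proj u0)); last first.
    exists (slit_dom d `&` [set z | (~` K) (chart_param d z.1)]), (fun=> 0); split.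
    + by apply: open_slit_dom; exact: closed_openC.
    + by split=> //; rewrite /mkset -pu0.
    + by move=> z [].
    + by apply: smooth_on_cst; apply: open_slit_dom; exact: closed_openC.
    + move=> z u [dz nK] Ez; have [pu _] := slit_paramP Ez.
      by case: asboolP => // cu; rewrite b0 ?mul0r // pu.
  have oU := @open_slit_dom R n M d N oN.
  exists (slit_dom d `&` [set z | N (chart_param d z.1)]).
  exists (fun z => loc d (b \o @slit_proj R n M) z * H (\sum_i loc d (P i) z *: E i)).
  have sub : slit_dom d `&` [set z | N (chart_param d z.1)] `<=` slit_dom d by move=> z [].
  have NE z : (slit_dom d `&` [set z | N (chart_param d z.1)]) z ->
      exists u z', [/\ slit_param d z = Some u, slit_dom c z', W z'.1, slit_param c z' = Some u & N (slit_proj u)].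
    move=> [dz Nz]; have [u Ez] := slit_param_Some ad dz; have [pu _] := slit_paramP Ez.
    have Nu : N (slit_proj u) by rewrite pu.
    have [cu Wu] := Nu; have [z' [cz' E']] := slit_coords ac cu.
    by exists u, z'; split=> //; rewrite -(slit_param_proj cz' E').
  split=> //.
  + by split=> //; rewrite /mkset -pu0; have [] := KN _ Ku.
  + apply: (smooth_onM oU (smooth_onS sub (smoothT_loc (smoothT_pull sb) ad))).
    apply: (smooth_on_comp oU _ sH) => [i|z Uz]; first exact: smooth_onS sub (smoothT_loc (sP i) ad).
    have [u [z' [Ez cz' Wz' Ez' _]]] := NE z Uz.
    rewrite (eq_bigr (fun i => P i u *: E i)) ?(PE z' u cz' Wz' Ez') // => i _.
    by rewrite (locE _ Ez).
  + move=> z u Uz Ez; have [u' [z' [Ez2 _ _ _ [cu _]]]] := NE z Uz.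
    move: Ez2 cu; rewrite Ez => -[<-] cu; case: asboolP => // _; rewrite (locE _ Ez) /=.
    by congr (_ * H _); apply: eq_bigr => i _; rewrite (locE _ Ez).
- move=> z u cz Ez; have cu := slit_param_dom cz Ez; case: asboolP => // _.
  have [Kx|/b0 ->] := EM (K (slit_proj u)); last by rewrite !mul0r.
  congr (_ * H _); apply: PE => //; have [_ [_]] := KN _ Kx.
  by rewrite /preimage /= (slit_param_proj cz Ez).
Qed.

(** Global vector fields that coincide with the coordinate fields over a neighbourhood of [p].
    Coordinates of [u] are selected by choice, harmlessly since they are unique. *)
Lemma lift_exists c p : atlas M c -> chart_dom c p -> exists b : M -> R,
  [/\ smM b, \near p, b p = 1 & forall e, exists A, vf A /\
     forall z u, slit_dom c z -> slit_param c z = Some u -> A u = b (slit_proj u) *: slit_vec c z e].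
Proof.
move=> ac cp; have [b [sb b1 Hb]] := slit_extend ac cp.
exists b; split=> // e.
have /choice[zc Hz] : forall u, exists z, chart_dom c (slit_proj u) -> slit_dom c z /\ slit_param c z = Some u.
  move=> u; have [cu|ncu] := EM (chart_dom c (slit_proj u)); last by exists 0.
  by have [z Hz] := slit_coords ac cu; exists z.
pose A u : vec R (slit M) := if `[< chart_dom c (slit_proj u) >] then
  b (slit_proj u) *: slit_vec c (zc u) e else 0.
have AE z u : slit_dom c z -> slit_param c z = Some u -> A u = b (slit_proj u) *: slit_vec c z e.
  move=> cz E; rewrite /A; case: asboolP => [cu|]; last by case; exact: slit_param_dom cz E.
  have [cz' E'] := Hz u cu; by rewrite (slit_param_inj ac cz cz' E E').
exists A; split=> //; split=> [u|F sF].
  rewrite /A; case: asboolP => cu; last exact: tangent0.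
  by have [cz E] := Hz u cu; apply: tangent_scale; exact: slit_vec_tangent.
have [G [sG GE G0]] := Hb _ (smooth_on_derive e (smoothT_loc sF ac)).
rewrite (_ : (fun u => A u F) = G) //; apply/funext => u.
have [cu|ncu] := EM (chart_dom c (slit_proj u)); last first.
  by rewrite G0 // /A; case: asboolP.
have [cz E] := Hz u cu; rewrite (AE _ _ cz E) (GE _ _ cz E).
by rewrite -[LHS]/(_ * slit_vec c _ e F) slit_vecE.
Qed.

End Frames.

(** * The Finsler metric *)

Section Homogeneity.
Context {R : realType} {n : nat}.
Implicit Types (y a b : 'rV[R]_n) (phi : 'rV[R]_n -> R).

Definition homog (m : nat) phi : Prop := forall (t : R) y, 0 < t -> y <> 0 ->
  phi (t *: y) = t ^+ m * phi y.

Lemma scale_neq0 (t : R) y : 0 < t -> y <> 0 -> t *: y <> 0.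
Proof.
by move=> t0 y0 /eqP; rewrite scaler_eq0 => /orP[/eqP t00|/eqP//]; rewrite t00 ltxx in t0.
Qed.

Lemma derive_line0 phi y a : differentiable phi y ->
  is_derive (0 : R) (1 : R) (fun t : R => phi (y + t *: a)) ('D_a phi y).
Proof.
move=> dphi; have E : y + (0 : R) *: a = y by rewrite scale0r addr0.
have := @is_derive_line R _ phi y a 0; rewrite !E; exact.
Qed.

(** Differentiate phi(t y + s t a) = t^(m+1) phi(y + s a) at s = 0 and cancel one factor [t]. *)
Lemma homog_derive m phi a : homog m.+1 phi ->
  (forall y, y <> 0 -> differentiable phi y) -> homog m ('D_a phi).
Proof.
move=> hphi dphi t y t0 y0.
have ty0 := scale_neq0 t0 y0.
have [_ d1] := derive_line0 (t *: a) (dphi _ ty0).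
have [_ d2] := derive_line0 a (dphi _ y0).
have E : 'D_1 (fun s : R => phi (t *: y + s *: (t *: a))) 0 =
    'D_1 (fun s : R => t ^+ m.+1 * phi (y + s *: a)) 0.
  apply: near_eq_derive; apply: filterS (near_nonzero_line a y0) => s nz.
  by rewrite -hphi // scalerDr !scalerA [s * t]mulrC.
have dl : differentiable (fun s : R => phi (y + s *: a)) 0.
  by apply/derivable1_diffP; case: (derive_line0 a (dphi _ y0)).
move: E; rewrite d1 (derive_scaleE _ _ dl) d2.
have -> : 'D_(t *: a) phi (t *: y) = t * 'D_a phi (t *: y).
  by rewrite !(deriveE _ (dphi _ ty0)) linearZ.
by rewrite exprS -mulrA => /(mulfI (lt0r_neq0 t0)).
Qed.

(** Differentiate phi((1 + s) y) = (1 + s)^m phi(y) at s = 0. *)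
Lemma euler m phi y : homog m phi -> y <> 0 -> differentiable phi y ->
  'D_y phi y = m%:R * phi y.
Proof.
move=> hphi y0 dphi; have [_ <-] := derive_line0 y dphi.
have dX : is_derive (0 : R) (1 : R) (fun s : R => (1 + s) ^+ m) m%:R.
  have d1 : is_derive (0 : R) (1 : R) (fun s : R => 1 + s) 1.
    have := is_deriveD (is_derive_cst (1 : R) (0 : R) (1 : R)) (is_derive_id (0 : R) (1 : R)).
    by rewrite add0r.
  have := is_deriveX m d1; rewrite exprfctE => /is_derive_eq; apply.
  by rewrite addr0 expr1n mulr1 /GRing.scale /= mulr1.
transitivity ('D_1 (fun s : R => (1 + s) ^+ m * phi y) 0).
  apply: near_eq_derive; near=> s.
  rewrite -hphi //; first by rewrite scalerDl scale1r.
  rewrite -ltrBlDl sub0r; near: s; apply: lt_nbhsr; lra.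
have [dd dv] := dX; rewrite (derive_mulE _ _ (differentiable_cst _ _)).
  by rewrite derive_cst mulr0 add0r dv mulrC.
exact/derivable1_diffP.
Unshelve. all: by end_near. Qed.

End Homogeneity.

(** * The fibre Hessian and its vertical derivative *)

Section FinslerMetric.
Context {R : realType} {n : nat} {M : manifold R n}.
Implicit Types (c d : chart R n M) (p q : M) (x y a b : 'rV[R]_n) (f h : M -> R)
  (u : slit M) (z e : 'rV[R]_n * 'rV[R]_n) (F G : slit M -> R)
  (X Y Z : slit M -> vec R M) (A B : slit M -> vec R (slit M)).
Local Notation smM := (@smoothM R n M).
Local Notation smT := (@smoothT R n M).
Local Notation V := ('rV[R]_n * 'rV[R]_n)%type.
Local Notation pf := (@pi_field R n M).

(** Both directions are vertical, so the symmetry of second derivatives on row vectors applies to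
    the restriction of [Phi] to one punctured fibre. *)
Lemma vert_comm c z (Phi : V -> R) a b : slit_dom c z -> smooth_on (slit_dom c) Phi ->
  'D_((0, a) : V) ('D_((0, b) : V) Phi) z = 'D_((0, b) : V) ('D_((0, a) : V) Phi) z.
Proof.
move=> cz sP; have [cz1 z2] := cz.
pose U := [set y : 'rV[R]_n | slit_dom c (z.1, y)].
have oU : open U.
  have -> : U = ~` [set 0] by apply/seteqP; split=> y //= [].
  by apply: closed_openC; apply: accessible_closed_set1; apply: hausdorff_accessible; exact: norm_hausdorff.
have E v w : 'D_((0, v) : V) ('D_((0, w) : V) Phi) z = 'D_v ('D_w (fun y => Phi (z.1, y))) z.2.
  have -> : 'D_w (fun y => Phi (z.1, y)) = fun y => 'D_((0, w) : V) Phi (z.1, y).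
    by apply/funext => y; rewrite slice_derive.
  by rewrite (slice_derive ('D_((0, w) : V) Phi) z.1 z.2 v) -surjective_pairing.
rewrite !E; apply: (derive_comm a b oU); last exact: (smooth_on_slice (x := z.1) sP).
by rewrite /U /= -surjective_pairing.
Qed.

Lemma slit_dom_fibre c z y : slit_dom c z -> y <> 0 -> slit_dom c (z.1, y).
Proof. by move=> [cz _] y0. Qed.

Lemma fibre_deriv2 c z u a b F : atlas M c -> slit_dom c z -> slit_param c z = Some u -> smT F ->
  fibre_deriv (coord_vec c z.1 a) (fibre_deriv (coord_vec c z.1 b) F) u =
  'D_((0, a) : V) ('D_((0, b) : V) (loc c F)) z.
Proof.
move=> ac cz E sF; apply: (fibre_derivE _ ac cz E) => [y u' y0 E'|].
  have cz' := slit_dom_fibre cz y0.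
  apply: (fibre_derivE (z := (z.1, y)) _ ac cz' E') => [y' u'' _ E''|]; first by rewrite (locE _ E'').
  exact: loc_diff.
exact: (smooth_on_diff (smooth_on_derive _ (smoothT_loc sF ac))).
Qed.

Variable L : slit M -> R.
Hypothesis hL : finsler L.
Let L2 := fun u => L u ^+ 2.
Local Notation g := (finsler_metric L).

Lemma smoothT_L2 : smT L2.
Proof.
case: hL => sL _ _ _; rewrite /L2 (_ : (fun u => _) = fun u => L u * L u); first exact: smoothT_mul.
by apply/funext => u; rewrite expr2.
Qed.

Lemma fmetric_coord c z u a b : atlas M c -> slit_dom c z -> slit_param c z = Some u ->
  g u (coord_vec c z.1 a) (coord_vec c z.1 b) =
  2^-1 * 'D_((0, a) : V) ('D_((0, b) : V) (loc c L2)) z.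
Proof. by move=> ac cz E; rewrite /finsler_metric (fibre_deriv2 _ _ ac cz E smoothT_L2). Qed.

Lemma smooth_hess c b : atlas M c -> smooth_on (slit_dom c) ('D_((0, b) : V) (loc c L2)).
Proof. by move=> ac; exact: smooth_on_derive (smoothT_loc smoothT_L2 ac). Qed.

Lemma fmetric_sym u v w : tangent smM (slit_proj u) v -> tangent smM (slit_proj u) w ->
  g u v w = g u w v.
Proof.
move=> tv tw; have [c [z [ac cz E]]] := slit_coords_exists u.
have [a ->] := tangent_slit_coord ac cz E tv; have [b ->] := tangent_slit_coord ac cz E tw.
rewrite (fmetric_coord a b ac cz E) (fmetric_coord b a ac cz E).
exact (congr1 (fun r => 2^-1 * r) (vert_comm a b cz (smoothT_loc smoothT_L2 ac))).
Qed.

Lemma fmetric_linl u (r : R) v v' w : tangent smM (slit_proj u) v ->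
  tangent smM (slit_proj u) v' -> tangent smM (slit_proj u) w ->
  g u (r *: v + v') w = r * g u v w + g u v' w.
Proof.
move=> tv tv' tw; have [c [z [ac cz E]]] := slit_coords_exists u; have [cz1 _] := cz.
have [a ->] := tangent_slit_coord ac cz E tv; have [b ->] := tangent_slit_coord ac cz E tw.
have [a' ->] := tangent_slit_coord ac cz E tv'.
rewrite -(coord_vec_lin r a a' ac cz1) !(fmetric_coord _ _ ac cz E).
have dh := smooth_on_diff (smooth_hess b ac) cz.
have -> : ((0, r *: a + a') : V) = r *: ((0, a) : V) + (0, a').
  by rewrite [RHS]surjective_pairing /= scaler0 addr0.
by rewrite !(deriveE _ dh) linearP mulrDr mulrCA.
Qed.

Lemma fmetric_pos u v : tangent smM (slit_proj u) v -> v <> 0 -> 0 < g u v v.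
Proof. by case: hL => _ _ _; apply. Qed.

Lemma fmetric_smooth Y Z : pf Y -> pf Z -> smT (fun u => g u (Y u) (Z u)).
Proof.
move=> pY pZ; apply: smoothT_local => c z0 ac cz0; have [cz1 _] := cz0.
have [X [W [sX oW Wz0 Wc H]]] := coordinate_functions ac cz1.
pose U := slit_dom c `&` [set z | W z.1].
have oU : open U by exact: open_slit_dom_fst.
have sub : U `<=` slit_dom c by move=> z [].
exists U, (fun z => \sum_i \sum_j (loc c (fun u => Y u (X i)) z * (loc c (fun u => Z u (X j)) z *
    (2^-1 * 'D_((0, unit_row i) : V) ('D_((0, unit_row j) : V) (loc c L2)) z)))).
split=> //.
- apply: smooth_on_sum => // i; apply: smooth_on_sum => // j.
  apply: (smooth_onM oU).
    exact: smooth_onS sub (smoothT_loc (pi_field_smooth pY (sX i)) ac).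
  apply: (smooth_onM oU).
    exact: smooth_onS sub (smoothT_loc (pi_field_smooth pZ (sX j)) ac).
  by apply: (smooth_onZ _ oU); apply: smooth_onS sub _; exact: smooth_on_derive (smooth_hess _ ac).
move=> z u [cz Wz] E; have [_ _ HY] := H z u cz Wz E; have [zc1 _] := cz.
have tY := pi_field_tangent u pY; have tZ := pi_field_tangent u pZ.
have vec_sum v : tangent smM (slit_proj u) v -> v = \sum_i v (X i) *: coord_vec c z.1 (unit_row i).
  move=> tv; rewrite {1}(HY _ tv) coord_vec_row //; apply: eq_bigr => i _; by rewrite mxE.
have [pu _] := slit_paramP E.
have tc a : tangent smM (slit_proj u) (coord_vec c z.1 a) by rewrite pu; exact: coord_vec_tangent.
have g0l w : tangent smM (slit_proj u) w -> g u 0 w = 0.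
  move=> tw; have := fmetric_linl 1 (tangent0 _ _) (tangent0 _ _) tw.
  by rewrite scale1r addr0 mul1r => /eqP; rewrite -subr_eq0 opprD addrA subrr sub0r oppr_eq0 => /eqP.
have suml (r : 'I_n -> R) w : tangent smM (slit_proj u) w ->
    g u (\sum_i r i *: coord_vec c z.1 (unit_row i)) w = \sum_i r i * g u (coord_vec c z.1 (unit_row i)) w.
  move=> tw; elim: (index_enum _) => [|i s IH]; first by rewrite !big_nil g0l.
  rewrite !big_cons fmetric_linl ?IH //.
  by apply: tangent_vsum => j; exact: tangent_scale.
rewrite {1}(vec_sum _ tY) suml //; apply: eq_bigr => i _.
rewrite (locE _ E) -mulr_sumr; congr (_ * _).
rewrite (fmetric_sym (tc (unit_row i)) tZ) {1}(vec_sum _ tZ) (suml _ _ (tc (unit_row i))).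
apply: eq_bigr => j _; rewrite (fmetric_sym (tc (unit_row j)) (tc (unit_row i))).
by rewrite (locE _ E) (fmetric_coord _ _ ac cz E).
Qed.

Lemma homog_L2 c z : atlas M c -> slit_dom c z -> homog 2 (fun y => loc c L2 (z.1, y)).
Proof.
move=> ac cz t y t0 y0; have ty0 := scale_neq0 t0 y0.
have cy := slit_dom_fibre cz y0; have cty := slit_dom_fibre cz ty0.
have [u E] := slit_param_Some ac cy; have [u' E'] := slit_param_Some ac cty.
rewrite (locE _ E) (locE _ E') /L2 -exprMn; congr (_ ^+ 2).
have [pu eu] := slit_paramP E; have [pu' eu'] := slit_paramP E'.
case: hL => _ _ + _; apply=> //; first by rewrite pu pu'.
by rewrite eu eu' /=; apply: coord_vecZ => //; case: cz.
Qed.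

Lemma diff_slice c z (Phi : V -> R) : slit_dom c z -> smooth_on (slit_dom c) Phi ->
  forall y, y <> 0 -> differentiable (fun y => Phi (z.1, y)) y.
Proof.
move=> cz sP y y0; apply: (smooth_on_diff (smooth_on_slice (x := z.1) sP)).
exact: slit_dom_fibre cz y0.
Qed.

Lemma slice_deriveE (Phi : V -> R) x b :
  'D_b (fun y => Phi (x, y)) = fun y => 'D_((0, b) : V) Phi (x, y).
Proof. by apply/funext => y; rewrite slice_derive. Qed.

Lemma homog_dL2 c z b : atlas M c -> slit_dom c z ->
  homog 1 (fun y => 'D_((0, b) : V) (loc c L2) (z.1, y)).
Proof.
move=> ac cz; rewrite -slice_deriveE; apply: homog_derive; first exact: homog_L2.
exact: diff_slice cz (smoothT_loc smoothT_L2 ac).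
Qed.

Lemma homog_ddL2 c z a b : atlas M c -> slit_dom c z ->
  homog 0 (fun y => 'D_((0, a) : V) ('D_((0, b) : V) (loc c L2)) (z.1, y)).
Proof.
move=> ac cz; rewrite -slice_deriveE; apply: homog_derive; first exact: homog_dL2.
exact: diff_slice cz (smooth_hess b ac).
Qed.

(** Euler's relation twice: in degree 1 for a first fibre derivative, then in degree 2 for [L ^+ 2],
    whose factor 2 cancels the one half of the metric. *)
Lemma fmetric_eta u : g u (eta_field u) (eta_field u) = L u ^+ 2.
Proof.
have [c [z [ac cz E]]] := slit_coords_exists u; have [_ eu] := slit_paramP E; have [_ z2] := cz.
rewrite eu (fmetric_coord _ _ ac cz E) [z in 'D__ _ z]surjective_pairing -slice_derive.
rewrite (euler (homog_dL2 z.2 ac cz) z2 (diff_slice cz (smooth_hess z.2 ac) z2)) mul1r.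
rewrite -slice_derive.
rewrite (euler (homog_L2 ac cz) z2 (diff_slice cz (smoothT_loc smoothT_L2 ac) z2)).
by rewrite -surjective_pairing (locE _ E) /L2; field.
Qed.

(** Basic fields have constant components along the fibre, so only the metric coefficients are
    differentiated. The result is a third fibre derivative of half of [L ^+ 2], the classical Cartan
    tensor up to a factor 2. *)
Lemma gamma_metric c z u a b b' Y Z : atlas M c -> slit_dom c z -> slit_param c z = Some u ->
  basic Y -> basic Z -> Y u = coord_vec c z.1 b -> Z u = coord_vec c z.1 b' ->
  gamma_map u (coord_vec c z.1 a) (fun u => g u (Y u) (Z u)) =
  2^-1 * 'D_((0, a) : V) ('D_((0, b) : V) ('D_((0, b') : V) (loc c L2))) z.
Proof.
move=> ac cz E bY bZ Yu Zu.
have sg := fmetric_smooth (basic_pi_field bY) (basic_pi_field bZ).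
rewrite /gamma_map cut_smoothE //.
have dd := smooth_on_diff (smooth_on_derive ((0, b) : V) (smooth_hess b' ac)) cz.
rewrite (@fibre_derivE _ _ _ c z u a _ (fun z => 2^-1 * 'D_((0, b) : V) ('D_((0, b') : V) (loc c L2)) z) ac cz E).
- by rewrite (derive_mulE _ (differentiable_cst _ _) dd) derive_cst mulr0 addr0.
- move=> y u' y0 E'; have cz' := slit_dom_fibre cz y0.
  have [pu _] := slit_paramP E; have [pu' _] := slit_paramP E'.
  have -> : Y u' = coord_vec c z.1 b.
    by rewrite -Yu; case: bY => s [_ _ ->] /=; rewrite pu pu'.
  have -> : Z u' = coord_vec c z.1 b'.
    by rewrite -Zu; case: bZ => s [_ _ ->] /=; rewrite pu pu'.
  exact: (fmetric_coord b b' ac cz' E').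
- by apply: differentiableM => //; exact: differentiable_cst.
Qed.

Lemma cartan_sym X Y Z u : basic X -> basic Y -> basic Z ->
  gamma_map u (X u) (fun u => g u (Y u) (Z u)) = gamma_map u (Y u) (fun u => g u (X u) (Z u)).
Proof.
move=> bX bY bZ; have [c [z [ac cz E]]] := slit_coords_exists u.
have [a Xa] := tangent_slit_coord ac cz E (pi_field_tangent u (basic_pi_field bX)).
have [b Yb] := tangent_slit_coord ac cz E (pi_field_tangent u (basic_pi_field bY)).
have [b' Zb] := tangent_slit_coord ac cz E (pi_field_tangent u (basic_pi_field bZ)).
rewrite Xa Yb (gamma_metric a ac cz E bY bZ Yb Zb) (gamma_metric b ac cz E bX bZ Xa Zb).
exact (congr1 (fun r => 2^-1 * r) (vert_comm a b cz (smooth_hess b' ac))).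
Qed.

(** The fibre Hessian of [L ^+ 2] is homogeneous of degree 0, so Euler's relation kills its radial
    derivative. *)
Lemma cartan_eta Y Z u : basic Y -> basic Z ->
  gamma_map u (eta_field u) (fun u => g u (Y u) (Z u)) = 0.
Proof.
move=> bY bZ; have [c [z [ac cz E]]] := slit_coords_exists u; have [_ z2] := cz.
have [b Yb] := tangent_slit_coord ac cz E (pi_field_tangent u (basic_pi_field bY)).
have [b' Zb] := tangent_slit_coord ac cz E (pi_field_tangent u (basic_pi_field bZ)).
have [_ eu] := slit_paramP E.
rewrite eu (gamma_metric _ ac cz E bY bZ Yb Zb) [z in 'D__ _ z]surjective_pairing -slice_derive.
have sh := smooth_on_derive ((0, b) : V) (smooth_hess b' ac).
by rewrite (euler (homog_ddL2 b b' ac cz) z2 (diff_slice cz sh z2)) mul0r mulr0.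
Qed.

End FinslerMetric.

(** * Regular connections *)

Section RegularConnection.
Context {R : realType} {n : nat} {M : manifold R n}.
Implicit Types (c d : chart R n M) (p q : M) (x y a b : 'rV[R]_n) (f h : M -> R)
  (u : slit M) (z e : 'rV[R]_n * 'rV[R]_n) (F G : slit M -> R)
  (X Y Z : slit M -> vec R M) (A B : slit M -> vec R (slit M)).
Local Notation smM := (@smoothM R n M).
Local Notation smT := (@smoothT R n M).
Local Notation V := ('rV[R]_n * 'rV[R]_n)%type.
Local Notation pf := (@pi_field R n M).
Local Notation vf := (@vfield R n M).
Local Notation eta := (@eta_field R n M).

(** Along [u + t v] the tautological section is affine in [t] with slope [v]. In particular the
    vertical lift is injective. *)
Lemma gamma_eta u (v : vec R M) f : tangent smM (slit_proj u) v -> smM f ->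
  gamma_map u v (fun u => eta_field u f) = v f.
Proof.
move=> tv sf; rewrite /gamma_map cut_smoothE; last exact: smoothT_eta.
have [c [z [ac cz E]]] := slit_coords_exists u; have [cz1 z2] := cz.
have [a va] := tangent_slit_coord ac cz E tv; have [_ eu] := slit_paramP E.
rewrite /fibre_deriv derive1E.
transitivity ('D_1 (fun t : R => eta_field u f + v f * t) 0).
  apply: near_eq_derive; apply: filterS (near_nonzero_line a z2) => t nz.
  have [_ e'] := slit_paramP (translate_param ac cz E nz).
  by rewrite va e' /= coord_vecD // coord_vecZ // -eu mulrC.
have di : differentiable (id : R -> R) 0 by exact: differentiable_id || exact/derivable1_diffP/derivable_id.
rewrite (derive_addE _ (differentiable_cst _ _)); last exact: differentiableM (differentiable_cst _ _) di.
by rewrite derive_cst add0r (derive_scaleE _ _ di) derive_id mulr1.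
Qed.

Lemma rho0 : rho_map (0 : vec R (slit M)) = 0.
Proof.
by have := rho_lin (-1) (0 : vec R (slit M)) 0; rewrite scaler0 addr0 scaleN1r addNr.
Qed.

Lemma gamma_inj u (v : vec R M) : tangent smM (slit_proj u) v -> gamma_map u v = 0 -> v = 0.
Proof.
move=> tv g0; apply: (tangent_ext tv (tangent0 _ _)) => f sf.
by rewrite -(gamma_eta tv sf) g0.
Qed.

Lemma smoothT_prod (I : Type) (r : seq I) (F : I -> slit M -> R) : (forall i, smT (F i)) ->
  smT (fun u => \prod_(i <- r) F i u).
Proof.
move=> sF; elim: r => [|i r IH].
  by rewrite (_ : (fun u => _) = fun=> 1); [exact: smoothT_cst|apply/funext => u; rewrite big_nil].
by rewrite (_ : (fun u => _) = fun u => F i u * \prod_(i <- r) F i u); [exact: smoothT_mul|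
  apply/funext => u; rewrite big_cons].
Qed.

Lemma smoothT_det m (P : slit M -> 'M[R]_m) : (forall i j, smT (fun u => P u i j)) ->
  smT (fun u => \det (P u)).
Proof.
move=> sP; apply: smoothT_sum => s; apply: smoothT_mul; first exact: smoothT_cst.
by apply: smoothT_prod => i; exact: sP.
Qed.

Lemma smoothT_adj m (P : slit M -> 'M[R]_m) i j : (forall i j, smT (fun u => P u i j)) ->
  smT (fun u => (\adj (P u)) i j).
Proof.
move=> sP; rewrite (_ : (fun u => _) = fun u => (-1) ^+ (j + i) * \det (row' j (col' i (P u)))).
  apply: smoothT_scale; apply: smoothT_det => i' j'.
  rewrite (_ : (fun u => _) = fun u => P u (lift j i') (lift i j')) //.
  by apply/funext => u; rewrite !mxE.
by apply/funext => u; rewrite mxE.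
Qed.

(** The shape in which Cramer's rule delivers a horizontal lift: numerator and denominator are
    global smooth functions, while the relation holds only over an open set of the base. *)
Lemma smoothT_quotient F : (forall u, exists (N : set M) (D G : slit M -> R),
   [/\ open N, N (slit_proj u), smT D, smT G
     & forall v, N (slit_proj v) -> D v != 0 /\ D v * F v = G v]) -> smT F.
Proof.
move=> H; apply: smoothT_local => c z0 ac cz0.
have [u0 E0] := slit_param_Some ac cz0; have [N [D [G [oN Nu sD sG DG]]]] := H u0.
have oU := @open_slit_dom R n M c N oN.
have sub : slit_dom c `&` [set z | N (chart_param c z.1)] `<=` slit_dom c by move=> z [].
exists (slit_dom c `&` [set z | N (chart_param c z.1)]), (fun z => loc c G z * (loc c D z)^-1).
have NE z : (slit_dom c `&` [set z | N (chart_param c z.1)]) z ->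
    exists u, slit_param c z = Some u /\ N (slit_proj u).
  move=> [cz Nz]; have [u Ez] := slit_param_Some ac cz; have [pu _] := slit_paramP Ez.
  by exists u; rewrite pu.
split=> //.
- by split=> //=; have [<- _] := slit_paramP E0.
- apply: (smooth_onM oU); first exact: smooth_onS sub (smoothT_loc sG ac).
  apply: (smooth_onV oU); last exact: smooth_onS sub (smoothT_loc sD ac).
  by move=> z /NE[u [E Nu']]; rewrite (locE _ E); case: (DG u Nu').
move=> z u Uz E; rewrite !(locE _ E).
have [u' []] := NE z Uz; rewrite E => -[<-] /DG [D0 <-].
by rewrite mulrAC divff // mul1r.
Qed.

Variable nabla : connection_map M.
Hypothesis conn : is_connection nabla.

Lemma nabla_linw u (r : R) w w' X : tangent smT u w -> tangent smT u w' -> pf X ->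
  nabla u (r *: w + w') X = r *: nabla u w X + nabla u w' X.
Proof. by case: conn => H _ _ _; exact: H. Qed.

Lemma nablaDw u w w' X : tangent smT u w -> tangent smT u w' -> pf X ->
  nabla u (w + w') X = nabla u w X + nabla u w' X.
Proof. by move=> tw tw' pX; have := nabla_linw 1 tw tw' pX; rewrite !scale1r. Qed.

Lemma nabla0w u X : pf X -> nabla u 0 X = 0.
Proof.
move=> pX; have := nabla_linw (-1) (tangent0 _ u) (tangent0 _ u) pX.
by rewrite scaler0 addr0 scaleN1r addNr.
Qed.

Lemma nablaZw u (r : R) w X : tangent smT u w -> pf X -> nabla u (r *: w) X = r *: nabla u w X.
Proof.
by move=> tw pX; have := nabla_linw r tw (tangent0 _ u) pX; rewrite !addr0 nabla0w // addr0.
Qed.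

Lemma nablaD u w X Y : tangent smT u w -> pf X -> pf Y -> nabla u w (X + Y) = nabla u w X + nabla u w Y.
Proof. by case: conn => _ H _ _; exact: H. Qed.

Lemma nabla_leibniz u w F X : tangent smT u w -> smT F -> pf X ->
  nabla u w (fun u => F u *: X u) = F u *: nabla u w X + w F *: X u.
Proof. by case: conn => _ _ H _; exact: H. Qed.

Lemma nabla_tangent u w X : tangent smT u w -> pf X -> tangent smM (slit_proj u) (nabla u w X).
Proof. by case: conn => _ _ _ [H _]; exact: H. Qed.

Lemma cov_pi_field A X : vf A -> pf X -> pf (cov nabla A X).
Proof. by case: conn => _ _ _ [_ H]; exact: H. Qed.

Hypothesis reg : is_regular nabla.

Local Notation K := (Kmap nabla).

Lemma vertical_horizontal0 u w : tangent smT u w -> rho_map w = 0 -> K u w = 0 -> w = 0.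
Proof. by move=> tw r0 k0; case: (reg u) => _; apply; split. Qed.

Lemma horizontal_unique u w w' : tangent smT u w -> tangent smT u w' -> K u w = 0 -> K u w' = 0 ->
  rho_map w = rho_map w' -> w = w'.
Proof.
move=> tw tw' k k' r; apply/eqP; rewrite -subr_eq0; apply/eqP.
have E : w - w' = (-1) *: w' + w by rewrite scaleN1r addrC.
apply: (@vertical_horizontal0 u); rewrite E.
- exact: tangent_lin.
- by rewrite rho_lin r scaleN1r addNr.
- by rewrite /Kmap nabla_linw //; [rewrite -!/(K u _) k k' scaler0 addr0|exact: pi_field_eta].
Qed.

(** Take the horizontal part of any coordinate lift of [v]; the vertical part discarded has zero
    projection. *)
Lemma beta_exists u (v : vec R M) : tangent smM (slit_proj u) v ->
  exists w, horizontal nabla u w /\ rho_map w = v.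
Proof.
move=> tv; have [c [z [ac cz E]]] := slit_coords_exists u.
have [a va] := tangent_slit_coord ac cz E tv.
have tw := slit_vec_tangent ((a, 0) : V) ac cz E.
have [/(_ _ tw)[w1 [w2 [[tw1 r1] hw2 E12]]] _] := reg u.
exists w2; split=> //; rewrite va.
have <- := slit_vec_rho ((a, 0) : V) ac cz E.
by rewrite E12 -[w1]scale1r rho_lin r1 scaler0 add0r.
Qed.

Lemma betaP u (v : vec R M) : tangent smM (slit_proj u) v ->
  [/\ tangent smT u (beta_map nabla u v), K u (beta_map nabla u v) = 0
    & rho_map (beta_map nabla u v) = v].
Proof.
move=> /beta_exists ex; rewrite /beta_map.
by have [[]] := xgetPex 0 ex.
Qed.

Lemma beta_unique u w : tangent smT u w -> K u w = 0 -> beta_map nabla u (rho_map w) = w.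
Proof.
move=> tw k0; have [tb kb rb] := betaP (rho_tangent tw).
exact: horizontal_unique tb tw kb k0 rb.
Qed.

Lemma beta_lin u (r : R) (v v' : vec R M) : tangent smM (slit_proj u) v -> tangent smM (slit_proj u) v' ->
  beta_map nabla u (r *: v + v') = r *: beta_map nabla u v + beta_map nabla u v'.
Proof.
move=> tv tv'; have [tb kb rb] := betaP tv; have [tb' kb' rb'] := betaP tv'.
have tl := tangent_lin r tb tb'.
rewrite -[in LHS]rb -[in LHS]rb' -rho_lin beta_unique //.
rewrite /Kmap nabla_linw //; last exact: pi_field_eta.
by rewrite -!/(K u _) kb kb' scaler0 addr0.
Qed.

(** [beta_map] is chosen point by point, so smoothness has to come from a formula. Near a point the
    horizontal lift is a smooth lift corrected by a vertical field, whose coefficients solve a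
    linear system with smooth entries, invertible by regularity. *)
Lemma vfield_hor X : pf X -> vf (hor nabla X).
Proof.
move=> pX; split=> [u|F sF]; first by have [] := betaP (pi_field_tangent u pX).
apply: smoothT_quotient => u0.
have [c ac cp] := atlas_cover (slit_proj u0); set p := slit_proj u0 in cp *.
have [Xc [W [sX oW Wx Wc XE]]] := coordinate_functions ac (img_coord cp).
have [b [sb b1 Hb]] := lift_exists ac cp.
have /choice[H HE] := fun i => Hb ((unit_row i, 0) : V).
have /choice[T TE] := fun i => Hb ((0, unit_row i) : V).
have [N1 [oN1 N1p] N1b] : exists2 N, open_nbhs p N & N `<=` [set q | b q = 1].
  by move: b1; rewrite -nbhs_nearE nbhsE.
(* A smooth lift of [X] near [p], in general not horizontal. *)
pose At u := \sum_i X u (Xc i) *: H i u.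
have sAt : vf At.
  have -> : At = \sum_i (fun u => X u (Xc i) *: H i u) by apply/funext => u; rewrite fct_sumE.
  elim: (index_enum _) => [|i s IH]; first by rewrite big_nil; exact: vfield0.
  rewrite big_cons; apply: vfieldD => //; apply: vfieldZ; first exact: pi_field_smooth.
  by have [] := HE i.
(* The connection map on the vertical coordinate fields: row [j] holds the components of the
   covariant derivative of [eta] along [T j]. *)
pose P u : 'M[R]_n := \matrix_(j, i) cov nabla (T j) eta u (Xc i).
have sP i j : smT (fun u => P u i j).
  rewrite (_ : (fun u => _) = fun u => cov nabla (T i) eta u (Xc j)).
    apply: pi_field_smooth => //; apply: cov_pi_field; last exact: pi_field_eta.
    by have [] := TE i.
  by apply/funext => u; rewrite mxE.
pose kap u : 'rV[R]_n := \row_i cov nabla At eta u (Xc i).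
have skap i : smT (fun u => kap u 0 i).
  rewrite (_ : (fun u => _) = fun u => cov nabla At eta u (Xc i)).
    by apply: pi_field_smooth => //; apply: cov_pi_field => //; exact: pi_field_eta.
  by apply/funext => u; rewrite mxE.
(* The correction [- cv / det P] cancels the connection map of [At]. Using the adjugate keeps the
   coefficients globally smooth, the determinant being the only denominator. *)
pose cv u := kap u *m \adj (P u).
have scv j : smT (fun u => cv u 0 j).
  rewrite (_ : (fun u => _) = fun u => \sum_i kap u 0 i * (\adj (P u)) i j).
    by apply: smoothT_sum => i; apply: smoothT_mul => //; exact: smoothT_adj.
  by apply/funext => u; rewrite mxE.
exists (chart_dom c `&` chart_coord c @^-1` W `&` N1), (fun u => \det (P u)).
exists (fun u => \det (P u) * At u F - \sum_j cv u 0 j * T j u F); split.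
- by apply: openI => //; exact: open_dom_preimage.
- by [].
- exact: smoothT_det.
- apply: smoothT_sub; first by apply: smoothT_mul; [exact: smoothT_det|exact: vfield_smooth].
  apply: smoothT_sum => j; apply: smoothT_mul => //; apply: vfield_smooth => //; by have [] := TE j.
move=> u [[cu Wu] N1u]; have [z [cz E]] := slit_coords ac cu.
have Wz : W z.1 by rewrite -(slit_param_proj cz E).
have bu : b (slit_proj u) = 1 := N1b _ N1u.
have [_ _ vE] := XE z u cz Wz E.
have v0 v : tangent smM (slit_proj u) v -> (forall i, v (Xc i) = 0) -> v = 0.
  move=> tv vi; rewrite (vE v tv) (_ : \row_i _ = 0) ?coord_vec0 //; first by case: cz.
  by apply/rowP => i; rewrite !mxE.
have HEu i : H i u = slit_vec c z (unit_row i, 0).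
  by have [_ /(_ z u cz E) ->] := HE i; rewrite bu scale1r.
have TEu i : T i u = gamma_map u (coord_vec c z.1 (unit_row i)).
  by have [_ /(_ z u cz E) ->] := TE i; rewrite bu scale1r (gamma_coord _ ac cz E).
have [cz1 _] := cz; have [pu _] := slit_paramP E.
have tc a : tangent smM (slit_proj u) (coord_vec c z.1 a) by rewrite pu; exact: coord_vec_tangent.
have tT j : tangent smT u (T j u) by rewrite TEu; exact: gamma_tangent.
have tS (r : 'rV[R]_n) : tangent smT u (\sum_j r 0 j *: T j u).
  by apply: tangent_vsum => j; exact: tangent_scale.
have KS (r : 'rV[R]_n) i : K u (\sum_j r 0 j *: T j u) (Xc i) = (r *m P u) 0 i.
  rewrite mxE; have [] : tangent smT u (\sum_j r 0 j *: T j u) /\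
      K u (\sum_j r 0 j *: T j u) (Xc i) = \sum_j r 0 j * P u j i; last by [].
  elim: (index_enum _) => [|j s [IH1 IH2]].
    rewrite !big_nil; split; first exact: tangent0.
    by rewrite /Kmap nabla0w //; exact: pi_field_eta.
  rewrite !big_cons; split; first exact: tangent_lin.
  rewrite /Kmap nabla_linw //; last exact: pi_field_eta.
  by rewrite -[LHS]/(_ * _ + K u _ (Xc i)) IH2 mxE.
have rS (r : 'rV[R]_n) : rho_map (\sum_j r 0 j *: T j u) = 0.
  elim: (index_enum _) => [|j s IH]; first by rewrite big_nil rho0.
  by rewrite big_cons rho_lin IH TEu gamma_rho // scaler0 addr0.
have gS (r : 'rV[R]_n) : \sum_j r 0 j *: T j u = gamma_map u (coord_vec c z.1 r).
  rewrite (gamma_coord r ac cz E) {2}(row_sum_unit r) -sum_pair_snd.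
  elim: (index_enum _) => [|i s IH]; last first.
    rewrite !big_cons IH TEu (gamma_coord (unit_row i) ac cz E).
    exact (esym (slit_vec_lin _ _ _ ac cz)).
  have := slit_vec_lin (-1) (0 : V) (0 : V) ac cz.
  by rewrite !big_nil scaler0 addr0 scaleN1r addNr.
(* A row in the left kernel of [P u] yields a vertical vector killed by the connection map.
   Regularity makes this vector zero, and the injectivity of [gamma_map] makes the row zero. *)
have detP : \det (P u) != 0.
  apply/negP => /det0P[r r0 rP]; move/negP: r0; apply; apply/eqP.
  have S0 : \sum_j r 0 j *: T j u = 0.
    apply: (vertical_horizontal0 (tS r) (rS r)); apply: v0 => [|i]; last by rewrite KS rP mxE.
    by apply: nabla_tangent => //; exact: pi_field_eta.
  move: S0; rewrite gS => /(gamma_inj (tc r)); rewrite -(coord_vec0 ac cz1).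
  exact: coord_vec_inj.
split=> //; set D := \det (P u) in detP *.
pose w := (- D^-1) *: (\sum_j cv u 0 j *: T j u) + At u.
have tAt := vfield_tangent u sAt.
have wE : hor nabla X u = w.
  rewrite /hor -[X u](_ : rho_map w = _).
    apply: beta_unique; first exact: tangent_lin.
    apply: v0 => [|i]; first by apply: nabla_tangent; [exact: tangent_lin|exact: pi_field_eta].
    rewrite /Kmap nabla_linw //; last exact: pi_field_eta.
    rewrite -[LHS]/(- D^-1 * K u _ (Xc i) + cov nabla At eta u (Xc i)) KS.
    rewrite /cv -mulmxA mul_adj_mx mul_mx_scalar !mxE mulrA mulNr mulVf // mulN1r addNr //.
  rewrite rho_lin rS scaler0 add0r (vE _ (pi_field_tangent u pX)) coord_vec_row //.
  rewrite /At; elim: (index_enum _) => [|i s IH].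
    by rewrite !big_nil rho0.
  by rewrite !big_cons rho_lin IH HEu (slit_vec_rho _ ac cz E) mxE.
rewrite wE -[w F]/(- D^-1 * (\sum_j cv u 0 j *: T j u) F + At u F).
have -> : (\sum_j cv u 0 j *: T j u) F = \sum_j cv u 0 j * T j u F by rewrite fct_sumE.
by rewrite mulrDr mulrA mulrN divff // mulN1r addrC.
Qed.

End RegularConnection.

(** * Bianchi identities *)

Section FieldArithmetic.
Context {R : realType} {n : nat} {M : manifold R n}.
Implicit Types (u : slit M) (F : slit M -> R).

Definition fscale (T : Type) F (X : slit M -> vec R T) : slit M -> vec R T := fun u => F u *: X u.

Lemma fieldDE (T : Type) (X Y : slit M -> vec R T) u (f : T -> R) : (X + Y) u f = X u f + Y u f.
Proof. by []. Qed.

Lemma fieldNE (T : Type) (X : slit M -> vec R T) u (f : T -> R) : (- X) u f = - X u f.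
Proof. by []. Qed.

Lemma field0E (T : Type) u (f : T -> R) : (0 : slit M -> vec R T) u f = 0.
Proof. by []. Qed.

Lemma fscaleE (T : Type) F (X : slit M -> vec R T) u (f : T -> R) : fscale F X u f = F u * X u f.
Proof. by []. Qed.

Lemma slit_fieldP (T : Type) (X Y : slit M -> vec R T) : (forall u (f : T -> R), X u f = Y u f) -> X = Y.
Proof. by move=> H; apply/funext => u; apply/funext => f. Qed.

End FieldArithmetic.

Ltac atoms u f := repeat match goal with
  | |- context [?X u f] => let r := fresh "r" in generalize (X u f); intro r end.

(* The operators are generalized first, since [ring] would unfold them. *)
Ltac abstract_fields := repeat match goal with
  | |- context [cov ?a ?b ?c] => generalize (cov a b c); intro
  | |- context [torsion ?a ?b ?c] => generalize (torsion a b c); intro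
  | |- context [Ttorsion ?a ?b ?c] => generalize (Ttorsion a b c); intro
  | |- context [rho_field ?a] => generalize (rho_field a); intro
  | |- context [lie_bracket ?a ?b] => generalize (lie_bracket a b); intro
  | |- context [curvature ?a ?b ?c ?d] => generalize (curvature a b c d); intro
  | |- context [Rcurv ?a ?b ?c ?d] => generalize (Rcurv a b c d); intro
  | |- context [Pcurv ?a ?b ?c ?d] => generalize (Pcurv a b c d); intro
  | |- context [Scurv ?a ?b ?c ?d] => generalize (Scurv a b c d); intro
  end.

Ltac linear_fields := abstract_fields; let u := fresh "u" in let f := fresh "f" in
  apply: slit_fieldP; intros u f; rewrite ?(fieldDE, fieldNE, field0E); atoms u f; ring.

(** * Tensoriality of torsion and curvature for an arbitrary connection *)

Section FieldAlgebra.
Context {R : realType} {n : nat} {M : manifold R n}.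
Implicit Types (p q : M) (f h : M -> R) (u : slit M) (F G : slit M -> R)
  (X Y Z : slit M -> vec R M) (A B C : slit M -> vec R (slit M)).
Local Notation smM := (@smoothM R n M).
Local Notation smT := (@smoothT R n M).
Local Notation pf := (@pi_field R n M).
Local Notation vf := (@vfield R n M).

Lemma fscale_pf F X : smT F -> pf X -> pf (fscale F X).
Proof. exact: pi_fieldZ. Qed.

Lemma fscale_vf F A : smT F -> vf A -> vf (fscale F A).
Proof. exact: vfieldZ. Qed.

Lemma vfield_ext A B : vf A -> vf B -> (forall u F, smT F -> A u F = B u F) -> A = B.
Proof.
move=> vA vB H; apply/funext => u.
exact: tangent_ext (vfield_tangent u vA) (vfield_tangent u vB) (H u).
Qed.

Lemma pi_field_ext X Y : pf X -> pf Y -> (forall u f, smM f -> X u f = Y u f) -> X = Y.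
Proof.
move=> pX pY H; apply/funext => u.
exact: tangent_ext (pi_field_tangent u pX) (pi_field_tangent u pY) (H u).
Qed.

Lemma vfieldDf A u F G : vf A -> smT F -> smT G -> A u (fun v => F v + G v) = A u F + A u G.
Proof. by move=> vA sF sG; exact (tangentD (vfield_tangent u vA) sF sG). Qed.

Lemma vfieldBf A u F G : vf A -> smT F -> smT G -> A u (fun v => F v - G v) = A u F - A u G.
Proof.
move=> vA sF sG.
exact (tangentB (@smoothT_cst R n M) (@smoothT_mul R n M) (vfield_tangent u vA) sF sG).
Qed.

Lemma vfieldMf A u F G : vf A -> smT F -> smT G ->
  A u (fun v => F v * G v) = F u * A u G + G u * A u F.
Proof. by move=> vA sF sG; exact (tangentM (vfield_tangent u vA) sF sG). Qed.

Lemma bracketC A B : lie_bracket A B = - lie_bracket B A.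
Proof. by apply: slit_fieldP => u F; rewrite fieldNE /lie_bracket opprB. Qed.

Lemma bracketDl A B C : vf A -> vf B -> vf C ->
  lie_bracket (A + B) C = lie_bracket A C + lie_bracket B C.
Proof.
move=> vA vB vC; apply: vfield_ext => [||u F sF].
- by apply: vfield_bracket => //; exact: vfieldD.
- by apply: vfieldD; exact: vfield_bracket.
rewrite fieldDE /lie_bracket (vfieldDf u vC (vfield_smooth vA sF) (vfield_smooth vB sF)).
rewrite fieldDE; ring.
Qed.

Lemma bracket_scalel F A B : smT F -> vf A -> vf B ->
  lie_bracket (fscale F A) B = fscale F (lie_bracket A B) - fscale (fun u => B u F) A.
Proof.
move=> sF vA vB; have sBF := vfield_smooth vB sF.
apply: vfield_ext => [||u G sG].
- by apply: vfield_bracket => //; exact: fscale_vf.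
- by apply: vfieldB; apply: fscale_vf => //; exact: vfield_bracket.
rewrite fieldDE fieldNE !fscaleE /lie_bracket.
rewrite (vfieldMf u vB sF (vfield_smooth vA sG)) fscaleE; ring.
Qed.

Lemma jacobi A B C : vf A -> vf B -> vf C ->
  lie_bracket (lie_bracket A B) C + lie_bracket (lie_bracket B C) A
  + lie_bracket (lie_bracket C A) B = 0.
Proof.
move=> vA vB vC.
have vAB := vfield_bracket vA vB; have vBC := vfield_bracket vB vC.
have vCA := vfield_bracket vC vA.
apply: vfield_ext => [||u F sF]; last first.
- have sA := vfield_smooth vA sF; have sB := vfield_smooth vB sF; have sC := vfield_smooth vC sF.
  rewrite !fieldDE field0E /lie_bracket.
  rewrite (vfieldBf u vC (vfield_smooth vA sB) (vfield_smooth vB sA)).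
  rewrite (vfieldBf u vA (vfield_smooth vB sC) (vfield_smooth vC sB)).
  rewrite (vfieldBf u vB (vfield_smooth vC sA) (vfield_smooth vA sC)).
  ring.
- exact: vfield0.
- by apply: vfieldD; [apply: vfieldD|]; exact: vfield_bracket.
Qed.

Lemma rho_field_pf A : vf A -> pf (rho_field A).
Proof.
move=> vA; split=> [u|f sf]; first exact: rho_tangent (vfield_tangent u vA).
rewrite (_ : (fun u => _) = fun u => A u (f \o @slit_proj R n M)).
  exact: vfield_smooth vA (smoothT_pull sf).
by apply/funext => u; rewrite /rho_field rhoE.
Qed.

Lemma rho_fieldD A B : rho_field (A + B) = rho_field A + rho_field B.
Proof.
apply/funext => u; rewrite -[RHS]/(rho_map (A u) + rho_map (B u)).
by rewrite -[rho_map (A u)]scale1r -rho_lin scale1r.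
Qed.

Lemma rho_fieldN A : rho_field (- A) = - rho_field A.
Proof.
apply/funext => u; have := rho_lin (-1) (A u) 0.
by rewrite rho0 !addr0 !scaleN1r.
Qed.

Lemma rho_field_scale F A : rho_field (fscale F A) = fscale F (rho_field A).
Proof.
apply/funext => u; have := rho_lin (F u) (A u) 0.
by rewrite rho0 !addr0.
Qed.

Lemma rho_field_ver X : pf X -> rho_field (ver X) = 0.
Proof. by move=> pX; apply/funext => u; apply: gamma_rho; exact: pi_field_tangent. Qed.

Lemma verD X Y : pf X -> pf Y -> ver (X + Y) = ver X + ver Y.
Proof.
move=> pX pY; apply/funext => u; have := gamma_lin 1 (pi_field_tangent u pX) (pi_field_tangent u pY).
by rewrite !scale1r.
Qed.

Lemma gamma0 u : gamma_map u (0 : vec R M) = 0.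
Proof.
have t0 : tangent smM (slit_proj u) 0 := tangent0 _ _.
by have := gamma_lin (-1) t0 t0; rewrite scaler0 addr0 scaleN1r addNr.
Qed.

Lemma ver_scale F X : pf X -> ver (fscale F X) = fscale F (ver X).
Proof.
move=> pX; apply/funext => u.
have := gamma_lin (F u) (pi_field_tangent u pX) (pi_field_tangent u pi_field0).
by rewrite addr0 gamma0 addr0.
Qed.

Lemma verN X : pf X -> ver (- X) = - ver X.
Proof.
move=> pX; apply/funext => u.
have := gamma_lin (-1) (pi_field_tangent u pX) (pi_field_tangent u pi_field0).
by rewrite gamma0 !addr0 !scaleN1r.
Qed.

Variable nabla : connection_map M.
Hypothesis conn : is_connection nabla.

Local Notation cv := (cov nabla).

Lemma covDr A X Y : vf A -> pf X -> pf Y -> cv A (X + Y) = cv A X + cv A Y.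
Proof. by move=> vA pX pY; apply/funext => u; apply: nablaD => //; exact: vfield_tangent. Qed.

Lemma cov_scaler A F X : vf A -> smT F -> pf X ->
  cv A (fscale F X) = fscale F (cv A X) + fscale (fun u => A u F) X.
Proof. by move=> vA sF pX; apply/funext => u; apply: nabla_leibniz => //; exact: vfield_tangent. Qed.

Lemma cov0r A : vf A -> cv A 0 = 0.
Proof.
by move=> vA; have := covDr vA pi_field0 pi_field0; rewrite addr0 => /esym/(canRL (addrK _)); rewrite subrr.
Qed.

Lemma covNr A X : vf A -> pf X -> cv A (- X) = - cv A X.
Proof.
move=> vA pX; have := covDr vA pX (pi_fieldN pX); rewrite subrr cov0r // => /esym/eqP.
by rewrite addr_eq0 => /eqP->; rewrite opprK.
Qed.

Lemma covBr A X Y : vf A -> pf X -> pf Y -> cv A (X - Y) = cv A X - cv A Y.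
Proof. by move=> vA pX pY; rewrite covDr ?covNr //; exact: pi_fieldN. Qed.

Lemma covDl A B X : vf A -> vf B -> pf X -> cv (A + B) X = cv A X + cv B X.
Proof.
by move=> vA vB pX; apply/funext => u; apply: nablaDw => //; exact: vfield_tangent.
Qed.

Lemma cov_scalel F A X : vf A -> pf X -> cv (fscale F A) X = fscale F (cv A X).
Proof.
by move=> vA pX; apply/funext => u; apply: nablaZw => //; exact: vfield_tangent.
Qed.

Lemma cov0l X : pf X -> cv 0 X = 0.
Proof. by move=> pX; apply/funext => u; exact: nabla0w. Qed.

Lemma covNl A X : vf A -> pf X -> cv (- A) X = - cv A X.
Proof.
move=> vA pX; have := covDl vA (vfieldN vA) pX; rewrite subrr cov0l // => /esym/eqP.
by rewrite addr_eq0 => /eqP->; rewrite opprK.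
Qed.

Lemma cov_pf A X : vf A -> pf X -> pf (cv A X).
Proof. exact: cov_pi_field. Qed.

Hint Resolve pi_fieldD pi_fieldN pi_fieldB pi_field0 pi_field_eta cov_pf vfield_bracket
  vfieldD vfieldN vfieldB vfield0 vfield_ver fscale_pf fscale_vf rho_field_pf smoothT_mul
  smoothT_add smoothT_sub smoothT_opp vfield_smooth : fields.

Local Ltac field_auto := solve [auto 12 with fields].


Lemma torsionC A B : torsion nabla A B = - torsion nabla B A.
Proof. rewrite /torsion (bracketC A B) rho_fieldN; linear_fields. Qed.

Lemma torsion_pf A B : vf A -> vf B -> pf (torsion nabla A B).
Proof. by move=> vA vB; rewrite /torsion; field_auto. Qed.

Lemma torsionDl A B C : vf A -> vf B -> vf C ->
  torsion nabla (A + B) C = torsion nabla A C + torsion nabla B C.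
Proof.
move=> vA vB vC; rewrite /torsion bracketDl // !rho_fieldD covDl ?covDr; try field_auto.
linear_fields.
Qed.

Lemma torsionDr A B C : vf A -> vf B -> vf C ->
  torsion nabla A (B + C) = torsion nabla A B + torsion nabla A C.
Proof.
move=> vA vB vC; rewrite torsionC torsionDl // (torsionC B) (torsionC C); linear_fields.
Qed.

(** The term [B F] produced by the Leibniz rule cancels the one produced by the bracket. *)
Lemma torsion_scalel F A B : smT F -> vf A -> vf B ->
  torsion nabla (fscale F A) B = fscale F (torsion nabla A B).
Proof.
move=> sF vA vB; rewrite /torsion bracket_scalel // rho_fieldD rho_fieldN !rho_field_scale.
rewrite cov_scalel ?cov_scaler; try field_auto.
apply: slit_fieldP => u f; rewrite !(fieldDE, fieldNE, fscaleE); atoms u f; ring.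
Qed.

Lemma curvatureC A B Z : vf A -> vf B -> pf Z -> curvature nabla A B Z = - curvature nabla B A Z.
Proof.
by move=> vA vB pZ; rewrite /curvature (bracketC A B) covNl; [linear_fields|field_auto|field_auto].
Qed.

Lemma curvature_pf A B Z : vf A -> vf B -> pf Z -> pf (curvature nabla A B Z).
Proof. by move=> vA vB pZ; rewrite /curvature; field_auto. Qed.

Lemma curvatureDl A B C Z : vf A -> vf B -> vf C -> pf Z ->
  curvature nabla (A + B) C Z = curvature nabla A C Z + curvature nabla B C Z.
Proof.
move=> vA vB vC pZ; rewrite /curvature bracketDl //.
rewrite (covDl vA vB (cov_pf vC pZ)) (covDl vA vB pZ).
rewrite (covDl (vfield_bracket vA vC) (vfield_bracket vB vC) pZ) (covDr vC (cov_pf vA pZ) (cov_pf vB pZ)).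
linear_fields.
Qed.

Lemma curvatureDr A B C Z : vf A -> vf B -> vf C -> pf Z ->
  curvature nabla A (B + C) Z = curvature nabla A B Z + curvature nabla A C Z.
Proof.
move=> vA vB vC pZ; rewrite curvatureC ?curvatureDl ?(curvatureC vB) ?(curvatureC vC); try field_auto.
linear_fields.
Qed.

Lemma curvature_scalel F A B Z : smT F -> vf A -> vf B -> pf Z ->
  curvature nabla (fscale F A) B Z = fscale F (curvature nabla A B Z).
Proof.
move=> sF vA vB pZ; have sBF := vfield_smooth vB sF.
rewrite /curvature bracket_scalel // covDl ?covNl ?(cov_scalel _ vA) ?cov_scalel ?cov_scaler; try field_auto.
apply: slit_fieldP => u f; rewrite !(fieldDE, fieldNE, fscaleE); atoms u f; ring.
Qed.

(** After unfolding, all that remains is the sum of the projected iterated brackets, zero by Jacobi.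
    The sign on the right comes from the sign convention for the curvature. Arguments are arbitrary
    vector fields, so each mixed identity is obtained by inserting lifts. *)
Lemma bianchi1 A B C : vf A -> vf B -> vf C ->
  curvature nabla A B (rho_field C) + curvature nabla B C (rho_field A)
    + curvature nabla C A (rho_field B) =
  - (cv A (torsion nabla B C) + cv B (torsion nabla C A) + cv C (torsion nabla A B)
     + torsion nabla A (lie_bracket B C) + torsion nabla B (lie_bracket C A)
     + torsion nabla C (lie_bracket A B)).
Proof.
move=> vA vB vC.
have J u f : rho_field (lie_bracket A (lie_bracket B C)) u f +
    rho_field (lie_bracket B (lie_bracket C A)) u f + rho_field (lie_bracket C (lie_bracket A B)) u f = 0.
  have rho_field0 : rho_field (0 : slit M -> vec R (slit M)) = 0.
    by apply/funext => v; exact: rho0.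
  have := congr1 (fun D => rho_field D u f) (jacobi vA vB vC).
  rewrite rho_field0 (rho_fieldD (lie_bracket (lie_bracket A B) C + lie_bracket (lie_bracket B C) A)).
  rewrite (rho_fieldD (lie_bracket (lie_bracket A B) C)) !fieldDE field0E.
  rewrite (bracketC A (lie_bracket B C)) (bracketC B (lie_bracket C A)) (bracketC C (lie_bracket A B)).
  by rewrite !rho_fieldN !fieldNE; atoms u f; lra.
rewrite /torsion !covBr; try field_auto.
rewrite /curvature; apply: slit_fieldP => u f; move: (J u f).
rewrite !(fieldDE, fieldNE); atoms u f; lra.
Qed.

(** The Jacobi identity for the commutators of the operators [cov], combined with the Jacobi
    identity for the vector fields themselves. *)
Lemma bianchi2 A B C W : vf A -> vf B -> vf C -> pf W ->
  cv A (curvature nabla B C W) - curvature nabla B C (cv A W)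
  + (cv B (curvature nabla C A W) - curvature nabla C A (cv B W))
  + (cv C (curvature nabla A B W) - curvature nabla A B (cv C W)) =
  curvature nabla (lie_bracket A B) C W + curvature nabla (lie_bracket B C) A W
  + curvature nabla (lie_bracket C A) B W.
Proof.
move=> vA vB vC pW.
have J : cv (lie_bracket (lie_bracket A B) C) W + cv (lie_bracket (lie_bracket B C) A) W
   + cv (lie_bracket (lie_bracket C A) B) W = 0.
  by rewrite -!covDl ?jacobi ?cov0l; try field_auto.
have {}J u f : cv (lie_bracket (lie_bracket A B) C) W u f + cv (lie_bracket (lie_bracket B C) A) W u f
   + cv (lie_bracket (lie_bracket C A) B) W u f = 0.
  by rewrite -!fieldDE J field0E.
rewrite /curvature !covDr ?covNr; try field_auto.
apply: slit_fieldP => u f; move: (J u f).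
rewrite !(fieldDE, fieldNE); atoms u f; lra.
Qed.

End FieldAlgebra.

(** * The Cartan connection *)

Section CartanConnection.
Context {R : realType} {n : nat} {M : manifold R n}.
Implicit Types (p q : M) (f h : M -> R) (u : slit M) (F : slit M -> R)
  (X Y Z W U : slit M -> vec R M) (A B C : slit M -> vec R (slit M)).
Local Notation smM := (@smoothM R n M).
Local Notation smT := (@smoothT R n M).
Local Notation pf := (@pi_field R n M).
Local Notation vf := (@vfield R n M).
Local Notation eta := (@eta_field R n M).

Variables (L : slit M -> R) (nabla : connection_map M).
Hypothesis hL : finsler L.
Hypothesis hC : is_cartan nabla L.

Local Notation cv := (cov nabla).
Local Notation g := (finsler_metric L).
Local Notation hr := (hor nabla).
Local Notation T := (Ttorsion nabla).
Local Notation K := (curvature nabla).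

Let conn : is_connection nabla. Proof. by case: hC. Qed.
Let reg : is_regular nabla. Proof. by case: hC. Qed.

Lemma hor_vf X : pf X -> vf (hr X).
Proof. exact: vfield_hor. Qed.

Lemma cv_pf A X : vf A -> pf X -> pf (cv A X).
Proof. exact: cov_pi_field. Qed.

Lemma torsion_is_pf A B : vf A -> vf B -> pf (torsion nabla A B).
Proof. exact: torsion_pf. Qed.

Lemma curvature_is_pf A B Z : vf A -> vf B -> pf Z -> pf (K A B Z).
Proof. exact: curvature_pf. Qed.

Hint Resolve pi_fieldD pi_fieldN pi_fieldB pi_field0 pi_field_eta cv_pf vfield_bracket
  vfieldD vfieldN vfieldB vfield0 vfield_ver fscale_pf fscale_vf rho_field_pf smoothT_mul
  smoothT_add smoothT_sub smoothT_opp vfield_smooth hor_vf torsion_is_pf curvature_is_pf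
  basic_pi_field : fields.

Local Ltac field_auto := solve [auto 14 with fields].


Definition gg X Y : slit M -> R := fun u => g u (X u) (Y u).

Lemma gg_smooth X Y : pf X -> pf Y -> smT (gg X Y).
Proof. exact: fmetric_smooth. Qed.

Lemma ggC X Y : pf X -> pf Y -> gg X Y = gg Y X.
Proof.
move=> pX pY; apply/funext => u; rewrite /gg.
exact (fmetric_sym hL (pi_field_tangent u pX) (pi_field_tangent u pY)).
Qed.

Lemma gg_linl F X Y Z : pf X -> pf Y -> pf Z -> forall u, gg (fscale F X + Y) Z u = F u * gg X Z u + gg Y Z u.
Proof. by move=> pX pY pZ u; apply: (fmetric_linl hL); exact: pi_field_tangent. Qed.

Lemma gg0 Z : pf Z -> forall u, gg 0 Z u = 0.
Proof.
move=> pZ u; have := gg_linl (fun=> -1) pi_field0 pi_field0 pZ u.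
rewrite (_ : fscale _ _ + _ = 0); last by apply: slit_fieldP => v f; rewrite fieldDE fscaleE field0E mulr0 addr0.
by rewrite mulN1r addNr.
Qed.

Lemma ggD X Y Z : pf X -> pf Y -> pf Z -> forall u, gg (X + Y) Z u = gg X Z u + gg Y Z u.
Proof.
move=> pX pY pZ u; have := gg_linl (fun=> 1) pX pY pZ u; rewrite mul1r => <-.
by congr (gg _ Z u); apply: slit_fieldP => v f; rewrite !fieldDE fscaleE mul1r.
Qed.

Lemma gg_scale F X Z : pf X -> pf Z -> forall u, gg (fscale F X) Z u = F u * gg X Z u.
Proof.
move=> pX pZ u; have := gg_linl F pX pi_field0 pZ u; rewrite gg0 // !addr0 => <-.
by [].
Qed.

Lemma ggN X Z : pf X -> pf Z -> forall u, gg (- X) Z u = - gg X Z u.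
Proof.
move=> pX pZ u; have := gg_scale (fun=> -1) pX pZ u; rewrite mulN1r => <-.
by congr (gg _ Z u); apply: slit_fieldP => v f; rewrite fieldNE fscaleE mulN1r.
Qed.

Lemma ggB X Y Z : pf X -> pf Y -> pf Z -> forall u, gg (X - Y) Z u = gg X Z u - gg Y Z u.
Proof. by move=> pX pY pZ u; rewrite ggD ?ggN //; exact: pi_fieldN. Qed.

Lemma gg_eta u : gg eta eta u = L u ^+ 2.
Proof. exact: fmetric_eta. Qed.

Lemma gg_pos X u : pf X -> X u <> 0 -> 0 < gg X X u.
Proof. by move=> pX Xu; apply: (fmetric_pos hL) => //; exact: pi_field_tangent. Qed.

Lemma gg_nondegenerate X : pf X -> (forall Z u, basic Z -> gg X Z u = 0) -> X = 0.
Proof.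
move=> pX H; apply/funext => u; have [Z [bZ Zu]] := basic_value (pi_field_tangent u pX).
have := H Z u bZ; rewrite /gg Zu -/(gg X X u) => E.
by apply: contrapT => Xu; have := gg_pos pX Xu; rewrite E ltxx.
Qed.

Lemma gg_inj X Y : pf X -> pf Y -> (forall Z u, basic Z -> gg X Z u = gg Y Z u) -> X = Y.
Proof.
move=> pX pY H; apply/eqP; rewrite -subr_eq0; apply/eqP/gg_nondegenerate => [|Z u bZ].
  exact: pi_fieldB.
by rewrite ggB ?H ?subrr //; exact: basic_pi_field.
Qed.

Lemma metric_compat A Y Z u : vf A -> pf Y -> pf Z ->
  A u (gg Y Z) = gg (cv A Y) Z u + gg Y (cv A Z) u.
Proof.
by case: hC => _ _ H _ _ vA pY pZ; apply: H => //; exact: vfield_tangent.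
Qed.

Lemma rho_hor X : pf X -> rho_field (hr X) = X.
Proof.
move=> pX; apply/funext => u.
by have [_ _] := betaP reg (pi_field_tangent u pX).
Qed.

Lemma cov_hor_eta X : pf X -> cv (hr X) eta = 0.
Proof.
move=> pX; apply/funext => u.
by have [_] := betaP reg (pi_field_tangent u pX).
Qed.

Lemma horD X Y : pf X -> pf Y -> hr (X + Y) = hr X + hr Y.
Proof.
move=> pX pY; apply/funext => u.
have := beta_lin conn reg 1 (pi_field_tangent u pX) (pi_field_tangent u pY).
by rewrite !scale1r.
Qed.

Lemma hor0 : hr 0 = 0.
Proof.
have := horD pi_field0 pi_field0; rewrite addr0 => /esym/(canRL (addrK _)).
by rewrite subrr.
Qed.

Lemma horN X : pf X -> hr (- X) = - hr X.
Proof.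
move=> pX; have := horD pX (pi_fieldN pX); rewrite subrr hor0 => /esym/eqP.
by rewrite addr_eq0 => /eqP->; rewrite opprK.
Qed.

Lemma hor_scale F X : pf X -> hr (fscale F X) = fscale F (hr X).
Proof.
move=> pX; apply/funext => u.
have := beta_lin conn reg (F u) (pi_field_tangent u pX) (pi_field_tangent u pi_field0).
by rewrite -/(hr 0 u) hor0 !addr0.
Qed.

Lemma T_pf X Y : pf X -> pf Y -> pf (T X Y).
Proof. by move=> pX pY; rewrite /Ttorsion; field_auto. Qed.

Hint Resolve T_pf : fields.

Lemma T_E X Y : pf X -> pf Y -> T X Y = cv (ver X) Y - rho_field (lie_bracket (ver X) (hr Y)).
Proof.
move=> pX pY; rewrite /Ttorsion /torsion rho_hor // rho_field_ver // cov0r ?subr0 //.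
exact: hor_vf.
Qed.

Lemma TDl X X' Y : pf X -> pf X' -> pf Y -> T (X + X') Y = T X Y + T X' Y.
Proof. by move=> pX pX' pY; rewrite /Ttorsion verD // torsionDl //; field_auto. Qed.

Lemma TDr X Y Y' : pf X -> pf Y -> pf Y' -> T X (Y + Y') = T X Y + T X Y'.
Proof. by move=> pX pX' pY; rewrite /Ttorsion horD // torsionDr //; field_auto. Qed.

Lemma T_scalel F X Y : smT F -> pf X -> pf Y -> T (fscale F X) Y = fscale F (T X Y).
Proof. by move=> sF pX pY; rewrite /Ttorsion ver_scale // torsion_scalel //; field_auto. Qed.

Lemma T_scaler F X Y : smT F -> pf X -> pf Y -> T X (fscale F Y) = fscale F (T X Y).
Proof.
move=> sF pX pY; rewrite /Ttorsion hor_scale // torsionC torsion_scalel //; try field_auto.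
rewrite (torsionC nabla (hr Y)).
by apply: slit_fieldP => u f; rewrite !(fieldNE, fscaleE); ring.
Qed.

(** On functions pulled back from [M], [hr Y] acts through the component [Y f] and [ver X] acts as
    zero; so one of the two terms of the bracket disappears. *)
Lemma rho_bracket_vh X Y u f : pf X -> pf Y -> smM f ->
  rho_field (lie_bracket (ver X) (hr Y)) u f = gamma_map u (X u) (fun v => Y v f).
Proof.
move=> pX pY sf; rewrite /rho_field rhoE // /lie_bracket.
have -> : (fun v => hr Y v (f \o @slit_proj R n M)) = fun v => Y v f.
  by apply/funext => v; rewrite -rhoE // -/(rho_field (hr Y) v) rho_hor.
have -> : (fun v => ver X v (f \o @slit_proj R n M)) = fun=> 0.
  by apply/funext => v; rewrite -rhoE // -/(rho_field (ver X) v) rho_field_ver.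
by rewrite (tangent_cst (@smoothT_cst R n M) (vfield_tangent u (hor_vf pY))) subr0.
Qed.

(** The components of a basic field are pulled back from [M], so a vertical vector annihilates them
    and the bracket in [T_E] has no projection. *)
Lemma T_basic X Y : pf X -> basic Y -> T X Y = cv (ver X) Y.
Proof.
move=> pX bY; have pY := basic_pi_field bY; rewrite T_E //.
rewrite (_ : rho_field _ = 0) ?subr0 //; apply: pi_field_ext; try field_auto.
move=> u f sf; rewrite rho_bracket_vh //; case: bY => s [_ ss ->].
by have := gamma_rho (pi_field_tangent u pX) => /(congr1 (fun w => w (fun q => s q f))); rewrite rhoE //; exact: ss.
Qed.

Lemma T_swap X Y Z u : pf X -> pf Y -> pf Z -> gg (T X Y) Z u = gg (T X Z) Y u.
Proof. by case: hC => _ _ _ _; apply. Qed.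

(** Compatibility with the metric gives two torsion terms, which [T_swap] makes equal. This ties [T]
    to the Cartan tensor. *)
Lemma gg_T X Y Z u : pf X -> basic Y -> basic Z ->
  2 * gg (T X Y) Z u = gamma_map u (X u) (gg Y Z).
Proof.
move=> pX bY bZ; have pY := basic_pi_field bY; have pZ := basic_pi_field bZ.
have := metric_compat u (vfield_ver pX) pY pZ.
rewrite -(T_basic pX bY) -(T_basic pX bZ) (ggC pY (T_pf pX pZ)) (T_swap u pX pZ pY).
by rewrite /ver => ->; rewrite mulr2n mulrDl mul1r.
Qed.

Lemma gg_T_linl F X X' Y Z u : smT F -> pf X -> pf X' -> pf Y -> pf Z ->
  gg (T (fscale F X + X') Y) Z u = F u * gg (T X Y) Z u + gg (T X' Y) Z u.
Proof.
move=> sF pX pX' pY pZ; rewrite (TDl (fscale_pf sF pX) pX' pY) (T_scalel sF pX pY).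
by rewrite (ggD (fscale_pf sF (T_pf pX pY)) (T_pf pX' pY) pZ) (gg_scale F (T_pf pX pY) pZ).
Qed.

Lemma gg_T_linr F X Y Y' Z u : smT F -> pf X -> pf Y -> pf Y' -> pf Z ->
  gg (T X (fscale F Y + Y')) Z u = F u * gg (T X Y) Z u + gg (T X Y') Z u.
Proof.
move=> sF pX pY pY' pZ; rewrite (TDr pX (fscale_pf sF pY) pY') (T_scaler sF pX pY).
by rewrite (ggD (fscale_pf sF (T_pf pX pY)) (T_pf pX pY') pZ) (gg_scale F (T_pf pX pY) pZ).
Qed.

(** On basic fields this is the symmetry of third fibre derivatives. It extends to all fields one
    argument at a time, applying [tensorial_basic] to the difference of the two sides. *)
Lemma T_sym X Y : pf X -> pf Y -> T X Y = T Y X.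
Proof.
move=> pX pY; apply: gg_inj; [exact: T_pf|exact: T_pf|move=> Z u bZ].
have pZ := basic_pi_field bZ.
have H1 X' Y' : basic X' -> basic Y' -> gg (T X' Y') Z u = gg (T Y' X') Z u.
  move=> bX bY; have half (r s t : R) : 2 * r = t -> 2 * s = t -> r = s by lra.
  apply: half (gg_T u (basic_pi_field bX) bY bZ) _.
  rewrite (gg_T u (basic_pi_field bY) bX bZ); exact: (esym (cartan_sym hL u bX bY bZ)).
have tl Y' : pf Y' -> forall F X1 X2, smT F -> pf X1 -> pf X2 ->
    gg (T (fscale F X1 + X2) Y') Z u - gg (T Y' (fscale F X1 + X2)) Z u =
    F u * (gg (T X1 Y') Z u - gg (T Y' X1) Z u) + (gg (T X2 Y') Z u - gg (T Y' X2) Z u).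
  move=> pY' F X1 X2 sF p1 p2.
  have alg (r a b c d s t : R) : s = r * a + b -> t = r * c + d ->
    s - t = r * (a - c) + (b - d) by move=> -> ->; ring.
  exact: alg (gg_T_linl u sF p1 p2 pY' pZ) (gg_T_linr u sF pY' p1 p2 pZ).
have H2 X' Y' : pf X' -> basic Y' -> gg (T X' Y') Z u - gg (T Y' X') Z u = 0.
  move=> pX' bY'; apply: (tensorial_basic (tau := fun X' => gg (T X' Y') Z u - gg (T Y' X') Z u) _ _ pX').
    by move=> F X1 X2; exact: tl (basic_pi_field bY') F X1 X2.
  by move=> X1 b1; rewrite H1 ?subrr.
have H3 : gg (T Y X) Z u - gg (T X Y) Z u = 0.
  apply: (tensorial_basic (tau := fun Y => gg (T Y X) Z u - gg (T X Y) Z u) _ _ pY).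
    by move=> F X1 X2; exact: tl pX F X1 X2.
  by move=> Y' bY'; rewrite -opprB H2 ?oppr0.
by apply/esym/eqP; rewrite -subr_eq0 H3.
Qed.

Lemma T_eta_l Y : pf Y -> T eta Y = 0.
Proof.
move=> pY; apply: gg_nondegenerate; first by field_auto.
move=> Z u bZ; have pZ := basic_pi_field bZ.
have tl F X1 X2 : smT F -> pf X1 -> pf X2 ->
    gg (T eta (fscale F X1 + X2)) Z u = F u * gg (T eta X1) Z u + gg (T eta X2) Z u.
  by move=> sF p1 p2; exact: gg_T_linr sF pi_field_eta p1 p2 pZ.
apply: (tensorial_basic (tau := fun Y => gg (T eta Y) Z u) tl _ pY).
move=> Y' bY'; have := gg_T u pi_field_eta bY' bZ.
by rewrite (cartan_eta hL u bY' bZ : gamma_map u (eta u) (gg Y' Z) = 0) => /eqP; rewrite mulf_eq0 pnatr_eq0 /= => /eqP.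
Qed.

Lemma T_eta_r Y : pf Y -> T Y eta = 0.
Proof. by move=> pY; rewrite T_sym ?T_eta_l //; exact: pi_field_eta. Qed.

(** The vanishing of [T X eta] turns this derivative into the projection of a bracket, which is the
    fibre derivative of the components of [eta]. *)
Lemma cov_ver_eta X : pf X -> cv (ver X) eta = X.
Proof.
move=> pX; have := T_eta_r pX; rewrite T_E //; last exact: pi_field_eta.
move=> /eqP; rewrite subr_eq0 => /eqP ->; apply: pi_field_ext; try field_auto.
move=> u f sf; rewrite rho_bracket_vh //; last exact: pi_field_eta.
by rewrite gamma_eta //; exact: pi_field_tangent.
Qed.

(** The difference of the two sides projects to zero. It is also killed by the connection map, which
    [cov_ver_eta] makes a left inverse of the vertical lift. Regularity then forces it to vanish. *)
Lemma hor_ver_decomp A : vf A -> A = hr (rho_field A) + ver (cv A eta).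
Proof.
move=> vA; apply/funext => u; have pe := @pi_field_eta R n M.
have pr := rho_field_pf vA; have pk := cv_pf vA pe.
have vS : vf (hr (rho_field A) + ver (cv A eta)) by field_auto.
set w := (_ + _) u; apply/eqP; rewrite -subr_eq0; apply/eqP.
have vD : vf (A - (hr (rho_field A) + ver (cv A eta))) by field_auto.
apply: (vertical_horizontal0 reg (u := u) (vfield_tangent u vD)).
  rewrite -[LHS]/(rho_field (A - (hr (rho_field A) + ver (cv A eta))) u).
  by rewrite rho_fieldD rho_fieldN rho_fieldD rho_hor // rho_field_ver // addr0 subrr.
rewrite -[LHS]/(cv (A - (hr (rho_field A) + ver (cv A eta))) eta u).
rewrite covDl ?covNl ?covDl ?cov_hor_eta ?cov_ver_eta; try field_auto.
by rewrite add0r subrr.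
Qed.

Lemma torsion_hh X Y : pf X -> pf Y -> torsion nabla (hr X) (hr Y) = 0.
Proof. by case: hC => _ _ _ H _; exact: H. Qed.

Lemma rho_bracket_vv A B : vf A -> vf B -> rho_field A = 0 -> rho_field B = 0 ->
  rho_field (lie_bracket A B) = 0.
Proof.
move=> vA vB rA rB; apply: pi_field_ext; try field_auto.
move=> u f sf; rewrite /rho_field rhoE // /lie_bracket.
have -> : (fun v => B v (f \o @slit_proj R n M)) = fun=> 0.
  by apply/funext => v; rewrite -rhoE // -/(rho_field B v) rB.
have -> : (fun v => A v (f \o @slit_proj R n M)) = fun=> 0.
  by apply/funext => v; rewrite -rhoE // -/(rho_field A v) rA.
rewrite (tangent_cst (@smoothT_cst R n M) (vfield_tangent u vA)).
by rewrite (tangent_cst (@smoothT_cst R n M) (vfield_tangent u vB)) subrr.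
Qed.

Lemma torsion_vv X Y : pf X -> pf Y -> torsion nabla (ver X) (ver Y) = 0.
Proof.
move=> pX pY; rewrite /torsion rho_field_ver // rho_field_ver //.
rewrite rho_bracket_vv ?rho_field_ver //; try field_auto.
by rewrite !cov0r ?subr0 //; field_auto.
Qed.

(** * Brackets of lifts and identities between the three curvatures *)

Local Notation RR := (Rcurv nabla).
Local Notation PP := (Pcurv nabla).
Local Notation SS := (Scurv nabla).

Lemma RR_pf X Y Z : pf X -> pf Y -> pf Z -> pf (RR X Y Z).
Proof. by move=> pX pY pZ; rewrite /Rcurv; field_auto. Qed.

Lemma PP_pf X Y Z : pf X -> pf Y -> pf Z -> pf (PP X Y Z).
Proof. by move=> pX pY pZ; rewrite /Pcurv; field_auto. Qed.

Lemma SS_pf X Y Z : pf X -> pf Y -> pf Z -> pf (SS X Y Z).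
Proof. by move=> pX pY pZ; rewrite /Scurv; field_auto. Qed.

Hint Resolve RR_pf PP_pf SS_pf : fields.

(** The projection is read from the vanishing of the horizontal torsion. The vertical part is the
    curvature on [eta], since the horizontal derivatives of [eta] vanish and only the bracket term
    survives. *)
Lemma bracket_hh X Y : pf X -> pf Y ->
  lie_bracket (hr X) (hr Y) = hr (cv (hr X) Y - cv (hr Y) X) + ver (RR X Y eta).
Proof.
move=> pX pY; have pe := @pi_field_eta R n M.
have vb : vf (lie_bracket (hr X) (hr Y)) by field_auto.
rewrite [LHS]hor_ver_decomp //; congr (hr _ + ver _).
  have := torsion_hh pX pY; rewrite /torsion !rho_hor // => /eqP.
  by rewrite subr_eq0 => /eqP <-.
rewrite /Rcurv /curvature !cov_hor_eta // !cov0r; try field_auto.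
by rewrite oppr0 !add0r.
Qed.

Lemma bracket_vh X Y : pf X -> pf Y ->
  lie_bracket (ver X) (hr Y) = hr (cv (ver X) Y - T X Y) + ver (- (PP Y X eta + cv (hr Y) X)).
Proof.
move=> pX pY; have pe := @pi_field_eta R n M.
have vb : vf (lie_bracket (ver X) (hr Y)) by field_auto.
rewrite [LHS]hor_ver_decomp //; congr (hr _ + ver _).
  by rewrite T_E // opprB addrC subrK.
rewrite /Pcurv /curvature cov_hor_eta // cov_ver_eta // cov0r; try field_auto.
rewrite (bracketC (hr Y)) covNl //; linear_fields.
Qed.

Lemma T0l X : pf X -> T 0 X = 0.
Proof.
move=> pX; have := TDl pi_field0 pi_field0 pX; rewrite addr0 => /esym/(canRL (addrK _)).
by rewrite subrr.
Qed.

Lemma TNl X Y : pf X -> pf Y -> T (- X) Y = - T X Y.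
Proof.
move=> pX pY; have := TDl pX (pi_fieldN pX) pY; rewrite subrr T0l // => /esym/eqP.
by rewrite addr_eq0 => /eqP ->; rewrite opprK.
Qed.

Lemma TNr X Y : pf X -> pf Y -> T X (- Y) = - T X Y.
Proof. by move=> pX pY; rewrite T_sym ?TNl ?(T_sym pY) //; exact: pi_fieldN. Qed.

Lemma TBr X Y Z : pf X -> pf Y -> pf Z -> T X (Y - Z) = T X Y - T X Z.
Proof. by move=> pX pY pZ; rewrite TDr ?TNr //; exact: pi_fieldN. Qed.

Lemma torsion_ver_split X Z W : pf X -> pf Z -> pf W ->
  torsion nabla (ver X) (hr Z + ver W) = T X Z.
Proof.
move=> pX pZ pW; rewrite (torsionDr conn (vfield_ver pX) (hor_vf pZ) (vfield_ver pW)).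
by rewrite torsion_vv // addr0.
Qed.

Lemma torsion_hor_split X Z W : pf X -> pf Z -> pf W ->
  torsion nabla (hr X) (hr Z + ver W) = - T W X.
Proof.
move=> pX pZ pW; rewrite (torsionDr conn (hor_vf pX) (hor_vf pZ) (vfield_ver pW)).
by rewrite torsion_hh // add0r torsionC.
Qed.

Lemma curvature0 A B : vf A -> vf B -> K A B 0 = 0.
Proof. by move=> vA vB; rewrite /curvature !cov0r ?oppr0 ?addr0 //; field_auto. Qed.

Lemma bracket_hv X Y : pf X -> pf Y ->
  lie_bracket (hr Y) (ver X) = hr (T X Y - cv (ver X) Y) + ver (PP Y X eta + cv (hr Y) X).
Proof.
move=> pX pY; have pe := @pi_field_eta R n M.
rewrite (bracketC (hr Y)) (bracket_vh pX pY).
have p1 : pf (cv (ver X) Y - T X Y) by field_auto.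
have p2 : pf (PP Y X eta + cv (hr Y) X) by field_auto.
rewrite verN // opprD opprK -horN //.
by congr (hr _ + ver _); rewrite opprB.
Qed.

Lemma bracket_vv X Y : pf X -> pf Y ->
  lie_bracket (ver X) (ver Y) = hr 0 + ver (cv (lie_bracket (ver X) (ver Y)) eta).
Proof.
move=> pX pY; rewrite [LHS]hor_ver_decomp; last by field_auto.
by rewrite rho_bracket_vv ?rho_field_ver //; field_auto.
Qed.

(** First Bianchi identity for two vertical lifts and one horizontal lift: vertical lifts have no
    projection, so a single curvature term is left. *)
Lemma SS_formula X Y Z : pf X -> pf Y -> pf Z ->
  SS X Y Z = - cv (ver X) (T Y Z) - T X (cv (ver Y) Z - T Y Z) + cv (ver Y) (T X Z)
    + T Y (cv (ver X) Z - T X Z) + T (cv (lie_bracket (ver X) (ver Y)) eta) Z.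
Proof.
move=> pX pY pZ; have [vX vY] := (vfield_ver pX, vfield_ver pY); have vZ := hor_vf pZ.
have pe := @pi_field_eta R n M.
have := bianchi1 conn vX vY vZ.
rewrite (rho_hor pZ) (rho_field_ver pX) (rho_field_ver pY) !curvature0 // !addr0 -/(SS X Y Z) => ->.
rewrite -/(T Y Z) (torsionC nabla (hr Z) (ver X)) -/(T X Z) (torsion_vv pX pY).
rewrite (bracket_vh pY pZ) (bracket_hv pX pZ).
rewrite torsion_ver_split; try field_auto.
rewrite torsion_ver_split; try field_auto.
rewrite [X in torsion nabla (hr Z) X]bracket_vv // torsion_hor_split; try field_auto.
rewrite covNr ?cov0r; try field_auto.
rewrite (TBr pX (cv_pf vY pZ) (T_pf pY pZ)) (TBr pY (T_pf pX pZ) (cv_pf vX pZ)) (TBr pY (cv_pf vX pZ) (T_pf pX pZ)).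
linear_fields.
Qed.

(** First Bianchi identity for one vertical and two horizontal lifts, where two of the three
    curvature terms are left. *)
Lemma PP_formula X Y Z : pf X -> pf Y -> pf Z ->
  PP X Y Z - PP Z Y X = - cv (hr X) (T Y Z) + cv (hr Z) (T Y X)
    - T (PP Z Y eta + cv (hr Z) Y) X + T (PP X Y eta + cv (hr X) Y) Z
    - T Y (cv (hr Z) X - cv (hr X) Z).
Proof.
move=> pX pY pZ; have [vX vZ] := (hor_vf pX, hor_vf pZ); have vY := vfield_ver pY.
have pe := @pi_field_eta R n M.
have := bianchi1 conn vX vY vZ.
rewrite (rho_hor pZ) (rho_field_ver pY) (rho_hor pX) curvature0 // addr0.
rewrite (curvatureC conn vY vZ pX) -/(PP X Y Z) -/(PP Z Y X) => ->.
rewrite -/(T Y Z) (torsion_hh pZ pX) (torsionC nabla (hr X) (ver Y)) -/(T Y X).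
rewrite (bracket_vh pY pZ) (bracket_hh pZ pX) (bracket_hv pY pX).
rewrite torsion_hor_split; try field_auto.
rewrite torsion_ver_split; try field_auto.
rewrite torsion_hor_split; try field_auto.
rewrite covNr ?cov0r ?TNl; try field_auto.
linear_fields.
Qed.

(** Differentiate [g(Z, W)] along [A], [B] and their bracket. The mixed products of first
    derivatives cancel by symmetry of the metric, and what remains is the sum of the two curvature
    terms. *)
Lemma gg_curvature_skew A B Z W u : vf A -> vf B -> pf Z -> pf W ->
  gg (K A B Z) W u = - gg (K A B W) Z u.
Proof.
move=> vA vB pZ pW.
have key A' B' : vf A' -> vf B' -> A' u (fun v => B' v (gg Z W)) =
    gg (cv A' (cv B' Z)) W u + gg (cv B' Z) (cv A' W) u + (gg (cv A' Z) (cv B' W) u + gg Z (cv A' (cv B' W)) u).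
  move=> vA' vB'.
  have -> : (fun v => B' v (gg Z W)) = fun v => gg (cv B' Z) W v + gg Z (cv B' W) v.
    by apply/funext => v; rewrite metric_compat.
  have s1 : smT (gg (cv B' Z) W) by apply: gg_smooth; field_auto.
  have s2 : smT (gg Z (cv B' W)) by apply: gg_smooth; field_auto.
  rewrite (vfieldDf u vA' s1 s2).
  exact: (congr2 +%R (metric_compat u vA' (cv_pf vB' pZ) pW) (metric_compat u vA' pZ (cv_pf vB' pW))).
have bc := metric_compat u (vfield_bracket vA vB) pZ pW.
move: bc; rewrite /lie_bracket (key A B vA vB) (key B A vB vA) -/(lie_bracket A B).
have p1 : pf (cv A (cv B Z)) by field_auto.
have p2 : pf (cv B (cv A Z)) by field_auto.
have p3 : pf (cv (lie_bracket A B) Z) by field_auto.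
have q1 : pf (cv A (cv B W)) by field_auto.
have q2 : pf (cv B (cv A W)) by field_auto.
have q3 : pf (cv (lie_bracket A B) W) by field_auto.
rewrite (ggC pZ q1) (ggC pZ q2) (ggC pZ q3) /curvature.
rewrite (ggD (pi_fieldD (pi_fieldN p1) p2) p3 pW) (ggD (pi_fieldN p1) p2 pW) (ggN p1 pW).
rewrite (ggD (pi_fieldD (pi_fieldN q1) q2) q3 pZ) (ggD (pi_fieldN q1) q2 pZ) (ggN q1 pZ).
rewrite (ggC (cv_pf vB pZ) (cv_pf vA pW)) (ggC (cv_pf vA pZ) (cv_pf vB pW)).
have alg (a b c d e h i j : R) : a + b + (c + d) - (e + c + (b + h)) = i + j ->
   - a + e + i = - (- d + h + j) by lra.
exact: alg.
Qed.

Lemma bracket_vv_eta X Y : pf X -> pf Y ->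
  cv (lie_bracket (ver X) (ver Y)) eta = SS X Y eta + cv (ver X) Y - cv (ver Y) X.
Proof.
move=> pX pY; have pe := @pi_field_eta R n M.
rewrite /Scurv /curvature !cov_ver_eta //; linear_fields.
Qed.

Lemma curvature_split_hor U V Z W : pf U -> pf V -> pf Z -> pf W ->
  K (hr U + ver V) (hr Z) W = RR U Z W - PP Z V W.
Proof.
move=> pU pV pZ pW; rewrite (curvatureDl conn (hor_vf pU) (vfield_ver pV) (hor_vf pZ) pW).
by rewrite (curvatureC conn (vfield_ver pV) (hor_vf pZ) pW).
Qed.

Lemma curvature_split_ver U V X W : pf U -> pf V -> pf X -> pf W ->
  K (hr U + ver V) (ver X) W = PP U X W + SS V X W.
Proof.
move=> pU pV pX pW.
by rewrite (curvatureDl conn (hor_vf pU) (vfield_ver pV) (vfield_ver pX) pW).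
Qed.

(** Second Bianchi identity with each bracket replaced by its horizontal and vertical parts; the
    vertical parts, curvatures of [eta], bring in P. *)
Lemma bianchi_hhh X Y Z W : pf X -> pf Y -> pf Z -> pf W ->
  cv (hr X) (RR Y Z W) - RR Y Z (cv (hr X) W)
  + (cv (hr Y) (RR Z X W) - RR Z X (cv (hr Y) W))
  + (cv (hr Z) (RR X Y W) - RR X Y (cv (hr Z) W)) =
  (RR (cv (hr X) Y - cv (hr Y) X) Z W - PP Z (RR X Y eta) W)
  + (RR (cv (hr Y) Z - cv (hr Z) Y) X W - PP X (RR Y Z eta) W)
  + (RR (cv (hr Z) X - cv (hr X) Z) Y W - PP Y (RR Z X eta) W).
Proof.
move=> pX pY pZ pW; have [vX vY] := (hor_vf pX, hor_vf pY); have vZ := hor_vf pZ.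
have pe := @pi_field_eta R n M.
have p1 U1 U2 : pf U1 -> pf U2 -> pf (cv (hr U1) U2 - cv (hr U2) U1) by move=> ? ?; field_auto.
have p2 U1 U2 : pf U1 -> pf U2 -> pf (RR U1 U2 eta) by move=> ? ?; field_auto.
have := bianchi2 conn vX vY vZ pW.
rewrite (bracket_hh pX pY) (bracket_hh pY pZ) (bracket_hh pZ pX).
rewrite (curvature_split_hor (p1 X Y pX pY) (p2 X Y pX pY) pZ pW).
rewrite (curvature_split_hor (p1 Y Z pY pZ) (p2 Y Z pY pZ) pX pW).
by rewrite (curvature_split_hor (p1 Z X pZ pX) (p2 Z X pZ pX) pY pW).
Qed.

Lemma bianchi_vhh X Y Z W : pf X -> pf Y -> pf Z -> pf W ->
  cv (ver X) (RR Y Z W) - RR Y Z (cv (ver X) W)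
  + (cv (hr Y) (PP Z X W) - PP Z X (cv (hr Y) W))
  - (cv (hr Z) (PP Y X W) - PP Y X (cv (hr Z) W)) =
  (RR (cv (ver X) Y - T X Y) Z W - PP Z (- (PP Y X eta + cv (hr Y) X)) W)
  + (PP (cv (hr Y) Z - cv (hr Z) Y) X W + SS (RR Y Z eta) X W)
  + (RR (T X Z - cv (ver X) Z) Y W - PP Y (PP Z X eta + cv (hr Z) X) W).
Proof.
move=> pX pY pZ pW; have [vX vY] := (vfield_ver pX, hor_vf pY); have vZ := hor_vf pZ.
have pe := @pi_field_eta R n M.
have := bianchi2 conn vX vY vZ pW.
rewrite (bracket_vh pX pY) (bracket_hh pY pZ) (bracket_hv pX pZ).
rewrite (curvature_split_hor (pi_fieldB (cv_pf vX pY) (T_pf pX pY))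
  (pi_fieldN (pi_fieldD (PP_pf pY pX pe) (cv_pf vY pX))) pZ pW).
rewrite (curvature_split_ver (pi_fieldB (cv_pf vY pZ) (cv_pf vZ pY)) (RR_pf pY pZ pe) pX pW).
rewrite (curvature_split_hor (pi_fieldB (T_pf pX pZ) (cv_pf vX pZ))
  (pi_fieldD (PP_pf pZ pX pe) (cv_pf vZ pX)) pY pW).
rewrite (curvatureC conn vX vY pW) (curvatureC conn vX vY (cv_pf vZ pW)).
move=> <-; rewrite /Rcurv /Pcurv (covNr conn vZ (curvature_is_pf vY vX pW)).
linear_fields.
Qed.

Lemma PPDl X X' Y Z : pf X -> pf X' -> pf Y -> pf Z -> PP (X + X') Y Z = PP X Y Z + PP X' Y Z.
Proof.
move=> pX pX' pY pZ; rewrite /Pcurv (horD pX pX').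
exact (curvatureDl conn (hor_vf pX) (hor_vf pX') (vfield_ver pY) pZ).
Qed.

Lemma PPDr X Y Y' Z : pf X -> pf Y -> pf Y' -> pf Z -> PP X (Y + Y') Z = PP X Y Z + PP X Y' Z.
Proof.
move=> pX pY pY' pZ; rewrite /Pcurv (verD pY pY').
exact (curvatureDr conn (hor_vf pX) (vfield_ver pY) (vfield_ver pY') pZ).
Qed.

Lemma SSDl X X' Y Z : pf X -> pf X' -> pf Y -> pf Z -> SS (X + X') Y Z = SS X Y Z + SS X' Y Z.
Proof.
move=> pX pX' pY pZ; rewrite /Scurv (verD pX pX').
exact (curvatureDl conn (vfield_ver pX) (vfield_ver pX') (vfield_ver pY) pZ).
Qed.

Lemma PP_scaler F X Y Z : smT F -> pf X -> pf Y -> pf Z -> PP X (fscale F Y) Z = fscale F (PP X Y Z).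
Proof.
move=> sF pX pY pZ; have [vX vY] := (hor_vf pX, vfield_ver pY).
rewrite /Pcurv (ver_scale F pY) (curvatureC conn vX (fscale_vf sF vY) pZ).
rewrite (curvature_scalel conn sF vY vX pZ) (curvatureC conn vX vY pZ).
by apply: slit_fieldP => u f; rewrite fieldNE !fscaleE fieldNE mulrN.
Qed.

Lemma SS_scalel F X Y Z : smT F -> pf X -> pf Y -> pf Z -> SS (fscale F X) Y Z = fscale F (SS X Y Z).
Proof.
move=> sF pX pY pZ; rewrite /Scurv (ver_scale F pX).
exact (curvature_scalel conn sF (vfield_ver pX) (vfield_ver pY) pZ).
Qed.

Lemma SSC X Y Z : pf X -> pf Y -> pf Z -> SS X Y Z = - SS Y X Z.
Proof. by move=> pX pY pZ; exact (curvatureC conn (vfield_ver pX) (vfield_ver pY) pZ). Qed.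

Lemma PP_skew X Y Z W u : pf X -> pf Y -> pf Z -> pf W -> gg (PP X Y Z) W u = - gg (PP X Y W) Z u.
Proof. by move=> pX pY; exact: gg_curvature_skew (hor_vf pX) (vfield_ver pY). Qed.

Lemma SS_skew X Y Z W u : pf X -> pf Y -> pf Z -> pf W -> gg (SS X Y Z) W u = - gg (SS X Y W) Z u.
Proof. by move=> pX pY; exact: gg_curvature_skew (vfield_ver pX) (vfield_ver pY). Qed.

End CartanConnection.

(** * Structure equations *)

Module CartanAlgebra.

(* The part of the argument which only uses the structure equations of the Cartan
   connection: [E] is the module of pi-vector fields, [pf] and [sm] single out
   the smooth fields and functions, [D false] and [D true] are the horizontal and
   vertical covariant derivatives, [d false] and [d true] the corresponding
   derivatives of functions. *)
Section StructureEquations.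
Variables (R : realFieldType) (S : Type) (E : zmodType) (pf : E -> Prop) (sm : (S -> R) -> Prop).
Variables (sc : (S -> R) -> E -> E) (gg : E -> E -> S -> R) (eta : E).
Variables (D : bool -> E -> E -> E) (d : bool -> E -> (S -> R) -> S -> R).
Variables (T : E -> E -> E) (RR PP SS om : E -> E -> E -> E) (k : S -> R).
Implicit Types (X Y Z W U : E) (F G : S -> R) (u : S) (b : bool).

Local Notation Dh := (D false).
Local Notation Dv := (D true).

Hypotheses (pfD : forall X Y, pf X -> pf Y -> pf (X + Y)) (pfN : forall X, pf X -> pf (- X))
  (pf0 : pf 0) (pf_sc : forall F X, sm F -> pf X -> pf (sc F X)) (pf_eta : pf eta)
  (pf_D : forall b X Y, pf X -> pf Y -> pf (D b X Y)) (pf_T : forall X Y, pf X -> pf Y -> pf (T X Y))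
  (pf_R : forall X Y Z, pf X -> pf Y -> pf Z -> pf (RR X Y Z))
  (pf_P : forall X Y Z, pf X -> pf Y -> pf Z -> pf (PP X Y Z))
  (pf_S : forall X Y Z, pf X -> pf Y -> pf Z -> pf (SS X Y Z))
  (pf_om : forall X Y Z, pf X -> pf Y -> pf Z -> pf (om X Y Z))
  (sm_k : sm k) (sm_gg : forall X Y, pf X -> pf Y -> sm (gg X Y))
  (sm_d : forall b X F, pf X -> sm F -> sm (d b X F)).

Hypotheses (ggD : forall X Y Z u, pf X -> pf Y -> pf Z -> gg (X + Y) Z u = gg X Z u + gg Y Z u)
  (ggN : forall X Z u, pf X -> pf Z -> gg (- X) Z u = - gg X Z u)
  (gg_sc : forall F X Z u, pf X -> pf Z -> gg (sc F X) Z u = F u * gg X Z u)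
  (ggC : forall X Y, pf X -> pf Y -> gg X Y = gg Y X)
  (gg_inj : forall X Y, pf X -> pf Y -> (forall Z u, pf Z -> gg X Z u = gg Y Z u) -> X = Y)
  (gg_eta : forall u, gg eta eta u != 0).

Hypotheses (D_D : forall b X Y Z, pf X -> pf Y -> pf Z -> D b X (Y + Z) = D b X Y + D b X Z)
  (D_N : forall b X Y, pf X -> pf Y -> D b X (- Y) = - D b X Y)
  (D_sc : forall b X F Y, pf X -> sm F -> pf Y -> D b X (sc F Y) = sc F (D b X Y) + sc (d b X F) Y)
  (d_gg : forall b X Y Z u, pf X -> pf Y -> pf Z ->
     d b X (gg Y Z) u = gg (D b X Y) Z u + gg Y (D b X Z) u)
  (d0 : forall b X u, pf X -> d b X (fun=> 0) u = 0)
  (Dh_eta : forall X, pf X -> Dh X eta = 0) (Dv_eta : forall X, pf X -> Dv X eta = X).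

Hypotheses (T_sym : forall X Y, pf X -> pf Y -> T X Y = T Y X)
  (T_eta : forall X, pf X -> T X eta = 0)
  (T_swap : forall X Y Z u, pf X -> pf Y -> pf Z -> gg (T X Y) Z u = gg (T X Z) Y u)
  (TD : forall X Y Z, pf X -> pf Y -> pf Z -> T X (Y + Z) = T X Y + T X Z)
  (TN : forall X Y, pf X -> pf Y -> T X (- Y) = - T X Y).

Hypotheses
  (PP_skew : forall X Y Z W u, pf X -> pf Y -> pf Z -> pf W -> gg (PP X Y Z) W u = - gg (PP X Y W) Z u)
  (SS_skew : forall X Y Z W u, pf X -> pf Y -> pf Z -> pf W -> gg (SS X Y Z) W u = - gg (SS X Y W) Z u)
  (SSC : forall X Y Z, pf X -> pf Y -> pf Z -> SS X Y Z = - SS Y X Z)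
  (PPDr : forall X Y Y' Z, pf X -> pf Y -> pf Y' -> pf Z -> PP X (Y + Y') Z = PP X Y Z + PP X Y' Z)
  (PPDl : forall X X' Y Z, pf X -> pf X' -> pf Y -> pf Z -> PP (X + X') Y Z = PP X Y Z + PP X' Y Z)
  (PP_sc : forall F X Y Z, sm F -> pf X -> pf Y -> pf Z -> PP X (sc F Y) Z = sc F (PP X Y Z))
  (SSD : forall X X' Y Z, pf X -> pf X' -> pf Y -> pf Z -> SS (X + X') Y Z = SS X Y Z + SS X' Y Z)
  (SS_sc : forall F X Y Z, sm F -> pf X -> pf Y -> pf Z -> SS (sc F X) Y Z = sc F (SS X Y Z)).

Hypotheses
  (PP_formula : forall X Y Z, pf X -> pf Y -> pf Z -> PP X Y Z - PP Z Y X =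
     - Dh X (T Y Z) + Dh Z (T Y X) - T (PP Z Y eta + Dh Z Y) X + T (PP X Y eta + Dh X Y) Z
     - T Y (Dh Z X - Dh X Z))
  (SS_formula : forall X Y Z, pf X -> pf Y -> pf Z -> SS X Y Z =
     - Dv X (T Y Z) - T X (Dv Y Z - T Y Z) + Dv Y (T X Z) + T Y (Dv X Z - T X Z)
     + T (SS X Y eta + Dv X Y - Dv Y X) Z)
  (bianchi_hhh : forall X Y Z W, pf X -> pf Y -> pf Z -> pf W ->
     Dh X (RR Y Z W) - RR Y Z (Dh X W) + (Dh Y (RR Z X W) - RR Z X (Dh Y W))
     + (Dh Z (RR X Y W) - RR X Y (Dh Z W)) =
     (RR (Dh X Y - Dh Y X) Z W - PP Z (RR X Y eta) W)
     + (RR (Dh Y Z - Dh Z Y) X W - PP X (RR Y Z eta) W)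
     + (RR (Dh Z X - Dh X Z) Y W - PP Y (RR Z X eta) W))
  (bianchi_vhh : forall X Y Z W, pf X -> pf Y -> pf Z -> pf W ->
     Dv X (RR Y Z W) - RR Y Z (Dv X W) + (Dh Y (PP Z X W) - PP Z X (Dh Y W))
     - (Dh Z (PP Y X W) - PP Y X (Dh Z W)) =
     (RR (Dv X Y - T X Y) Z W - PP Z (- (PP Y X eta + Dh Y X)) W)
     + (PP (Dh Y Z - Dh Z Y) X W + SS (RR Y Z eta) X W)
     + (RR (T X Z - Dv X Z) Y W - PP Y (PP Z X eta + Dh Z X) W)).

Hypotheses
  (om_eta1 : forall X Y, pf X -> pf Y -> om eta X Y = 0)
  (om_eta2 : forall X Y, pf X -> pf Y -> om X eta Y = 0)
  (om_eta3 : forall X Y, pf X -> pf Y -> om X Y eta = 0)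
  (omC : forall X Y Z, pf X -> pf Y -> pf Z -> om X Y Z = - om Y X Z)
  (om0 : forall X Y, pf X -> pf Y -> om X Y 0 = 0)
  (omN : forall X Y Z, pf X -> pf Y -> pf Z -> om (- X) Y Z = - om X Y Z)
  (RR_E : forall X Y Z, pf X -> pf Y -> pf Z ->
     RR X Y Z = sc k (sc (gg X Z) Y - sc (gg Y Z) X + om X Y Z)).

Hint Resolve pfD pfN pf0 pf_sc pf_eta pf_D pf_T pf_R pf_P pf_S pf_om sm_k sm_gg sm_d : alg.
Local Ltac alg := solve [auto 12 with alg].

Lemma gg0 Z u : pf Z -> gg 0 Z u = 0.
Proof.
by move=> pZ; have := ggD u pf0 pf0 pZ; rewrite addr0 => /esym/(canRL (addrK _)); rewrite subrr.
Qed.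

(** The common pattern behind the vanishing of P(eta,.) and S(eta,.): symmetry will come from the
    torsion and skewness from the curvature. *)
Lemma sym_skew0 (Q : E -> E) : (forall Z, pf Z -> pf (Q Z)) ->
  (forall Z W u, pf Z -> pf W -> gg (Q Z) W u = gg (Q W) Z u) ->
  (forall Z W u, pf Z -> pf W -> gg (Q Z) W u = - gg (Q W) Z u) ->
  forall Z, pf Z -> Q Z = 0.
Proof.
move=> pQ sym skew Z pZ; apply: gg_inj => [||W u pW]; [exact: pQ|exact: pf0|].
have := skew Z W u pZ pW; rewrite -(sym Z W u pZ pW) gg0 //; lra.
Qed.

Lemma gg_T_eta X Y u : pf X -> pf Y -> gg (T X Y) eta u = 0.
Proof. by move=> pX pY; rewrite T_swap ?T_eta ?gg0. Qed.

Lemma D0 b X : pf X -> D b X 0 = 0.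
Proof.
by move=> pX; have := D_D b pX pf0 pf0; rewrite addr0 => /esym/(canRL (addrK _)); rewrite subrr.
Qed.

Lemma T0 X : pf X -> T X 0 = 0.
Proof.
by move=> pX; have := TD pX pf0 pf0; rewrite addr0 => /esym/(canRL (addrK _)); rewrite subrr.
Qed.

Lemma PP0r X Z : pf X -> pf Z -> PP X 0 Z = 0.
Proof.
by move=> pX pZ; have := PPDr pX pf0 pf0 pZ; rewrite addr0 => /esym/(canRL (addrK _)); rewrite subrr.
Qed.

Lemma PPNl X Y Z : pf X -> pf Y -> pf Z -> PP (- X) Y Z = - PP X Y Z.
Proof.
move=> pX pY pZ; have P0 : PP 0 Y Z = 0.
  by have := PPDl pf0 pf0 pY pZ; rewrite addr0 => /esym/(canRL (addrK _)); rewrite subrr.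
have := PPDl pX (pfN pX) pY pZ; rewrite subrr P0 => /esym/eqP.
by rewrite addr_eq0 => /eqP ->; rewrite opprK.
Qed.

Lemma PPNr X Y Z : pf X -> pf Y -> pf Z -> PP X (- Y) Z = - PP X Y Z.
Proof.
move=> pX pY pZ; have := PPDr pX pY (pfN pY) pZ; rewrite subrr PP0r // => /esym/eqP.
by rewrite addr_eq0 => /eqP ->; rewrite opprK.
Qed.

Lemma SSN X Y Z : pf X -> pf Y -> pf Z -> SS (- X) Y Z = - SS X Y Z.
Proof.
move=> pX pY pZ; have P0 : SS 0 Y Z = 0.
  by have := SSD pf0 pf0 pY pZ; rewrite addr0 => /esym/(canRL (addrK _)); rewrite subrr.
have := SSD pX (pfN pX) pY pZ; rewrite subrr P0 => /esym/eqP.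
by rewrite addr_eq0 => /eqP ->; rewrite opprK.
Qed.

Lemma TNl X Y : pf X -> pf Y -> T (- X) Y = - T X Y.
Proof. by move=> pX pY; rewrite T_sym ?TN ?(T_sym pY); alg. Qed.

Lemma TDl X Y Z : pf X -> pf Y -> pf Z -> T (X + Y) Z = T X Z + T Y Z.
Proof. by move=> pX pY pZ; rewrite T_sym ?TD ?(T_sym pZ); alg. Qed.

(** The function g(T(Y,Z), eta) is identically zero, and [eta] is parallel in horizontal
    directions. *)
Lemma gg_DT_eta X Y Z u : pf X -> pf Y -> pf Z -> gg (Dh X (T Y Z)) eta u = 0.
Proof.
move=> pX pY pZ; have pT := pf_T pY pZ; have := d_gg false u pX pT pf_eta.
rewrite Dh_eta // (ggC pT pf0) gg0 // addr0 => <-.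
by rewrite (_ : gg (T Y Z) eta = fun=> 0) ?d0 //; apply/funext => v; rewrite gg_T_eta.
Qed.

Lemma gg_PP_eta X Y Z u : pf X -> pf Y -> pf Z -> gg (PP X Y Z) eta u = - gg (PP X Y eta) Z u.
Proof. by move=> pX pY pZ; rewrite PP_skew. Qed.

(** Pairing [PP_formula] with [eta] annihilates every torsion term on its right side; skewness then
    moves [eta] into the last slot of P. *)
Lemma PP_hat_swap X Y Z u : pf X -> pf Y -> pf Z -> gg (PP X Y eta) Z u = gg (PP Z Y eta) X u.
Proof.
move=> pX pY pZ; have := congr1 (fun A => gg A eta u) (PP_formula pX pY pZ) => /=.
rewrite !ggD ?ggN; try alg.
rewrite !gg_T_eta ?gg_DT_eta ?gg_PP_eta; try alg.
rewrite !(oppr0, addr0, subr0, opprK); lra.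
Qed.

Lemma PP_eta_eta X : pf X -> PP eta X eta = 0.
Proof.
move=> pX; apply: gg_inj; try alg.
move=> Z u pZ; rewrite gg0 // PP_hat_swap //.
have := PP_skew u pZ pX pf_eta pf_eta; lra.
Qed.

Definition DT Y X := Dh eta (T Y X) - T (Dh eta Y) X - T Y (Dh eta X).

Lemma pf_DT X Y : pf X -> pf Y -> pf (DT X Y).
Proof. by move=> pX pY; rewrite /DT; auto 12 with alg. Qed.
Hint Resolve pf_DT : alg.

(** The metric is parallel, so a covariant derivative of [T] inherits [T_swap]. *)
Lemma gg_D_T_swap b A X Y Z u : pf A -> pf X -> pf Y -> pf Z ->
  gg (D b A (T X Y) - T (D b A X) Y - T X (D b A Y)) Z u =
  gg (D b A (T X Z) - T (D b A X) Z - T X (D b A Z)) Y u.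
Proof.
move=> pA pX pY pZ; rewrite !ggD ?ggN; try alg.
have e1 := d_gg b u pA (pf_T pX pY) pZ; have e2 := d_gg b u pA (pf_T pX pZ) pY.
have E0 : gg (T X Y) Z = gg (T X Z) Y by apply/funext => v; exact: T_swap.
have := e1; rewrite E0 e2 !(T_swap _ pX pY) ?(T_swap _ pX pZ) ?(T_swap _ (pf_D b pA pX) pY); try alg.
lra.
Qed.

Lemma PP_hat_aux X Y : pf X -> pf Y -> PP X Y eta - PP eta Y X = DT Y X.
Proof.
move=> pX pY; rewrite PP_formula // !T_eta ?PP_eta_eta ?add0r ?D0 ?Dh_eta ?oppr0 ?addr0 ?add0r ?subr0; try alg.
Qed.

(** By [PP_hat_aux] the operator sending X to P(eta,Y)X is a difference of two operators symmetric
    for the metric, one by [PP_hat_swap] and one by [gg_D_T_swap]. As a curvature operator it is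
    also skew. *)
Lemma PP_eta_l X Y : pf X -> pf Y -> PP eta Y X = 0.
Proof.
move=> pX pY; apply: (sym_skew0 (Q := fun X => PP eta Y X)) => //.
- by move=> Z0 p0; cbv beta; alg.
- move=> Z W u pZ pW.
  have e1 := congr1 (fun A => gg A W u) (PP_hat_aux pZ pY).
  have e2 := congr1 (fun A => gg A Z u) (PP_hat_aux pW pY).
  have e3 := gg_D_T_swap false u pf_eta pY pZ pW; rewrite -!/(DT _ _) -e1 -e2 in e3.
  move: e3; rewrite !ggD ?ggN; try alg.
  rewrite (PP_hat_swap u pZ pY pW); lra.
- by move=> Z W u pZ pW; exact: PP_skew.
Qed.

Lemma PP_hat_E X Y : pf X -> pf Y -> PP X Y eta = DT Y X.
Proof. by move=> pX pY; rewrite -PP_hat_aux // PP_eta_l // subr0. Qed.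

Lemma DT_sym X Y : pf X -> pf Y -> DT X Y = DT Y X.
Proof.
move=> pX pY; rewrite /DT (T_sym pX pY) (T_sym pX) ?(T_sym _ pY); try alg.
by rewrite addrAC.
Qed.

Lemma PP_hat_sym X Y : pf X -> pf Y -> PP X Y eta = PP Y X eta.
Proof. by move=> pX pY; rewrite !PP_hat_E // DT_sym. Qed.

Lemma PP_hat_eta X : pf X -> PP X eta eta = 0.
Proof. by move=> pX; rewrite PP_hat_sym // PP_eta_eta. Qed.

(** [PP_formula] with [eta] in the vertical slot: every torsion term then has [eta] or 0 among its
    arguments. *)
Lemma PP_eta_swap X Z : pf X -> pf Z -> PP X eta Z = PP Z eta X.
Proof.
move=> pX pZ; apply/eqP; rewrite -subr_eq0; apply/eqP; rewrite PP_formula //.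
have T_eta_l A : pf A -> T eta A = 0 by move=> pA; rewrite T_sym ?T_eta.
rewrite !T_eta_l ?D0; try alg.
rewrite !PP_hat_eta // !Dh_eta // !addr0 !(T_sym pf0) // !T0 //.
by rewrite !oppr0 !addr0.
Qed.

(* Symmetric in [X, Z] and skew in [Z, W]. *)
Lemma PP_eta_r X Z : pf X -> pf Z -> PP X eta Z = 0.
Proof.
move=> pX pZ; apply: gg_inj; try alg; move=> W u pW; rewrite gg0 //.
have e1 := PP_skew u pX pf_eta pZ pW; rewrite (PP_eta_swap pX pW) in e1.
have e2 := PP_skew u pW pf_eta pX pZ; rewrite (PP_eta_swap pW pZ) in e2.
have e3 := PP_skew u pZ pf_eta pW pX; rewrite (PP_eta_swap pZ pX) in e3.
lra.
Qed.

(** At Z = eta the torsion formula collapses to T(Y,X) - T(X,Y). *)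
Lemma SS_eta X Y : pf X -> pf Y -> SS X Y eta = 0.
Proof.
move=> pX pY; rewrite SS_formula // !T_eta ?D0 ?Dv_eta ?subr0 ?oppr0 ?add0r ?addr0; try alg.
by rewrite (T_sym pX pY) addNr.
Qed.

Lemma SS_eta_E Y Z : pf Y -> pf Z ->
  SS eta Y Z = - (Dv eta (T Y Z) - T (Dv eta Y) Z - T Y (Dv eta Z)) - T Y Z.
Proof.
move=> pY pZ; have T_eta_l A : pf A -> T eta A = 0 by move=> pA; rewrite T_sym ?T_eta.
rewrite SS_formula // SS_eta // Dv_eta // !T_eta_l ?D0; try alg.
rewrite add0r !subr0 addr0 TDl ?TNl; try alg.
apply: gg_inj; try alg; move=> W u pW.
by rewrite !ggD ?ggN ?ggD ?ggN; try alg; ring.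
Qed.

(** [SS_eta_E] writes this operator through [T Y] and its vertical derivative along [eta], both
    symmetric, while the curvature makes it skew. *)
Lemma SS_eta_l Y Z : pf Y -> pf Z -> SS eta Y Z = 0.
Proof.
move=> pY pZ; apply: (sym_skew0 (Q := fun Z => SS eta Y Z)) => //.
- by move=> Z0 p0; cbv beta; alg.
- move=> Z' W u pZ' pW; have e := gg_D_T_swap true u pf_eta pY pZ' pW.
  have t := T_swap u pY pZ' pW.
  rewrite !SS_eta_E // !(ggD _ (pfN _)) ?ggN; try alg.
  by rewrite e t.
- by move=> Z' W u pZ' pW; exact: SS_skew.
Qed.

Lemma gg_RR X Y Z U u : pf X -> pf Y -> pf Z -> pf U -> gg (RR X Y Z) U u =
  k u * (gg X Z u * gg Y U u - gg Y Z u * gg X U u + gg (om X Y Z) U u).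
Proof.
move=> pX pY pZ pU; rewrite RR_E // gg_sc ?ggD ?ggN ?gg_sc; try alg.
Qed.

Lemma gg_DRR b A X Y Z U u : pf A -> pf X -> pf Y -> pf Z -> pf U ->
  gg (D b A (RR X Y Z)) U u =
  d b A k u * (gg X Z u * gg Y U u - gg Y Z u * gg X U u + gg (om X Y Z) U u)
  + k u * ((gg (D b A X) Z u + gg X (D b A Z) u) * gg Y U u + gg X Z u * gg (D b A Y) U u
    - (gg (D b A Y) Z u + gg Y (D b A Z) u) * gg X U u - gg Y Z u * gg (D b A X) U u
    + gg (D b A (om X Y Z)) U u).
Proof.
move=> pA pX pY pZ pU; rewrite RR_E // D_sc; try alg.
rewrite !D_D ?D_N ?D_sc; try alg.
rewrite !(ggD, gg_sc, ggN); try alg.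
rewrite !d_gg //; ring.
Qed.

(** By hypothesis R(eta,Y)eta is k times (g(eta,eta) Y - g(Y,eta) eta), and the radial part is lost
    because P(.,eta) vanishes. *)
Lemma gg_PP_RR1 Y Z W U u : pf Y -> pf Z -> pf W -> pf U ->
  gg (PP Z (RR eta Y eta) W) U u = k u * gg eta eta u * gg (PP Z Y W) U u.
Proof.
move=> pY pZ pW pU; rewrite RR_E // om_eta1 // addr0 PP_sc; try alg.
rewrite PPDr ?PPNr ?PP_sc ?PP_eta_r; try alg.
by rewrite !(gg_sc, ggD, ggN, gg0); try alg; ring.
Qed.

Lemma gg_PP_RR2 Y Z W U u : pf Y -> pf Z -> pf W -> pf U ->
  gg (PP Y (RR Z eta eta) W) U u = - k u * gg eta eta u * gg (PP Y Z W) U u.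
Proof.
move=> pY pZ pW pU; rewrite RR_E // om_eta2 // addr0 PP_sc; try alg.
rewrite PPDr ?PPNr ?PP_sc ?PP_eta_r; try alg.
by rewrite !(gg_sc, ggD, ggN, gg0); try alg; ring.
Qed.

Lemma gg_SS_RR X Y W U u : pf X -> pf Y -> pf W -> pf U ->
  gg (SS (RR Y eta eta) X W) U u = - k u * gg eta eta u * gg (SS Y X W) U u.
Proof.
move=> pX pY pW pU; rewrite RR_E // om_eta2 // addr0 SS_sc; try alg.
rewrite SSD ?SSN ?SS_sc ?SS_eta_l; try alg.
by rewrite !(gg_sc, ggD, ggN, gg0); try alg; ring.
Qed.

Definition Dom X Y Z := Dh eta (om X Y Z) - om (Dh eta X) Y Z - om X (Dh eta Y) Z - om X Y (Dh eta Z).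

(** [bianchi_hhh] at X = eta. One P term has first argument [eta] and drops out; the other two yield
    the factor k g(eta,eta). Pairing with [U] turns an identity of fields into one of scalars,
    accessible to [ring]. *)
Lemma gg_hhh Y Z W U u : pf Y -> pf Z -> pf W -> pf U ->
  d false eta k u * (gg Y W u * gg Z U u - gg Z W u * gg Y U u + gg (om Y Z W) U u)
  + d false Y k u * (gg Z W u * gg eta U u - gg eta W u * gg Z U u)
  + d false Z k u * (gg eta W u * gg Y U u - gg Y W u * gg eta U u)
  + k u * gg (Dom Y Z W) U u
  + k u * gg eta eta u * (gg (PP Z Y W) U u - gg (PP Y Z W) U u) = 0.
Proof.
move=> pY pZ pW pU.
have := congr1 (fun A => gg A U u) (bianchi_hhh pf_eta pY pZ pW).
rewrite !Dh_eta // !subr0 !sub0r PP_eta_l ?subr0; try alg.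
rewrite !(ggD, ggN); try alg.
rewrite gg_PP_RR1 ?gg_PP_RR2; try alg.
rewrite !gg_RR ?gg_DRR; try alg.
rewrite !Dh_eta // !om_eta1 ?om_eta2 ?omN ?(omC (pf_D false pf_eta pZ)) ?opprK; try alg.
rewrite !D0 ?gg0; try alg.
rewrite /Dom !(ggD, ggN, gg0); try alg.
move=> /eqP; rewrite -subr_eq0 => /eqP H; rewrite -[RHS]H; ring.
Qed.

Definition DPP Y X W := Dh eta (PP Y X W) - PP (Dh eta Y) X W - PP Y (Dh eta X) W - PP Y X (Dh eta W).

(** [bianchi_vhh] with [eta] in the last horizontal slot. The term in [om X Y W] arises from
    R(-X,Y)W, as the vertical derivative of [eta] along X is X itself. *)
Lemma gg_vhh X Y W U u : pf X -> pf Y -> pf W -> pf U ->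
  d true X k u * (gg Y W u * gg eta U u - gg eta W u * gg Y U u)
  + k u * gg (om X Y W) U u
  + k u * (gg (T X Y) W u * gg eta U u - gg eta W u * gg (T X Y) U u)
  - gg (DPP Y X W) U u + k u * gg eta eta u * gg (SS Y X W) U u = 0.
Proof.
move=> pX pY pW pU.
have := congr1 (fun A => gg A U u) (bianchi_vhh pX pY pf_eta pW).
rewrite !Dh_eta // !T_eta // !Dv_eta // !sub0r !PP_eta_l ?D0 ?subr0 ?add0r; try alg.
rewrite !(ggD, ggN); try alg.
rewrite gg_SS_RR ?PPNl ?ggN; try alg.
rewrite !gg_RR ?gg_DRR; try alg.
rewrite !om_eta2 ?omN ?D0 ?Dv_eta; try alg.
rewrite /DPP !(ggD, ggN, gg0); try alg.
move=> /eqP; rewrite -subr_eq0 => /eqP H; rewrite -[RHS]H; ring.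
Qed.

Lemma PP0 X Y : pf X -> pf Y -> PP X Y 0 = 0.
Proof.
move=> pX pY; apply: gg_inj; try alg; move=> Z u pZ.
have p := pf_P pX pY pZ.
by rewrite PP_skew ?(ggC p pf0) ?gg0 ?oppr0; try alg.
Qed.

Lemma DPP_eta_sym X Y : pf X -> pf Y -> DPP Y X eta = DPP X Y eta.
Proof.
move=> pX pY; rewrite /DPP !Dh_eta // !PP0 // (PP_hat_sym pX pY).
rewrite (PP_hat_sym pX (pf_D false pf_eta pY)) (PP_hat_sym (pf_D false pf_eta pX) pY).
by rewrite (addrAC (Dh eta (PP Y X eta))).
Qed.

(* Antisymmetrizing [gg_vhh] at [W = eta] removes the curvature terms. *)
Lemma vert_dk X Y U u : pf X -> pf Y -> pf U ->
  d true X k u * (gg Y eta u * gg eta U u - gg eta eta u * gg Y U u) =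
  d true Y k u * (gg X eta u * gg eta U u - gg eta eta u * gg X U u).
Proof.
move=> pX pY pU.
have := gg_vhh u pX pY pf_eta pU; have := gg_vhh u pY pX pf_eta pU.
rewrite !om_eta3 // !SS_eta // (DPP_eta_sym pX pY) (T_sym pY pX) gg_T_eta // !gg0 //.
lra.
Qed.

(** [vert_dk] at U = Y: orthogonality clears the right side, and the left side is the derivative of
    [k] times - g(eta,eta) g(Y,Y). *)
Lemma vert_dk0 X Y u : pf X -> pf Y -> gg Y eta u = 0 -> gg X Y u = 0 -> gg Y Y u != 0 ->
  d true X k u = 0.
Proof.
move=> pX pY e1 e2 e3; have := vert_dk u pX pY pY.
rewrite e2 (ggC pf_eta pY) e1 !mulr0 subr0 mulr0 sub0r => /eqP.
by rewrite !mulf_eq0 oppr_eq0 mulf_eq0 (negbTE (gg_eta u)) (negbTE e3) !orbF => /eqP.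
Qed.

(** [gg_hhh] at W = eta and U = Z, with Z orthogonal to Y and [eta]: the derivative of [k] along Z
    disappears, P cancels by symmetry, and g(Z,Z) is a common factor. *)
Lemma hor_dk Y Z u : pf Y -> pf Z -> gg Z eta u = 0 -> gg Y Z u = 0 -> gg Z Z u != 0 ->
  d false Y k u * gg eta eta u = d false eta k u * gg Y eta u.
Proof.
move=> pY pZ e1 e2 e3; have := gg_hhh u pY pZ pf_eta pZ.
have -> : Dom Y Z eta = 0.
  by rewrite /Dom Dh_eta // om0 // !om_eta3 ?D0 ?subr0; try alg.
rewrite (PP_hat_sym pY pZ) gg0 // om_eta3 // gg0 // e2 (ggC pf_eta pZ) e1.
move=> H; apply: (mulIf e3); move: H; lra.
Qed.

Definition DDom X Y Z := Dh eta (Dom X Y Z) - Dom (Dh eta X) Y Z - Dom X (Dh eta Y) Z - Dom X Y (Dh eta Z).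

Lemma pf_Dom X Y Z : pf X -> pf Y -> pf Z -> pf (Dom X Y Z).
Proof. by move=> pX pY pZ; rewrite /Dom; auto 12 with alg. Qed.

Lemma pf_DPP X Y Z : pf X -> pf Y -> pf Z -> pf (DPP X Y Z).
Proof. by move=> pX pY pZ; rewrite /DPP; auto 12 with alg. Qed.
Hint Resolve pf_Dom pf_DPP : alg.

(** * The mixed and vertical curvatures for constant nonzero [k] *)

Section ConstantCurvature.
Hypotheses (dk0 : forall b X u, pf X -> d b X k u = 0) (k0 : forall u, k u != 0).

(** Kept as an identity of fields without division, so that it can be substituted for [Dom] under a
    further covariant derivative. *)
Lemma PP_antisym X Y Z : pf X -> pf Y -> pf Z ->
  sc (gg eta eta) (PP X Y Z - PP Y X Z) = Dom X Y Z.
Proof.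
move=> pX pY pZ; apply: gg_inj; try alg; move=> U u pU.
have := gg_hhh u pX pY pZ pU; rewrite !dk0 // !mul0r !add0r => H.
have p1 := pf_P pX pY pZ; have p2 := pf_P pY pX pZ.
rewrite (gg_sc _ u (pfD p1 (pfN p2)) pU) (ggD u p1 (pfN p2) pU) (ggN u p2 pU).
apply: (mulfI (k0 u)); have := congr1 -%R H; rewrite oppr0 => H'.
by apply/eqP; rewrite -subr_eq0; apply/eqP; rewrite -[RHS]H'; ring.
Qed.

Lemma gg_PP_antisym X Y Z U u : pf X -> pf Y -> pf Z -> pf U ->
  gg (PP X Y Z - PP Y X Z) U u = (gg eta eta u)^-1 * gg (Dom X Y Z) U u.
Proof.
move=> pX pY pZ pU; rewrite -PP_antisym // gg_sc; try alg.
by rewrite mulrA mulVf ?mul1r.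
Qed.

(** The derivative of [PP_antisym] along [eta]; the factor g(eta,eta) is constant in that
    direction. *)
Lemma gg_DDom X Y Z U u : pf X -> pf Y -> pf Z -> pf U ->
  gg (DDom X Y Z) U u = gg eta eta u * (gg (DPP X Y Z) U u - gg (DPP Y X Z) U u).
Proof.
move=> pX pY pZ pU; have pe := pf_eta.
have dL : d false eta (gg eta eta) u = 0.
  by rewrite d_gg // !Dh_eta // (ggC pf_eta pf0) !gg0 // addr0.
rewrite /DDom -!PP_antisym; try alg.
rewrite D_sc; try alg.
rewrite !D_D ?D_N; try alg.
rewrite /DPP !(ggD, ggN, gg_sc); try alg.
rewrite dL; ring.
Qed.

(** Subtract [gg_vhh] from its copy with X and Y exchanged. The torsion terms cancel by symmetry, S
    and [om] double by skewness (whence the 2), and the derivatives of P combine into [DDom] by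
    [gg_DDom]. *)
Lemma gg_SS X Y Z U u : pf X -> pf Y -> pf Z -> pf U ->
  gg (SS X Y Z) U u = (gg eta eta u)^-1 *
    ((2 * k u * gg eta eta u)^-1 * gg (DDom X Y Z) U u + gg (om X Y Z) U u).
Proof.
move=> pX pY pZ pU.
have := gg_vhh u pX pY pZ pU; have := gg_vhh u pY pX pZ pU.
rewrite !dk0 // (T_sym pY pX) (SSC pY pX pZ) (omC pY pX pZ) gg_DDom //.
rewrite (ggN u (pf_S pX pY pZ) pU) (ggN u (pf_om pX pY pZ) pU).
have := gg_eta u; have := k0 u.
move: (gg eta eta u) (k u) (gg (SS X Y Z) U u) (gg (om X Y Z) U u) => L2 ku s o ku0 L0.
move: (gg (DPP X Y Z) U u) (gg (DPP Y X Z) U u) (gg (T X Y) Z u) (gg eta U u) (gg eta Z u) (gg (T X Y) U u) => p q r1 r2 r3 r4 H1 H2.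
have H : 2 * ku * L2 * s = (p - q) + 2 * ku * o.
  have := congr2 (fun a b : R => a - b) H1 H2; rewrite subrr => /= H3.
  by apply/eqP; rewrite -subr_eq0; apply/eqP; rewrite -[RHS]H3; ring.
have n0 : 2 * ku * L2 != 0 by rewrite !mulf_neq0 // pnatr_eq0.
apply: (mulfI n0); rewrite H; field; exact/andP.
Qed.

End ConstantCurvature.

(** Gathered into one statement so that the structure equations are instantiated only once. *)
Lemma consequences :
  [/\ forall X Y u, pf X -> pf Y -> gg Y eta u = 0 -> gg X Y u = 0 -> gg Y Y u != 0 ->
        d true X k u = 0,
      forall Y Z u, pf Y -> pf Z -> gg Z eta u = 0 -> gg Y Z u = 0 -> gg Z Z u != 0 ->
        d false Y k u * gg eta eta u = d false eta k u * gg Y eta u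
    & (forall b X u, pf X -> d b X k u = 0) -> (forall u, k u != 0) ->
      (forall X Y Z U u, pf X -> pf Y -> pf Z -> pf U ->
        gg (PP X Y Z - PP Y X Z) U u = (gg eta eta u)^-1 * gg (Dom X Y Z) U u) /\
      (forall X Y Z U u, pf X -> pf Y -> pf Z -> pf U ->
        gg (SS X Y Z) U u = (gg eta eta u)^-1 *
          ((2 * k u * gg eta eta u)^-1 * gg (DDom X Y Z) U u + gg (om X Y Z) U u))].
Proof.
split=> [X Y u|Y Z u|dk0 k0]; [exact: vert_dk0|exact: hor_dk|].
by split=> *; [exact: gg_PP_antisym|exact: gg_SS].
Qed.

End StructureEquations.

End CartanAlgebra.

(** * The abstract identities for an actual Cartan connection *)

Section CurvatureCondition.
Context {R : realType} {n : nat} {M : manifold R n}.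
Implicit Types (p q : M) (f h : M -> R) (u : slit M) (F : slit M -> R)
  (X Y Z W U : slit M -> vec R M).
Local Notation smM := (@smoothM R n M).
Local Notation smT := (@smoothT R n M).
Local Notation pf := (@pi_field R n M).
Local Notation vf := (@vfield R n M).
Local Notation eta := (@eta_field R n M).
Variables (L : slit M -> R) (nabla : connection_map M) (omega : tensor13 M) (k : slit M -> R).
Hypotheses (hL : finsler L) (hC : is_cartan nabla L) (homega : pi_tensor13 omega)
  (homega_ind : indicatory omega) (homega_skew : skew12 omega) (hk : smT k)
  (hR : forall X Y Z, pf X -> pf Y -> pf Z -> forall u, Rcurv nabla X Y Z u =
     k u *: (finsler_metric L u (X u) (Z u) *: Y u - finsler_metric L u (Y u) (Z u) *: X u
             + omega u (X u) (Y u) (Z u))).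
Local Notation om := (tensor_on_fields omega).

Let conn : is_connection nabla. Proof. by case: hC. Qed.

(** The Boolean index lets each rule valid for both kinds of derivative be stated and supplied
    once. *)
Definition lift (b : bool) X : slit M -> vec R (slit M) := if b then ver X else hor nabla X.
Definition dir_cov b X := cov nabla (lift b X).
Definition dir_deriv b X F : slit M -> R := fun u => lift b X u F.

Lemma lift_vf b X : pf X -> vf (lift b X).
Proof. by case: b => pX; [exact: vfield_ver | exact: (hor_vf hC pX)]. Qed.

Lemma om_pf X Y Z : pf X -> pf Y -> pf Z -> pf (om X Y Z).
Proof. by case: homega => _ h; exact: h. Qed.

Lemma om_eta1 X Y : pf X -> pf Y -> om eta X Y = 0.
Proof.
move=> pX pY; apply: funext => u.
by case: (homega_ind (pi_field_tangent u pX) (pi_field_tangent u pY)).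
Qed.

Lemma om_eta2 X Y : pf X -> pf Y -> om X eta Y = 0.
Proof.
move=> pX pY; apply: funext => u.
by case: (homega_ind (pi_field_tangent u pX) (pi_field_tangent u pY)).
Qed.

Lemma om_eta3 X Y : pf X -> pf Y -> om X Y eta = 0.
Proof.
move=> pX pY; apply: funext => u.
by case: (homega_ind (pi_field_tangent u pX) (pi_field_tangent u pY)).
Qed.

Lemma omC X Y Z : pf X -> pf Y -> pf Z -> om X Y Z = - om Y X Z.
Proof.
move=> pX pY pZ; apply: funext => u.
exact: (homega_skew (pi_field_tangent u pX) (pi_field_tangent u pY) (pi_field_tangent u pZ)).
Qed.

Lemma om0r X Y : pf X -> pf Y -> om X Y 0 = 0.
Proof.
move=> pX pY; apply: funext => u; have tX := pi_field_tangent u pX; have tY := pi_field_tangent u pY.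
have t0 : tangent smM (slit_proj u) 0 by exact: tangent0.
case: homega => /(_ u)[_ _ _ H] _; have := H (-1) _ _ _ _ tX tY t0 t0.
by rewrite scaleN1r oppr0 addr0 scaleN1r addNr.
Qed.

Lemma om0l Y Z : pf Y -> pf Z -> om 0 Y Z = 0.
Proof.
move=> pY pZ; apply: funext => u; have tY := pi_field_tangent u pY; have tZ := pi_field_tangent u pZ.
have t0 : tangent smM (slit_proj u) 0 by exact: tangent0.
case: homega => /(_ u)[_ H _ _] _; have := H (-1) _ _ _ _ t0 t0 tY tZ.
by rewrite scaleN1r oppr0 addr0 scaleN1r addNr.
Qed.

Lemma omNl X Y Z : pf X -> pf Y -> pf Z -> om (- X) Y Z = - om X Y Z.
Proof.
move=> pX pY pZ; apply: funext => u; have tX := pi_field_tangent u pX.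
have tY := pi_field_tangent u pY; have tZ := pi_field_tangent u pZ.
have t0 : tangent smM (slit_proj u) 0 by exact: tangent0.
have e : omega u 0 (Y u) (Z u) = 0 := congr1 (fun A => A u) (om0l pY pZ).
case: homega => /(_ u)[_ H _ _] _; have := H (-1) _ _ _ _ tX t0 tY tZ.
by rewrite e addr0 !scaleN1r addr0.
Qed.

Lemma Rcurv_E X Y Z : pf X -> pf Y -> pf Z ->
  Rcurv nabla X Y Z = fscale k (fscale (gg L X Z) Y - fscale (gg L Y Z) X + om X Y Z).
Proof. by move=> pX pY pZ; apply: funext => u; exact: (hR pX pY pZ u). Qed.

Lemma dir_deriv_sm b X F : pf X -> smT F -> smT (dir_deriv b X F).
Proof. by move=> pX sF; exact: (vfield_smooth (lift_vf b pX) sF). Qed.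

Lemma dir_cov_pf b X Y : pf X -> pf Y -> pf (dir_cov b X Y).
Proof. by move=> pX pY; exact: (cv_pf hC (lift_vf b pX) pY). Qed.

Lemma dir_covD b X Y Z : pf X -> pf Y -> pf Z ->
  dir_cov b X (Y + Z) = dir_cov b X Y + dir_cov b X Z.
Proof. by move=> pX pY pZ; exact: (covDr conn (lift_vf b pX) pY pZ). Qed.

Lemma dir_covN b X Y : pf X -> pf Y -> dir_cov b X (- Y) = - dir_cov b X Y.
Proof. by move=> pX pY; exact: (covNr conn (lift_vf b pX) pY). Qed.

Lemma dir_cov_scale b X F Y : pf X -> smT F -> pf Y ->
  dir_cov b X (fscale F Y) = fscale F (dir_cov b X Y) + fscale (dir_deriv b X F) Y.
Proof. by move=> pX sF pY; exact: (cov_scaler conn (lift_vf b pX) sF pY). Qed.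

Lemma dir_deriv_gg b X Y Z u : pf X -> pf Y -> pf Z ->
  dir_deriv b X (gg L Y Z) u = gg L (dir_cov b X Y) Z u + gg L Y (dir_cov b X Z) u.
Proof. by move=> pX pY pZ; exact: (metric_compat hC u (lift_vf b pX) pY pZ). Qed.

Lemma dir_deriv_cst b X (r : R) u : pf X -> dir_deriv b X (fun=> r) u = 0.
Proof.
move=> pX; have t := vfield_tangent u (lift_vf b pX).
exact: (tangent_cst (@smoothT_cst R n M) t r).
Qed.

Lemma gg_inj_pf X Y : pf X -> pf Y -> (forall Z u, pf Z -> gg L X Z u = gg L Y Z u) -> X = Y.
Proof.
by move=> pX pY h; apply: (gg_inj hL pX pY) => Z u bZ; exact: (h Z u (basic_pi_field bZ)).
Qed.

Lemma gg_eta_neq0 u : gg L eta eta u != 0.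
Proof. by rewrite gg_eta // expf_neq0 // gt_eqF //; case: hL. Qed.

Lemma SS_formula_eta X Y Z : pf X -> pf Y -> pf Z -> Scurv nabla X Y Z =
  - dir_cov true X (Ttorsion nabla Y Z) - Ttorsion nabla X (dir_cov true Y Z - Ttorsion nabla Y Z)
  + dir_cov true Y (Ttorsion nabla X Z) + Ttorsion nabla Y (dir_cov true X Z - Ttorsion nabla X Z)
  + Ttorsion nabla (Scurv nabla X Y eta + dir_cov true X Y - dir_cov true Y X) Z.
Proof.
move=> pX pY pZ; have := SS_formula hL hC pX pY pZ.
by rewrite (bracket_vv_eta hL hC pX pY).
Qed.

Lemma curvature_consequences :
  [/\ forall X Y u, pf X -> pf Y -> gg L Y eta u = 0 -> gg L X Y u = 0 -> gg L Y Y u != 0 ->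
        dir_deriv true X k u = 0,
      forall Y Z u, pf Y -> pf Z -> gg L Z eta u = 0 -> gg L Y Z u = 0 -> gg L Z Z u != 0 ->
        dir_deriv false Y k u * gg L eta eta u = dir_deriv false eta k u * gg L Y eta u
    & (forall b X u, pf X -> dir_deriv b X k u = 0) -> (forall u, k u != 0) ->
      (forall X Y Z U u, pf X -> pf Y -> pf Z -> pf U ->
        gg L (Pcurv nabla X Y Z - Pcurv nabla Y X Z) U u =
        (gg L eta eta u)^-1 * gg L (CartanAlgebra.Dom eta dir_cov om X Y Z) U u) /\
      (forall X Y Z U u, pf X -> pf Y -> pf Z -> pf U ->
        gg L (Scurv nabla X Y Z) U u = (gg L eta eta u)^-1 *
          ((2 * k u * gg L eta eta u)^-1 * gg L (CartanAlgebra.DDom eta dir_cov om X Y Z) U u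
           + gg L (om X Y Z) U u))].
Proof.
apply: (CartanAlgebra.consequences (pf := pf) (sm := smT) (sc := @fscale R n M M) (RR := Rcurv nabla)
  (T := Ttorsion nabla) (d := dir_deriv)).
- exact: pi_fieldD.
- exact: pi_fieldN.
- exact: pi_field0.
- exact: fscale_pf.
- exact: pi_field_eta.
- exact: dir_cov_pf.
- by move=> X Y; exact: (T_pf hC).
- by move=> X Y Z; exact: (RR_pf hC).
- by move=> X Y Z; exact: (PP_pf hC).
- by move=> X Y Z; exact: (SS_pf hC).
- exact: om_pf.
- exact: hk.
- by move=> X Y; exact: (gg_smooth hL).
- exact: dir_deriv_sm.
- by move=> X Y Z u pX pY pZ; exact: (ggD hL pX pY pZ u).
- by move=> X Z u pX pZ; exact: (ggN hL pX pZ u).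
- by move=> F X Z u pX pZ; exact: (gg_scale hL F pX pZ u).
- by move=> X Y pX pY; exact: (ggC hL pX pY).
- exact: gg_inj_pf.
- exact: gg_eta_neq0.
- exact: dir_covD.
- exact: dir_covN.
- exact: dir_cov_scale.
- exact: dir_deriv_gg.
- by move=> b X u; exact: dir_deriv_cst.
- by move=> X pX; exact: (cov_hor_eta hC pX).
- by move=> X pX; exact: (cov_ver_eta hL hC pX).
- by move=> X Y pX pY; exact: (T_sym hL hC pX pY).
- by move=> X pX; exact: (T_eta_r hL hC pX).
- by move=> X Y Z u pX pY pZ; exact: (T_swap hC u pX pY pZ).
- by move=> X Y Z pX pY pZ; exact: (TDr hC pX pY pZ).
- by move=> X Y pX pY; exact: (TNr hL hC pX pY).
- by move=> X Y Z W u pX pY pZ pW; exact: (PP_skew hL hC u pX pY pZ pW).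
- by move=> X Y Z W u pX pY pZ pW; exact: (SS_skew hL hC u pX pY pZ pW).
- by move=> X Y Z pX pY pZ; exact: (SSC hC pX pY pZ).
- by move=> X Y Y' Z pX pY pY' pZ; exact: (PPDr hC pX pY pY' pZ).
- by move=> X X' Y Z pX pX' pY pZ; exact: (PPDl hC pX pX' pY pZ).
- by move=> F X Y Z sF pX pY pZ; exact: (PP_scaler hC sF pX pY pZ).
- by move=> X X' Y Z pX pX' pY pZ; exact: (SSDl hC pX pX' pY pZ).
- by move=> F X Y Z sF pX pY pZ; exact: (SS_scalel hC sF pX pY pZ).
- by move=> X Y Z pX pY pZ; exact: (PP_formula hL hC pX pY pZ).
- exact: SS_formula_eta.
- by move=> X Y Z W pX pY pZ pW; exact: (bianchi_hhh hL hC pX pY pZ pW).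
- by move=> X Y Z W pX pY pZ pW; exact: (bianchi_vhh hL hC pX pY pZ pW).
- exact: om_eta1.
- exact: om_eta2.
- exact: om_eta3.
- exact: omC.
- exact: om0r.
- exact: omNl.
- exact: Rcurv_E.
Qed.

End CurvatureCondition.

(** * Linear algebra in the tangent spaces *)

Section Geometry.
Context {R : realType} {n : nat} {M : manifold R n}.
Implicit Types (c : chart R n M) (p q : M) (x y a e : 'rV[R]_n) (u : slit M)
  (X Y Z W U : slit M -> vec R M).
Local Notation smM := (@smoothM R n M).
Local Notation pf := (@pi_field R n M).

Lemma row_kernel m (B : 'M[R]_(n, m)) : (m < n)%N -> exists2 y : 'rV[R]_n, y <> 0 & y *m B = 0.
Proof.
move=> mn; exists (nz_row (kermx B)).
  apply/eqP; rewrite nz_row_eq0 -mxrank_eq0 mxrank_ker -lt0n subn_gt0.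
  exact: leq_ltn_trans (rank_leq_col B) mn.
by apply: sub_kermxP; exact: nz_row_sub.
Qed.

(* Any nonzero [e] orthogonal to both vectors will do. *)
Lemma segments_avoid_zero y1 y2 : (2 < n)%N -> exists e, forall (t : R) y, y = y1 \/ y = y2 -> y <> 0 ->
  y + t *: (e - y) <> 0.
Proof.
move=> n3; pose B := (col_mx y1 y2)^T; have [w w0 wB] := row_kernel B n3.
exists w => t y yy y0 H.
have wy : w *m y^T = 0.
  move: wB; rewrite /B tr_col_mx mul_mx_row -row_mx0 => /eq_row_mx[e1 e2].
  by case: yy => ->.
have : (y + t *: (w - y)) *m y^T = 0 by rewrite H mul0mx.
rewrite scalerBr mulmxDl mulmxBl -!scalemxAl wy scaler0 sub0r => /matrixP/(_ 0 0).
set s := y *m y^T; rewrite !mxE => E.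
have s0 : 0 < s 0 0.
  rewrite /s mxE lt_def sumr_ge0 ?andbT => [|i _]; last by rewrite mxE -expr2 sqr_ge0.
  apply/eqP => S0; apply: y0; apply/rowP => i; rewrite mxE; apply/eqP.
  have P j : true -> 0 <= y 0 j * y^T j 0 by move=> _; rewrite mxE -expr2 sqr_ge0.
  by have /eqP := psumr_eq0P P S0 (i := i) isT; rewrite mxE -expr2 sqrf_eq0.
(* Since [w] is orthogonal to [y], pairing with [y] leaves (1 - t) times its squared length; and at
   t = 1 the vector is [w], which is nonzero. *)
have t1 : t = 1.
  have : (1 - t) * s 0 0 = 0 by rewrite mulrBl mul1r /s !mxE.
  by move/eqP; rewrite mulf_eq0 (gt_eqF s0) orbF subr_eq0 => /eqP.
by move: H; rewrite t1 scale1r addrC subrK.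
Qed.

Lemma pi_field_value u (v : vec R M) : tangent smM (slit_proj u) v -> exists2 Y, pf Y & Y u = v.
Proof. by move=> /basic_value[Y [bY <-]]; exists Y => //; exact: basic_pi_field. Qed.

Lemma slit_above p : (0 < n)%N -> exists u, slit_proj u = p.
Proof.
move=> n0; have [c ac cp] := atlas_cover p.
have z0 : slit_dom c (chart_coord c p, \row_(i < n) 1).
  by split=> /=; [exact: img_coord | move/rowP/(_ (Ordinal n0)); rewrite !mxE; exact/eqP/oner_neq0].
have [u su] := slit_param_Some ac z0; exists u.
by case: (slit_paramP su) => -> _ /=; rewrite coordK.
Qed.

Variable L : slit M -> R.
Hypothesis hL : finsler L.
Local Notation g := (finsler_metric L).

(** Two linear conditions on more than two components: a left kernel vector of an n by 2 matrix. *)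
Lemma perp_exists u (v1 v2 : vec R M) : (2 < n)%N -> tangent smM (slit_proj u) v1 ->
  tangent smM (slit_proj u) v2 -> exists v : vec R M,
  [/\ tangent smM (slit_proj u) v, v <> 0, g u v v1 = 0 & g u v v2 = 0].
Proof.
move=> n3 t1 t2; have [c [z [ac dz sz]]] := slit_coords_exists u.
have [pu _] := slit_paramP sz.
have tc a : tangent smM (slit_proj u) (coord_vec c z.1 a).
  by rewrite pu; apply: coord_vec_tangent => //; case: dz.
have lin v a : tangent smM (slit_proj u) v ->
    g u (coord_vec c z.1 a) v = \sum_i a 0 i * g u (coord_vec c z.1 (unit_row i)) v.
  move=> tv; have cd : img c z.1 by case: dz.
  have gl (r : R) b b' : g u (coord_vec c z.1 (r *: b + b')) v =
      r * g u (coord_vec c z.1 b) v + g u (coord_vec c z.1 b') v.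
    by rewrite coord_vec_lin // (fmetric_linl hL).
  have g00 : g u (coord_vec c z.1 0) v = 0.
    have := gl (-1) 0 0; rewrite scaler0 addr0 mulN1r addNr; exact.
  rewrite {1}(row_sum_unit a).
  elim/big_rec2: _ => [|i y1 y2 _ <-] //; exact: gl.
pose B : 'M[R]_(n, 2) := \matrix_(i, j) g u (coord_vec c z.1 (unit_row i)) (if j == 0 then v1 else v2).
have [y y0 yB] := row_kernel B n3; exists (coord_vec c z.1 y); split=> //.
- move=> e; apply: y0; apply: (@coord_vec_inj _ _ _ c z.1) => //; first by case: dz.
  by rewrite e coord_vec0 //; case: dz.
- have := congr1 (fun B : 'M[R]_(1, 2) => B 0 0) yB; rewrite !mxE => E; rewrite lin // -[RHS]E.
  by apply: eq_bigr => i _; rewrite mxE.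
- have := congr1 (fun B : 'M[R]_(1, 2) => B 0 1) yB; rewrite !mxE => E; rewrite lin // -[RHS]E.
  by apply: eq_bigr => i _; rewrite mxE.
Qed.

Lemma metric_separates u (v w : vec R M) : tangent smM (slit_proj u) v ->
  tangent smM (slit_proj u) w -> (forall v', tangent smM (slit_proj u) v' -> g u v v' = g u w v') -> v = w.
Proof.
move=> tv tw h; apply/eqP; rewrite -subr_eq0; apply/negPn/negP => /eqP n0.
have tm : tangent smM (slit_proj u) (-1 *: w + v).
  exact: tangent_lin.
have e : -1 *: w + v = v - w by rewrite scaleN1r addrC.
have := fmetric_pos hL tm; rewrite {1}e => /(_ n0).
by rewrite (fmetric_linl hL _ tw tv tm) h // mulN1r addNr ltxx.
Qed.

End Geometry.

(** * Constancy of the scalar *)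

Section Constancy.
Context {R : realType} {n : nat} {M : manifold R n}.
Implicit Types (c : chart R n M) (p q : M) (x y a e : 'rV[R]_n) (u : slit M)
  (z : 'rV[R]_n * 'rV[R]_n) (X Y Z W U : slit M -> vec R M).
Local Notation smM := (@smoothM R n M).
Local Notation smT := (@smoothT R n M).
Hypothesis n3 : (2 < n)%N.

Section FibreConstant.
Variable F : slit M -> R.
Hypotheses (sF : smT F)
  (vF : forall u (v : vec R M), tangent smM (slit_proj u) v -> gamma_map u v F = 0).

Lemma segment_constant c x y y' : atlas M c -> img c x ->
  (forall t : R, 0 <= t <= 1 -> y + t *: (y' - y) <> 0) -> loc c F (x, y') = loc c F (x, y).
Proof.
move=> ac cx ne; have d0 t : 0 <= t <= 1 -> slit_dom c (x, y + t *: (y' - y)) by move=> /ne.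
have -> : y' = y + (y' - y) by rewrite addrC subrK.
apply: (@derive0_const R 'rV[R]_n (fun y => loc c F (x, y))) => t t01.
  exact: (smooth_on_diff (smooth_on_slice (smoothT_loc sF ac)) (d0 _ t01)).
rewrite slice_derive -(slit_vecE _ _ _ sF).
have [u su] := slit_param_Some ac (d0 _ t01).
rewrite -(gamma_coord (z := (x, _)) _ ac (d0 _ t01) su) vF //.
by case: (slit_paramP su) => -> _; apply: coord_vec_tangent.
Qed.

(** A segment between two vectors may pass through zero. Both are joined instead to an auxiliary
    vector [e1] by segments that stay in the punctured fibre. *)
Lemma fibre_constant u u' : slit_proj u = slit_proj u' -> F u = F u'.
Proof.
move=> e; have [c [[x y] [ac dz su]]] := slit_coords_exists u.
have cu : chart_dom c (slit_proj u') by rewrite -e; exact: slit_param_dom su.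
have [[x' y'] [dz' su']] := slit_coords ac cu.
have e' : x' = x by have := slit_param_proj dz' su'; rewrite -e (slit_param_proj dz su).
subst x'; have [[cx y0] [_ y'0]] := (dz, dz').
have [e1 H] := segments_avoid_zero y y' n3.
rewrite -(locE F su) -(locE F su').
transitivity (loc c F (x, e1)); last by apply: segment_constant => // t _; apply: H => //; right.
by apply/esym/segment_constant => // t _; apply: H => //; left.
Qed.

Lemma loc_fibre c x y y' : atlas M c -> slit_dom c (x, y) -> slit_dom c (x, y') ->
  loc c F (x, y) = loc c F (x, y').
Proof.
move=> ac d1 d2; have [u1 s1] := slit_param_Some ac d1; have [u2 s2] := slit_param_Some ac d2.
rewrite (locE F s1) (locE F s2); apply: fibre_constant.
by case: (slit_paramP s1) => -> _; case: (slit_paramP s2) => -> _.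
Qed.

Lemma derive_shift (V W : normedModType R) (f : V -> W) (t v w : V) :
  'D_v (fun s => f (s + w)) t = 'D_v f (t + w).
Proof.
rewrite /derive; apply: (congr1 (fun G : R -> W => lim (G @ 0^'))).
by apply/funext => s /=; rewrite addrA.
Qed.

(** Near the point, translating by [y' - y] in the fibre stays in the domain and leaves [F]
    unchanged, so the two derivatives are those of locally equal functions. *)
Lemma derive_base_fibre c x y y' a : atlas M c -> slit_dom c (x, y) -> slit_dom c (x, y') ->
  'D_((a, 0) : 'rV[R]_n * 'rV[R]_n) (loc c F) (x, y) =
  'D_((a, 0) : 'rV[R]_n * 'rV[R]_n) (loc c F) (x, y').
Proof.
move=> ac d1 d2; pose w : 'rV[R]_n * 'rV[R]_n := (0, y' - y).
have ew : (x, y') = (x, y) + w by congr pair; rewrite /= ?addr0 // addrC subrK.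
rewrite ew -derive_shift; apply: near_eq_derive.
have o1 : open (slit_dom c) by exact: open_slit_domT.
have N1 := open_nbhs_nbhs (conj o1 d1); rewrite ew in d2.
have N2 : \forall z \near ((x, y) : 'rV[R]_n * 'rV[R]_n), slit_dom c (z + w).
  have : {for (x, y), continuous (fun z : 'rV[R]_n * 'rV[R]_n => z + w)}.
    by apply: cvgD; [exact: cvg_id | exact: cvg_cst].
  by apply; exact: (open_nbhs_nbhs (conj o1 d2)).
have key z : slit_dom c z -> slit_dom c (z + w) -> loc c F z = loc c F (z + w).
  case: z => x1 y1; have -> : (x1, y1) + w = (x1, y1 + (y' - y)) by congr pair; rewrite /= addr0.
  exact: loc_fibre.
by near=> z; apply: key; near: z.
Unshelve. all: by end_near. Qed.

Lemma derive_base (Phi : 'rV[R]_n * 'rV[R]_n -> R) z a : differentiable Phi z ->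
  'D_((a, 0) : 'rV[R]_n * 'rV[R]_n) Phi z =
  \sum_i a 0 i * 'D_((unit_row i, 0) : 'rV[R]_n * 'rV[R]_n) Phi z.
Proof.
move=> dPhi; rewrite deriveE // {1}(row_sum_unit a) -sum_pair_fst linear_sum.
by apply: eq_bigr => i _; rewrite linearZ deriveE.
Qed.

Hypothesis hF : forall c z a, atlas M c -> slit_dom c z ->
  'D_((z.2, 0) : 'rV[R]_n * 'rV[R]_n) (loc c F) z = 0 ->
  'D_((a, 0) : 'rV[R]_n * 'rV[R]_n) (loc c F) z = 0.

(* The base derivative does not depend on the point of the fibre, and by [hF] it
   vanishes at those [y] which lie in its kernel. *)
Lemma base_derive0 c z a : atlas M c -> slit_dom c z ->
  'D_((a, 0) : 'rV[R]_n * 'rV[R]_n) (loc c F) z = 0.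
Proof.
case: z => x y ac dz.
pose B : 'M[R]_(n, 1) := \col_i 'D_((unit_row i, 0) : 'rV[R]_n * 'rV[R]_n) (loc c F) (x, y).
have [y1 y10 yB] := row_kernel B (ltnW n3).
have d1 : slit_dom c (x, y1) by case: dz.
rewrite (@derive_base_fibre c x y y1) //; apply: hF => //=.
rewrite -(@derive_base_fibre c x y) // derive_base; last exact: loc_diff.
have := congr1 (fun B : 'M[R]_1 => B 0 0) yB; rewrite !mxE => E; rewrite -[RHS]E.
by apply: eq_bigr => i _; rewrite mxE.
Qed.

(** Over a coordinate ball every point is compared with the centre: move the base point along a
    segment with the fibre coordinate fixed, then change the vector within the fibre over the
    centre. *)
Lemma locally_constant p : exists N : set M, [/\ open N, N p
  & forall u u', N (slit_proj u) -> N (slit_proj u') -> F u = F u'].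
Proof.
have [c ac cp] := atlas_cover p; set x0 := chart_coord c p.
have cx0 : img c x0 by exact: img_coord.
have /nbhs_ballP[r r0 br] : nbhs x0 (img c) by apply: open_nbhs_nbhs; split => //; exact: open_img.
exists (chart_dom c `&` chart_coord c @^-1` [set x | `|x - x0| < r]); split.
- by apply: open_dom_preimage; exact: open_ball_row.
- by split=> //=; rewrite subrr normr0.
have inb x : `|x - x0| < r -> img c x.
  by move=> xr; apply: br; rewrite /= -ball_normE /= distrC.
have key u : chart_dom c (slit_proj u) -> `|chart_coord c (slit_proj u) - x0| < r ->
    forall u0, slit_proj u0 = p -> F u = F u0.
  move=> cu ur u0 e0; have [[x y] [dz su]] := slit_coords ac cu.
  rewrite (slit_param_proj dz su) /= in ur.
  have [_ /= y0] := dz.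
  have d0 : slit_dom c (x0, y) by [].
  have dt (t : R) : 0 <= t <= 1 -> slit_dom c ((x0, y) + t *: ((x - x0, 0) : 'rV[R]_n * 'rV[R]_n)).
    move=> /andP[t0 t1]; split; rewrite /= ?scaler0 ?addr0 //; apply: inb.
    rewrite addrAC subrr add0r normrZ ger0_norm //; apply: le_lt_trans ur.
    by rewrite ler_piMl.
  have := @derive0_const _ _ (loc c F) (x0, y) (x - x0, 0).
  have -> : (x0, y) + (x - x0, 0) = (x, y) :> 'rV[R]_n * 'rV[R]_n.
    by congr pair; rewrite /= ?addr0 // addrC subrK.
  rewrite (locE F su) => -> => [|t /dt d|t /dt d]; last 2 first.
  - exact: loc_diff.
  - exact: base_derive0.
  have [u1 su1] := slit_param_Some ac d0; rewrite (locE F su1).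
  by apply: fibre_constant; case: (slit_paramP su1) => -> _; rewrite e0 /= coordK.
move=> u u' [c1 r1] [c2 r2]; have [u0 e0] := slit_above p (ltnW (ltnW n3)).
by rewrite (key u c1 r1 u0 e0) (key u' c2 r2 u0 e0).
Qed.

Hypothesis hM : connected [set: M].

(** The set of base points over which [F] takes the value [F u0] is nonempty, open and closed. *)
Lemma globally_constant : exists b : R, forall u, F u = b.
Proof.
(* Connectedness does not exclude an empty manifold, over which any value will do. *)
have [[u0 _]|ne] := pselect (exists u0 : slit M, True); last first.
  by exists 0 => u; case: ne; exists u.
exists (F u0); pose A := [set p | forall u, slit_proj u = p -> F u = F u0].
suff AT : A = setT by move=> u; have Au : A (slit_proj u) by [rewrite AT]; exact: Au.
apply: hM.
- by exists (slit_proj u0) => u /fibre_constant.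
- exists A; last by rewrite setTI.
  rewrite openE => p Ap; have [N [oN Np NF]] := locally_constant p.
  apply: (filterS _ (open_nbhs_nbhs (conj oN Np))) => q Nq u eu.
  have [v ev] := slit_above p (ltnW (ltnW n3)).
  by rewrite -(Ap v ev); apply: NF; rewrite ?eu ?ev.
- exists A; last by rewrite setTI.
  rewrite -[A]setCK; apply: open_closedC; rewrite openE => p nAp.
  have [N [oN Np NF]] := locally_constant p.
  apply: (filterS _ (open_nbhs_nbhs (conj oN Np))) => q Nq Aq; apply: nAp => u eu.
  have [v ev] := slit_above q (ltnW (ltnW n3)).
  by rewrite -(Aq v ev); apply: NF; rewrite ?eu ?ev.
Qed.

End FibreConstant.
End Constancy.

Section Conclusion.
Context {R : realType} {n : nat} {M : manifold R n}.
Implicit Types (c : chart R n M) (p q : M) (a : 'rV[R]_n) (u : slit M)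
  (z : 'rV[R]_n * 'rV[R]_n) (X Y Z W U : slit M -> vec R M).
Local Notation smM := (@smoothM R n M).
Local Notation smT := (@smoothT R n M).
Local Notation pf := (@pi_field R n M).
Local Notation eta := (@eta_field R n M).
Variables (L : slit M -> R) (nabla : connection_map M) (omega : tensor13 M) (k : slit M -> R).
Hypotheses (n3 : (2 < n)%N) (hL : finsler L) (hC : is_cartan nabla L) (homega : pi_tensor13 omega)
  (homega_ind : indicatory omega) (homega_skew : skew12 omega) (hk : smT k)
  (hR : forall X Y Z, pf X -> pf Y -> pf Z -> forall u, Rcurv nabla X Y Z u =
     k u *: (finsler_metric L u (X u) (Z u) *: Y u - finsler_metric L u (Y u) (Z u) *: X u
             + omega u (X u) (Y u) (Z u))).
Local Notation om := (tensor_on_fields omega).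
Local Notation g := (finsler_metric L).

Let conn : is_connection nabla. Proof. by case: hC. Qed.

Let conseq := curvature_consequences hL hC homega homega_ind homega_skew hk hR.

Lemma perp_field u X : pf X -> exists Y, [/\ pf Y, gg L Y eta u = 0, gg L X Y u = 0 & gg L Y Y u != 0].
Proof.
move=> pX; have tX := pi_field_tangent u pX; have te := slit_tangent u.
have [v [tv v0 e1 e2]] := perp_exists hL n3 te tX.
have [Y pY Yv] := pi_field_value tv; exists Y; split; first exact: pY.
- by rewrite /gg Yv; exact: e1.
- by rewrite /gg Yv (fmetric_sym hL tX tv); exact: e2.
- by apply/lt0r_neq0; rewrite /gg Yv; exact: (fmetric_pos hL tv v0).
Qed.

Lemma vertical_k u (v : vec R M) : tangent smM (slit_proj u) v -> gamma_map u v k = 0.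
Proof.
move=> tv; have [X pX <-] := pi_field_value tv.
have [Y [pY e1 e2 e3]] := perp_field u pX.
by case: conseq => H _ _; exact: (H X Y u pX pY e1 e2 e3).
Qed.

Lemma horizontal_k X u : pf X -> dir_deriv nabla false eta k u = 0 -> dir_deriv nabla false X k u = 0.
Proof.
move=> pX e0; have [Y [pY e1 e2 e3]] := perp_field u pX.
case: conseq => _ H _; have := H X Y u pX pY e1 e2 e3; rewrite e0 mul0r => /eqP.
by rewrite mulf_eq0 (negbTE (gg_eta_neq0 hL u)) orbF => /eqP.
Qed.

(** Passes from horizontal to coordinate derivatives. The coordinate vector [(a, 0)] differs from
    the horizontal lift of its projection by a vertical vector, which annihilates [k]; for the
    direction [z.2] that projection is [eta]. *)
Lemma base_k c z a : atlas M c -> slit_dom c z ->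
  'D_((z.2, 0) : 'rV[R]_n * 'rV[R]_n) (loc c k) z = 0 ->
  'D_((a, 0) : 'rV[R]_n * 'rV[R]_n) (loc c k) z = 0.
Proof.
move=> ac dz; have [u su] := slit_param_Some ac dz.
have cu : chart_dom c (slit_proj u) by exact: slit_param_dom su.
have [b [_ bp lft]] := lift_exists ac cu.
have b1 : b (slit_proj u) = 1 by exact: nbhs_singleton bp.
have key e : exists X, [/\ pf X, X u = coord_vec c z.1 e
    & 'D_((e, 0) : 'rV[R]_n * 'rV[R]_n) (loc c k) z = dir_deriv nabla false X k u].
  have [A [vA AE]] := lft (e, 0); have Au := AE z u dz su; rewrite b1 scale1r in Au.
  exists (rho_field A); split; first exact: rho_field_pf.
    by rewrite /rho_field Au (slit_vec_rho (e, 0) ac dz su).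
  rewrite -slit_vecE // -Au.
  have := congr1 (fun B => B u k) (hor_ver_decomp hL hC vA) => /= ->.
  have pK : pf (cov nabla A eta) by exact: (cv_pf hC vA (@pi_field_eta R n M)).
  rewrite fieldDE /ver (vertical_k (pi_field_tangent u pK)) addr0.
  by [].
have [X [pX Xu ->]] := key a; have [E [pE Eu ->]] := key z.2.
have E_eta : E u = eta u by case: (slit_paramP su) => _ ->.
move=> H; apply: (horizontal_k pX); rewrite -[RHS]H.
exact: (congr1 (fun v => beta_map nabla u v k) (esym E_eta)).
Qed.

Lemma k_constant : connected [set: M] -> exists b : R, forall u, k u = b.
Proof. exact: (globally_constant n3 hk vertical_k base_k). Qed.

Section NonzeroCurvature.
Variable b : R.
Hypotheses (kb : forall u, k u = b) (b0 : b <> 0).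

Let dk0 i X u : pf X -> dir_deriv nabla i X k u = 0.
Proof.
move=> pX; have -> : k = fun=> b by exact/funext.
exact: (dir_deriv_cst hC).
Qed.

Let k0 u : k u != 0. Proof. by rewrite kb; apply/eqP. Qed.

Lemma field_separates X Y u : pf X -> pf Y -> (forall U, pf U -> g u (X u) (U u) = g u (Y u) (U u)) ->
  X u = Y u.
Proof.
move=> pX pY h; apply: (metric_separates hL (pi_field_tangent u pX) (pi_field_tangent u pY)) => v tv.
by have [U pU <-] := pi_field_value tv; exact: h.
Qed.

Lemma hcov3_eta_pf X Y Z : pf X -> pf Y -> pf Z -> pf (cov3 nabla (hor nabla eta) om X Y Z).
Proof.
move=> pX pY pZ; have vh := hor_vf hC (@pi_field_eta R n M).
have pc A : pf A -> pf (cov nabla (hor nabla eta) A) by move=> pA; exact: (cv_pf hC vh pA).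
have po A B C := @om_pf _ _ _ omega homega A B C.
by rewrite /cov3; apply: pi_fieldB; [apply: pi_fieldB; [apply: pi_fieldB|]|]; auto.
Qed.

(** Needed for the term of [hcov4] that differentiates its first argument: along the horizontal lift
    of [eta] the derivative of [eta] is the zero field. *)
Lemma hcov3_0 X Y Z : pf X -> pf Y -> pf Z -> hcov3 nabla om 0 X Y Z = 0.
Proof.
move=> pX pY pZ; rewrite /hcov3 /cov3 (hor0 hC).
have cl A : pf A -> cov nabla 0 A = 0 by move=> pA; exact: (cov0l conn pA).
have p0 := @pi_field0 R n M.
rewrite (cl _ (om_pf homega pX pY pZ)) (cl _ pX) (cl _ pY) (cl _ pZ).
rewrite (omC homega_skew pX p0 pZ) (om0l homega pY pZ) (om0l homega pX pZ) (om0r homega pX pY).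
by rewrite !oppr0 !addr0.
Qed.

Lemma hcov4_eta X Y Z : pf X -> pf Y -> pf Z ->
  hcov4 nabla (hcov3 nabla om) eta eta X Y Z = CartanAlgebra.DDom eta (dir_cov nabla) om X Y Z.
Proof.
move=> pX pY pZ.
by rewrite /hcov4 /cov4 (cov_hor_eta hC (@pi_field_eta R n M)) (hcov3_0 pX pY pZ) subr0.
Qed.

Lemma hcov4_eta_pf X Y Z : pf X -> pf Y -> pf Z ->
  pf (CartanAlgebra.DDom eta (dir_cov nabla) om X Y Z).
Proof.
move=> pX pY pZ; have vh := hor_vf hC (@pi_field_eta R n M).
have pc A : pf A -> pf (dir_cov nabla false eta A) by move=> pA; exact: (cv_pf hC vh pA).
have po A B C : pf A -> pf B -> pf C -> pf (CartanAlgebra.Dom eta (dir_cov nabla) om A B C).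
  exact: hcov3_eta_pf.
by rewrite /CartanAlgebra.DDom; apply: pi_fieldB; [apply: pi_fieldB; [apply: pi_fieldB|]|]; auto.
Qed.

Lemma P_antisymmetrization X Y Z u : pf X -> pf Y -> pf Z ->
  Pcurv nabla X Y Z u - Pcurv nabla Y X Z u =
  (L u ^+ 2)^-1 *: cov3 nabla (hor nabla eta) om X Y Z u.
Proof.
(* [r] is the value at the single point [u], hence a constant coefficient, and the right side
   remains a smooth field; only values at [u] are compared. *)
move=> pX pY pZ; set r := (L u ^+ 2)^-1.
have pD := hcov3_eta_pf pX pY pZ.
have p1 := pi_fieldB (PP_pf hC pX pY pZ) (PP_pf hC pY pX pZ).
have p2 := fscale_pf (smoothT_cst r) pD.
apply: (field_separates (u := u) p1 p2) => U pU.
case: conseq => _ _ /(_ dk0 k0)[H _].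
have e1 := H X Y Z U u pX pY pZ pU; rewrite (gg_eta hL u) in e1.
exact: etrans e1 (esym (gg_scale hL (fun=> r) pD pU u)).
Qed.

Lemma S_formula X Y Z u : pf X -> pf Y -> pf Z ->
  Scurv nabla X Y Z u = (L u ^+ 2)^-1 *:
    ((2 * b * L u ^+ 2)^-1 *: hcov4 nabla (hcov3 nabla om) eta eta X Y Z u
     + omega u (X u) (Y u) (Z u)).
Proof.
move=> pX pY pZ; rewrite (hcov4_eta pX pY pZ).
set r := (L u ^+ 2)^-1; set s := (2 * b * L u ^+ 2)^-1.
have pD := hcov4_eta_pf pX pY pZ; have po := om_pf homega pX pY pZ.
have p3 := fscale_pf (smoothT_cst s) pD; have p4 := pi_fieldD p3 po.
apply: (field_separates (u := u) (SS_pf hC pX pY pZ) (fscale_pf (smoothT_cst r) p4)) => U pU.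
case: conseq => _ _ /(_ dk0 k0)[_ H].
have e1 := H X Y Z U u pX pY pZ pU; rewrite (gg_eta hL u) kb in e1.
have e2 := gg_scale hL (fun=> r) p4 pU u; have e3 := ggD hL p3 po pU u.
have e4 := gg_scale hL (fun=> s) pD pU u.
by rewrite e3 e4 in e2; exact: etrans e1 (esym e2).
Qed.

End NonzeroCurvature.
End Conclusion.

Theorem theorem3p1 (R : realType) (n : nat) (M : manifold R n)
    (L : slit M -> R) (nabla : connection_map M)
    (omega : tensor13 M) (k : slit M -> R)
    (hn : (3 <= n)%N)
    (hM : connected [set: M])
    (hL : finsler L)
    (hnabla : is_cartan nabla L)
    (homega : pi_tensor13 omega)
    (homega_ind : indicatory omega)
    (homega_skew : skew12 omega)
    (homega_h0 : homogeneous0_tensor nabla omega)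
    (hk : smoothT k)
    (hk_h0 : homogeneous0_fun k)
    (hR : forall X Y Z : slit M -> vec R M,
      pi_field X -> pi_field Y -> pi_field Z ->
      forall u : slit M,
        Rcurv nabla X Y Z u =
          k u *: (finsler_metric L u (X u) (Z u) *: Y u
                  - finsler_metric L u (Y u) (Z u) *: X u
                  + omega u (X u) (Y u) (Z u))) :
  exists c : R,
    (forall u : slit M, k u = c) /\
    (c <> 0 ->
     forall X Y Z : slit M -> vec R M,
       pi_field X -> pi_field Y -> pi_field Z ->
       forall u : slit M,
         (Pcurv nabla X Y Z u - Pcurv nabla Y X Z u =
            (L u ^+ 2)^-1 *:
              cov3 nabla (hor nabla (@eta_field R n M)) (tensor_on_fields omega)
                X Y Z u) /\
         (Scurv nabla X Y Z u =
            (L u ^+ 2)^-1 *: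
              ((2 * c * L u ^+ 2)^-1 *:
                 hcov4 nabla (hcov3 nabla (tensor_on_fields omega))
                   (@eta_field R n M) (@eta_field R n M) X Y Z u
               + omega u (X u) (Y u) (Z u)))).
Proof.
have [c kc] := k_constant hn hL hnabla homega homega_ind homega_skew hk hR hM.
exists c; split=> // c0 X Y Z pX pY pZ u; split.
  exact: (P_antisymmetrization hL hnabla homega homega_ind homega_skew hk hR kc c0 u pX pY pZ).
exact: (S_formula hL hnabla homega homega_ind homega_skew hk hR kc c0 u pX pY pZ).
Qed.
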